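(* Let $K$ be a number field and $O_K$ the ring of integers of $K$. The following two statements (about the fixed field $K$) are equivalent: (i) Every polynomial map $F=(P,Q)\in K[x,y]^2$ with $\det DF\equiv 1$ is invertible over $K$. (ii) For every $F=(P,Q)\in O_K[x,y]^2$ with $\det DF\equiv 1$, the curve $P=0$ has more than one integral point.
   Context: For $F=(P,Q)\in K[x,y]^2$, $\det DF=P_xQ_y-P_yQ_x$ is the Jacobian determinant, where subscripts denote partial derivatives. $F$ is invertible over $K$ if $F$, viewed as a polynomial map, has an inverse in $K[x,y]^2$, i.e. there is $G\in K[x,y]^2$ with $F\circ G=G\circ F=(x,y)$. An integral point is a point with coordinates in $O_K$; thus the integral points of the curve $P=0$ are the $(a,b)\in O_K^2$ with $P(a,b)=0$. *)

(* Defs.v *)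
(* Number fields are modelled as [K : fieldExtType rat]. *)
From HB Require Import structures.
From mathcomp Require Import all_boot all_order all_algebra all_field.
From mathcomp Require Import mpoly.

Set Implicit Arguments.
Unset Strict Implicit.
Unset Printing Implicit Defensive.

Import GRing.Theory.
Local Open Scope ring_scope.

Definition ring_of_integers (K : fieldExtType rat) (a : K) : Prop :=
  integralOver (intr : int -> K) a.

(* The variables x and y of K[x, y] are 'X_0 and 'X_1, with 0 1 : 'I_2. *)

Definition jacobian_det (R : comNzRingType) (P Q : {mpoly R[2]})
    : {mpoly R[2]} :=
  P^`M(0) * Q^`M(1) - P^`M(1) * Q^`M(0).

(* The two conjuncts are F o G = (x, y) and G o F = (x, y), for F = (P, Q)
   and G = (G1, G2). *)
Definition invertible_map (R : comNzRingType) (P Q : {mpoly R[2]}) : Prop :=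
  exists G1 G2 : {mpoly R[2]},
    (P \mPo [tuple G1; G2] = 'X_0 /\ Q \mPo [tuple G1; G2] = 'X_1) /\
    (G1 \mPo [tuple P; Q] = 'X_0 /\ G2 \mPo [tuple P; Q] = 'X_1).

Definition integral_coefs (K : fieldExtType rat) (P : {mpoly K[2]}) : Prop :=
  forall m : 'X_{1..2}, ring_of_integers P@_m.

Definition integral_point (K : fieldExtType rat) (P : {mpoly K[2]})
    (c : K * K) : Prop :=
  [/\ ring_of_integers c.1, ring_of_integers c.2
    & P.@[tnth [tuple c.1; c.2]] = 0].

(* Main.v *)
Require Import Defs.
From HB Require Import structures.
From Stdlib Require Import Classical.
From mathcomp Require Import all_boot all_order all_algebra all_field.
From mathcomp Require Import mpoly ssrcomplements.
From mathcomp Require Import ring lra zify.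

Set Implicit Arguments.
Unset Strict Implicit.
Unset Printing Implicit Defensive.

Import Order.TTheory GRing.Theory Num.Theory.
Local Open Scope ring_scope.

(** Why the theorem holds.

    Let F = (P, Q) have Jacobian determinant 1.  The derivations
    D1 = [jacobian_det (- Q)] and D2 = [jacobian_det P] satisfy
    D1 P = D2 Q = 1 and D1 Q = D2 P = 0: they are the partial derivatives with
    respect to P and Q, and they commute.

    From (i) to (ii).  If F has integral coefficients and inverse G, then G maps
    integral points to integral points, and G (0, 0), G (0, 1) are two integral
    points of P = 0.  Indeed, after an affine change of coordinates F is tangent
    to the identity, and the coefficients of G are then computed from those of
    G o F by a triangular system with integral entries ([coefs_in_comp],
    [integral_inverse]).

    From (ii) to (i) there are three steps.

    Step 1, [nilpotent_invertible].  If a power of D1 and a power of D2 kill x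
    and y, integration with respect to P and Q writes x and y as polynomials in
    P and Q, and P, Q are algebraically independent, so this inverse is
    two-sided.  The symmetry (P, Q) -> (- Q, P) leaves D2 to be treated.

    Step 2, [integral_nilpotent].  Suppose that x and y are integral over
    K(P)[Q], that is, satisfy relations over K[P, Q] whose leading coefficients
    lie in K[P].  Embed K into the complex numbers.  Along the flow of D2, P is
    constant and Q moves by the time t, so x and y become power series in t
    which are integral over polynomials in t.  Where they converge, this bounds
    them in terms of the modulus of t alone; and from a bounded point the flow
    continues them a fixed distance further.  So they are entire, of polynomial
    growth, hence polynomials, of a degree bounded independently of the starting
    point.  The algebraic complex numbers suffice
    for this, as finite truncations of the series replace limits.

    Step 3, [coordinates_integral].  Under (ii) the coordinates are integral
    over K(P)[Q].  Otherwise Runge's method applies.  Let z be a coordinate that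
    is not integral, and Pi (P, Q, z) = 0 a relation of least degree in z with
    coprime coefficients ([primitive_relation]); its leading coefficient a (u, v)
    has positive degree in v.  There is a curve u = h (t), v = t - theta h (t)
    along which a is divisible by pairwise coprime p_0 (t), ..., p_m (t), with m
    the number of embeddings of K.  For every j, linear algebra provides a
    polynomial g_j in t and z which is small at every place where t is large
    and p_j (t) is not small against it ([auxiliary_function],
    [good_place_bound]), and g_j is coprime to the relation because the p_j-adic behaviour of their leading
    coefficients differs ([local_auxiliary]).  At each place at most one p_j (t)
    is small, so for every integral point on the curve some g_j is small at
    all places; its norm is then less than 1, so g_j = 0, and t is a root of
    one of finitely many polynomials.  Hence the product of the absolute values
    of t is bounded ([runge_bounded]).

    Finally, F' = (P - h (Q + theta P), Q + theta P) has Jacobian determinant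
    1.  With N the inverse of its linear part and lambda a large, highly
    divisible integer, F'' = lambda^-1 F' (lambda N X) has integral coefficients
    and is the identity plus twice an integral map of order at least 2.  An
    integral zero of the first component of F'' gives a point of the curve above
    with t = lambda t' and t' integral.  The bound on t forces t' = 0, so the
    point is a common zero of both components, and is (0, 0) because a
    determinant congruent to 1 modulo 2 is not zero ([tangent_id_zero]).  So the
    curve defined by that component has only one integral point, against (ii). *)

(** * Substitution in iterated polynomial rings *)
Section Evaluation.
Variables (R S : comNzRingType) (f : {rmorphism R -> S}).

(** Relations between P, Q and z are elements of {poly {poly {poly R}}}: the
    innermost variable u stands for P, then v for Q, and the outermost for z. *)
Definition ev1 (p : S) : {rmorphism {poly R} -> S} :=
  horner_morph (fun c => mulrC p (f c)).

Definition ev2 (p q : S) : {rmorphism {poly {poly R}} -> S} :=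
  horner_morph (fun c => mulrC q (ev1 p c)).

Definition ev3 (p q z : S) : {rmorphism {poly {poly {poly R}}} -> S} :=
  horner_morph (fun c => mulrC z (ev2 p q c)).

Lemma ev1C p c : ev1 p c%:P = f c. Proof. exact: horner_morphC. Qed.
Lemma ev1X p : ev1 p 'X = p. Proof. exact: horner_morphX. Qed.
Lemma ev2C p q c : ev2 p q c%:P = ev1 p c. Proof. exact: horner_morphC. Qed.
Lemma ev2X p q : ev2 p q 'X = q. Proof. exact: horner_morphX. Qed.
Lemma ev3C p q z c : ev3 p q z c%:P = ev2 p q c. Proof. exact: horner_morphC. Qed.
Lemma ev3X p q z : ev3 p q z 'X = z. Proof. exact: horner_morphX. Qed.

Section Deriv.
Variable d : S -> S.
Hypothesis dD : {morph d : x y / x + y}.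
Hypothesis dM : forall x y, d (x * y) = d x * y + x * d y.
Hypothesis dC : forall c, d (f c) = 0.

Lemma deriv_ev1 p a : d (ev1 p a) = ev1 p a^`() * d p.
Proof.
elim/poly_ind: a => [|a c IH].
  by rewrite deriv0 !rmorph0 mul0r -[0 in LHS](rmorph0 f) dC.
rewrite derivMXaddC !rmorphD !rmorphM /= !ev1X ev1C dD dM dC IH.
by ring.
Qed.

Lemma deriv_ev2 p q a :
  d (ev2 p q a) = ev2 p q (map_poly (@deriv R) a) * d p + ev2 p q a^`() * d q.
Proof.
elim/poly_ind: a => [|a c IH].
  by rewrite deriv0 map_poly0 !rmorph0 !mul0r -[0 in LHS](rmorph0 f) dC addr0.
have -> : map_poly (@deriv R) (a * 'X + c%:P)
   = map_poly (@deriv R) a * 'X + (c^`())%:P.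
  apply/polyP=> i; rewrite coef_map_id0 ?deriv0 // !coefD !coefMX !coefC.
  case: i => [|i] /=; first by rewrite !add0r.
  by rewrite !addr0 coef_map_id0 ?deriv0.
rewrite derivMXaddC !rmorphD !rmorphM /= !ev2X !ev2C dD dM deriv_ev1 IH.
by ring.
Qed.

End Deriv.
End Evaluation.

Arguments ev1 : simpl never.
Arguments ev2 : simpl never.
Arguments ev3 : simpl never.

Lemma eq_ev1 (R S : comNzRingType) (f g : {rmorphism R -> S}) p a :
  f =1 g -> ev1 f p a = ev1 g p a.
Proof. by move=> fg; rewrite /= /horner_morph (eq_map_poly fg). Qed.

Lemma eq_ev2 (R S : comNzRingType) (f g : {rmorphism R -> S}) p q a :
  f =1 g -> ev2 f p q a = ev2 g p q a.
Proof.
move=> fg; rewrite /= /horner_morph; congr _.[_]; apply: eq_map_poly => c.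
exact: eq_ev1.
Qed.

Lemma eq_ev3 (R S : comNzRingType) (f g : {rmorphism R -> S}) p q z a :
  f =1 g -> ev3 f p q z a = ev3 g p q z a.
Proof.
move=> fg; rewrite /= /horner_morph; congr _.[_]; apply: eq_map_poly => c.
exact: eq_ev2.
Qed.

Lemma rmorph_ev1 (R S T : comNzRingType) (f : {rmorphism R -> S})
    (g : {rmorphism S -> T}) p a : g (ev1 f p a) = ev1 (g \o f) (g p) a.
Proof.
elim/poly_ind: a => [|a c IH]; first by rewrite !rmorph0.
by rewrite !rmorphD !rmorphM /= !ev1X !ev1C IH.
Qed.

Lemma rmorph_ev2 (R S T : comNzRingType) (f : {rmorphism R -> S})
    (g : {rmorphism S -> T}) p q a :
  g (ev2 f p q a) = ev2 (g \o f) (g p) (g q) a.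
Proof.
elim/poly_ind: a => [|a c IH]; first by rewrite !rmorph0.
by rewrite !rmorphD !rmorphM /= !ev2X !ev2C IH rmorph_ev1.
Qed.

Lemma rmorph_ev3 (R S T : comNzRingType) (f : {rmorphism R -> S})
    (g : {rmorphism S -> T}) p q z a :
  g (ev3 f p q z a) = ev3 (g \o f) (g p) (g q) (g z) a.
Proof.
elim/poly_ind: a => [|a c IH]; first by rewrite !rmorph0.
by rewrite !rmorphD !rmorphM /= !ev3X !ev3C IH rmorph_ev2.
Qed.

(** * The Jacobian derivations and local nilpotence *)
Section Jacobian.
Variable R : comNzRingType.
Implicit Types P Q f g : {mpoly R[2]}.

Lemma jacobianD P : {morph jacobian_det P : f g / f + g}.
Proof. by move=> f g; rewrite /jacobian_det !mderivD; ring. Qed.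

Lemma jacobianM P f g :
  jacobian_det P (f * g) = jacobian_det P f * g + f * jacobian_det P g.
Proof. by rewrite /jacobian_det !mderivM; ring. Qed.

Lemma jacobianC P c : jacobian_det P c%:MP = 0.
Proof. by rewrite /jacobian_det !mderivC !mulr0 subrr. Qed.

Lemma jacobianN P f : jacobian_det P (- f) = - jacobian_det P f.
Proof. by rewrite /jacobian_det !mderivN; ring. Qed.

Lemma jacobianZ P c f : jacobian_det P (c *: f) = c *: jacobian_det P f.
Proof. by rewrite -!mul_mpolyC jacobianM jacobianC mul0r add0r. Qed.

Lemma jacobian_self P : jacobian_det P P = 0.
Proof. by rewrite /jacobian_det; ring. Qed.

Lemma jacobian_swap P Q : jacobian_det (- Q) P = jacobian_det P Q.
Proof. by rewrite /jacobian_det !mderivN; ring. Qed.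

Lemma jacobian0 P : jacobian_det P 0 = 0.
Proof. by rewrite -mpolyC0 jacobianC. Qed.

(** The commutator of the two derivations is the derivation attached to the
    Jacobian determinant, here a constant. *)
Lemma jacobian_comm P Q f : jacobian_det P Q = 1 ->
  jacobian_det (- Q) (jacobian_det P f) = jacobian_det P (jacobian_det (- Q) f).
Proof.
move=> h.
have h0 : (jacobian_det P Q)^`M(0) = 0 by rewrite h -mpolyC1 mderivC.
have h1 : (jacobian_det P Q)^`M(1) = 0 by rewrite h -mpolyC1 mderivC.
move: h0 h1; rewrite /jacobian_det !(mderivB, mderivM, mderivN).
have eP := mderiv_comm 0 1 P; have eQ := mderiv_comm 0 1 Q.
have ef := mderiv_comm 0 1 f; move: eP eQ ef.
set f0 := f^`M(0); set f1 := f^`M(1).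
set A := P^`M(0); set B := P^`M(1); set C := Q^`M(0); set E := Q^`M(1).
move=> -> -> -> h0 h1; apply/eqP; rewrite -subr_eq0; apply/eqP.
transitivity (f1 * 0 - f0 * 0 : {mpoly R[2]}); last by rewrite !mulr0 subrr.
by rewrite -{1}h0 -{1}h1; ring.
Qed.

End Jacobian.

Lemma ord2P (i : 'I_2) : i = 0 \/ i = 1.
Proof. by case: i => [[|[|i]] hi] //; [left | right]; apply: val_inj. Qed.

Section Bivariate.
Variable R : comNzRingType.

Lemma mpolyX2 (m : 'X_{1..2}) :
  'X_[m] = 'X_0 ^+ m 0 * 'X_1 ^+ m 1 :> {mpoly R[2]}.
Proof.
rewrite mpolyXE_id !big_ord_recl big_ord0 mulr1.
by have -> : lift ord0 ord0 = 1 :> 'I_2 by apply: val_inj.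
Qed.

(** Nested polynomials are easier to do induction on, and to substitute in,
    than multivariate ones. *)
Lemma mpoly2_ev (T : {mpoly R[2]}) :
  exists t, T = ev2 (@mpolyC 2 R) 'X_0 'X_1 t.
Proof.
elim/mpolyind: T => [|c m T _ _ [t ->]]; first by exists 0; rewrite rmorph0.
exists (c%:P%:P * (('X%:P) ^+ m 0 * 'X ^+ m 1) + t).
rewrite rmorphD /= !rmorphM /= !rmorphXn /= !ev2C ev2X ev1C ev1X.
by rewrite -mul_mpolyC mpolyX2.
Qed.

Lemma comp_ev2 (P Q : {mpoly R[2]}) t :
  ev2 (@mpolyC 2 R) 'X_0 'X_1 t \mPo [tuple P; Q] = ev2 (@mpolyC 2 R) P Q t.
Proof.
elim/poly_ind: t => [|t c IH]; first by rewrite !rmorph0.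
rewrite !rmorphD !rmorphM /= !ev2X !ev2C IH comp_mpolyXU /=; congr (_ + _).
elim/poly_ind: c => [|c k IHc]; first by rewrite !rmorph0.
by rewrite !rmorphD !rmorphM /= !ev1X !ev1C IHc comp_mpolyXU comp_mpolyC.
Qed.

End Bivariate.

Section Keller.
Variable F : fieldType.
Hypothesis char0 : [pchar F] =i pred0.
Implicit Types P Q f g : {mpoly F[2]}.

Lemma natr_neq0_char0 n : (n.+1%:R : F) != 0.
Proof. by rewrite ((pcharf0P F).1 char0). Qed.

Lemma mderiv_eq0_const f : f^`M(0) = 0 -> f^`M(1) = 0 -> f = (f@_0)%:MP.
Proof.
move=> f0 f1; apply/mpolyP=> m; rewrite mcoeffC.
have [->|m0] := eqVneq m 0%MM; first by rewrite mulr1.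
rewrite mulr0.
have key (i : 'I_2) : f^`M(i) = 0 -> (0 < m i)%N -> f@_m = 0.
  move=> fi mi; have := congr1 (fun p : {mpoly F[2]} => p@_(m - U_(i))%MM) fi.
  rewrite mcoeff_mderiv mcoeff0 submK; last first.
    by apply/mnm_lepP=> j; rewrite mnm1E; case: eqP => // <-.
  rewrite -mulr_natr => /eqP; rewrite mulf_eq0 (negPf (natr_neq0_char0 _)).
  by rewrite orbF => /eqP.
case: (posnP (m 0)) => [h0|]; last exact: (key 0 f0).
case: (posnP (m 1)) => [h1|]; last exact: (key 1 f1).
case/eqP: m0; apply/mnmP=> i; rewrite mnmE.
by case: (ord2P i) => ->.
Qed.

Variables P Q : {mpoly F[2]}.
Hypothesis jac1 : jacobian_det P Q = 1.
Local Notation D1 := (jacobian_det (- Q)).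
Local Notation D2 := (jacobian_det P).
Local Notation ev := (ev2 (@mpolyC 2 F) P Q).

Lemma jacobian_swapP : D1 P = 1. Proof. by rewrite jacobian_swap. Qed.
Lemma jacobian_oppQ : D1 Q = 0.
Proof. by rewrite /jacobian_det !mderivN; ring. Qed.

Lemma D1_ev a : D1 (ev a) = ev (map_poly (@deriv F) a).
Proof.
by rewrite (deriv_ev2 (jacobianD _) (jacobianM _) (jacobianC _)) jacobian_swapP jacobian_oppQ mulr0
  addr0 mulr1.
Qed.

Lemma D2_ev a : D2 (ev a) = ev a^`().
Proof.
by rewrite (deriv_ev2 (jacobianD _) (jacobianM _) (jacobianC _)) jacobian_self
  jac1 mulr0 add0r mulr1.
Qed.

(** By Cramer's rule, the two derivations span the partial derivatives. *)
Lemma D12_eq0_const f : D1 f = 0 -> D2 f = 0 -> f = (f@_0)%:MP.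
Proof.
move=> h1 h2; apply: mderiv_eq0_const.
  rewrite -[LHS]mulr1 -jac1; transitivity (P^`M(0) * D1 f + Q^`M(0) * D2 f).
    by rewrite /jacobian_det !mderivN; ring.
  by rewrite h1 h2 !mulr0 addr0.
rewrite -[LHS]mulr1 -jac1; transitivity (P^`M(1) * D1 f + Q^`M(1) * D2 f).
  by rewrite /jacobian_det !mderivN; ring.
by rewrite h1 h2 !mulr0 addr0.
Qed.

(** A relation of least degree is differentiated: D1 acts as d/dP. *)
Lemma ev1_inj a : ev1 (@mpolyC 2 F) P a = 0 -> a = 0.
Proof.
have [n] := ubnP (size a); elim: n a => // n IH a; rewrite ltnS => sa h.
have d0 : a^`() = 0.
  case: (ltngtP (size a) 0) => // [a_gt0|/eqP]; last first.
    by rewrite size_poly_eq0 => /eqP ->; rewrite deriv0.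
  apply: IH; first by apply: leq_trans sa; rewrite lt_size_deriv // -size_poly_gt0.
  have := congr1 D1 h; rewrite jacobian0.
  by rewrite (deriv_ev1 (jacobianD _) (jacobianM _) (jacobianC _)) jacobian_swapP mulr1.
have ha : a = (a`_0)%:P.
  apply/polyP=> -[|i]; rewrite coefC //=.
  have := congr1 (fun p : {poly F} => p`_i) d0; rewrite coef_deriv coef0.
  by rewrite -mulr_natr => /eqP; rewrite mulf_eq0 (negPf (natr_neq0_char0 _))
    orbF => /eqP.
move: h; rewrite ha ev1C -mpolyC0 => /eqP; rewrite mpolyC_eq => /eqP ->.
by rewrite polyC0.
Qed.

Lemma ev2_inj a : ev a = 0 -> a = 0.
Proof.
have [n] := ubnP (size a); elim: n a => // n IH a; rewrite ltnS => sa h.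
have d0 : a^`() = 0.
  case: (ltngtP (size a) 0) => // [a_gt0|/eqP]; last first.
    by rewrite size_poly_eq0 => /eqP ->; rewrite deriv0.
  apply: IH; first by apply: leq_trans sa; rewrite lt_size_deriv // -size_poly_gt0.
  by rewrite -D2_ev h jacobian0.
have ha : a = (a`_0)%:P.
  apply/polyP=> -[|i]; rewrite coefC //=.
  have := congr1 (fun p : {poly {poly F}} => p`_i) d0.
  rewrite coef_deriv coef0 -mulr_natr => /eqP; rewrite mulf_eq0 -polyC_natr.
  by rewrite polyC_eq0 (negPf (natr_neq0_char0 _)) orbF => /eqP.
by move: h; rewrite ha ev2C => /ev1_inj ->; rewrite polyC0.
Qed.

Lemma comp_mpoly2_inj (T : {mpoly F[2]}) : T \mPo [tuple P; Q] = 0 -> T = 0.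
Proof.
have [t ->] := mpoly2_ev T.
by rewrite comp_ev2 => /ev2_inj ->; rewrite rmorph0.
Qed.

Lemma antideriv_ex (a : {poly F}) : {b : {poly F} | b^`() = a}.
Proof.
exists (\poly_(i < (size a).+1) (a`_i.-1 / i%:R)); apply/polyP=> i.
rewrite coef_deriv coef_poly ltnS; case: ltnP => [_|h] /=; last first.
  by rewrite mul0rn nth_default.
by rewrite -[LHS]mulr_natr mulfVK // natr_neq0_char0.
Qed.

Lemma antideriv_coef_ex (a : {poly {poly F}}) :
  exists b : {poly {poly F}}, map_poly (@deriv F) b = a.
Proof.
pose I c := if c == 0 then 0 else sval (antideriv_ex c).
have dI c : (I c)^`() = c.
  by rewrite /I; case: eqP => [->|_]; [rewrite deriv0 | case: antideriv_ex].
exists (map_poly I a); apply/polyP=> i.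
by rewrite !coef_map_id0 ?deriv0 ?/I ?eqxx // -/(I _) dI.
Qed.

Lemma iter_jacobian0 (g : {mpoly F[2]}) n : iter n (jacobian_det g) 0 = 0.
Proof. by elim: n => //= n ->; rewrite jacobian0. Qed.

Lemma iter_jacobianB (g f1 f2 : {mpoly F[2]}) n :
  iter n (jacobian_det g) (f1 - f2)
  = iter n (jacobian_det g) f1 - iter n (jacobian_det g) f2.
Proof. by elim: n => //= n ->; rewrite jacobianD jacobianN. Qed.

Lemma iter_jacobian_ge0 (g f : {mpoly F[2]}) m n : (m <= n)%N ->
  iter m (jacobian_det g) f = 0 -> iter n (jacobian_det g) f = 0.
Proof.
by move=> mn h; rewrite -(subnK mn) iterD h iter_jacobian0.
Qed.

Lemma iter_D2_ev (a : {poly {poly F}}) : iter (size a) D2 (ev a) = 0.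
Proof.
suff h n (b : {poly {poly F}}) : (size b <= n)%N -> iter n D2 (ev b) = 0 by exact: h.
elim: n b => [|n IH] {}a.
  by rewrite leqn0 size_poly_eq0 => /eqP ->; rewrite rmorph0.
move=> sa; rewrite iterSr D2_ev IH //.
have [->|a0] := eqVneq a 0; first by rewrite deriv0 size_poly0.
by rewrite -ltnS; apply: leq_trans sa; apply: lt_size_deriv.
Qed.

(** Integration with respect to Q: D2 g is a polynomial in Q by induction, and
    an antiderivative of it differs from g by a constant. *)
Lemma nilpotent_poly_in_Q n g : D1 g = 0 -> iter n D2 g = 0 ->
  exists b : {poly F}, g = ev1 (@mpolyC 2 F) Q b.
Proof.
elim: n g => [|n IH] g h1 h2; first by exists 0; rewrite rmorph0 -h2.
have [||b hb] := IH (D2 g).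
- by rewrite jacobian_comm // h1 jacobian0.
- by rewrite -[LHS](iterSr n D2 g).
have [c hc] := antideriv_ex b.
have : exists k, g - ev1 (@mpolyC 2 F) Q c = k%:MP.
  exists (g - ev1 (@mpolyC 2 F) Q c)@_0%MM; apply: D12_eq0_const.
    rewrite jacobianD jacobianN (deriv_ev1 (jacobianD _) (jacobianM _) (jacobianC _)).
    by rewrite h1 jacobian_oppQ mulr0 subrr.
  rewrite jacobianD jacobianN (deriv_ev1 (jacobianD _) (jacobianM _) (jacobianC _)).
  by rewrite hb hc jac1 mulr1 subrr.
case=> k /eqP; rewrite subr_eq => /eqP ->.
by exists (c + k%:P); rewrite rmorphD /= ev1C addrC.
Qed.

(** Integration with respect to P: the constant of integration is killed by D1,
    hence is a polynomial in Q. *)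
Lemma nilpotent_poly_in_PQ m n f : iter m D1 f = 0 -> iter n D2 f = 0 ->
  exists a, f = ev a.
Proof.
elim: m f n => [|m IH] f n h1 h2; first by exists 0; rewrite rmorph0 -h1.
have [||a ha] := IH (D1 f) n; first by rewrite -[LHS](iterSr m D1 f).
  suff -> : iter n D2 (D1 f) = D1 (iter n D2 f) by rewrite h2 jacobian0.
  by elim: n {h2} => //= n ->; rewrite jacobian_comm.
have [c hc] := antideriv_coef_ex a.
have [||b hb] := @nilpotent_poly_in_Q (maxn n (size c)) (f - ev c).
- by rewrite jacobianD jacobianN D1_ev hc ha subrr.
- rewrite iter_jacobianB (iter_jacobian_ge0 _ h2) ?leq_maxl //.
  by rewrite (iter_jacobian_ge0 _ (iter_D2_ev c)) ?leq_maxr // subr0.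
exists (c + map_poly polyC b); rewrite rmorphD /=.
suff -> : ev (map_poly polyC b) = ev1 (@mpolyC 2 F) Q b.
  by rewrite -hb addrC subrK.
elim/poly_ind: b {hb} => [|b k IHb]; first by rewrite map_poly0 !rmorph0.
rewrite rmorphD rmorphM /= map_polyC map_polyX !rmorphD !rmorphM /= IHb.
by rewrite ev2X ev1X ev2C !ev1C.
Qed.

End Keller.

(** Integrating x and y gives G with G o F = (x, y).  Then F o G o F = F, and
    F on the right can be cancelled as P and Q are algebraically independent. *)
Lemma nilpotent_invertible (F : fieldType) (P Q : {mpoly F[2]}) n :
  [pchar F] =i pred0 -> jacobian_det P Q = 1 ->
  (forall i, iter n (jacobian_det (- Q)) 'X_i = 0) ->
  (forall i, iter n (jacobian_det P) 'X_i = 0) -> invertible_map P Q.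
Proof.
move=> char0 jac1 h1 h2.
have [a ha] := nilpotent_poly_in_PQ char0 jac1 (h1 0) (h2 0).
have [b hb] := nilpotent_poly_in_PQ char0 jac1 (h1 1) (h2 1).
pose G1 := ev2 (@mpolyC 2 F) 'X_0 'X_1 a; pose G2 := ev2 (@mpolyC 2 F) 'X_0 'X_1 b.
have e1 : G1 \mPo [tuple P; Q] = 'X_0 by rewrite comp_ev2.
have e2 : G2 \mPo [tuple P; Q] = 'X_1 by rewrite comp_ev2.
exists G1, G2; split=> //.
have assoc T : (T \mPo [tuple G1; G2]) \mPo [tuple P; Q] = T.
  have [t ->] := mpoly2_ev T.
  rewrite comp_ev2 rmorph_ev2 /= e1 e2.
  by apply: eq_ev2 => c /=; rewrite comp_mpolyC.
split; apply/eqP; rewrite -subr_eq0; apply/eqP/(comp_mpoly2_inj char0 jac1).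
  by rewrite comp_mpolyB assoc comp_mpolyXU subrr.
by rewrite comp_mpolyB assoc comp_mpolyXU subrr.
Qed.

(** * Invertible maps have two integral points *)
(** The ring of integers is a [Prop]-valued predicate, so closure properties are
    stated for such predicates. *)
Section SubringCoefs.
Variables (R : comNzRingType) (S : R -> Prop).
Hypothesis S1 : S 1.
Hypothesis SB : forall a b, S a -> S b -> S (a - b).
Hypothesis SM : forall a b, S a -> S b -> S (a * b).

Lemma subring0 : S 0. Proof. by rewrite -(subrr 1); apply: SB. Qed.
Lemma subringN a : S a -> S (- a).
Proof. by move=> Sa; rewrite -sub0r; apply: SB => //; apply: subring0. Qed.
Lemma subringD a b : S a -> S b -> S (a + b).
Proof. by move=> Sa Sb; rewrite -[b]opprK; apply: SB => //; apply: subringN. Qed.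
Lemma subringX a n : S a -> S (a ^+ n).
Proof. by move=> Sa; elim: n => [|n IH]; rewrite ?expr0 // exprS; apply: SM. Qed.
Lemma subring_sum (I : Type) (r : seq I) (p : pred I) (f : I -> R) :
  (forall i, p i -> S (f i)) -> S (\sum_(i <- r | p i) f i).
Proof. exact: (big_ind S subring0 subringD). Qed.
Lemma subring_prod (I : Type) (r : seq I) (p : pred I) (f : I -> R) :
  (forall i, p i -> S (f i)) -> S (\prod_(i <- r | p i) f i).
Proof. exact: (big_ind S S1 SM). Qed.
Lemma subring_nat n : S n%:R.
Proof. by elim: n => [|n IH]; [apply: subring0 | rewrite -natr1; apply: subringD]. Qed.

Definition coefs_in n (p : {mpoly R[n]}) := forall m, S p@_m.

Lemma coefs_inB n (p q : {mpoly R[n]}) : coefs_in p -> coefs_in q -> coefs_in (p - q).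
Proof. by move=> hp hq m; rewrite mcoeffB; apply: SB. Qed.
Lemma coefs_inM n (p q : {mpoly R[n]}) : coefs_in p -> coefs_in q -> coefs_in (p * q).
Proof. by move=> hp hq m; rewrite mcoeffM; apply: subring_sum => k _; apply: SM. Qed.
Lemma coefs_inC n c : S c -> coefs_in (c%:MP : {mpoly R[n]}).
Proof. by move=> Sc m; rewrite mcoeffC; apply: SM => //; apply: subring_nat. Qed.
Lemma coefs_inX n i : coefs_in ('X_i : {mpoly R[n]}).
Proof. by move=> m; rewrite mcoeffX; apply: subring_nat. Qed.
Lemma coefs_in1 n : coefs_in (1 : {mpoly R[n]}).
Proof. by rewrite -mpolyC1; apply: coefs_inC. Qed.
Lemma coefs_inXn n (p : {mpoly R[n]}) k : coefs_in p -> coefs_in (p ^+ k).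
Proof.
by move=> hp; elim: k => [|k IH]; rewrite ?expr0 ?exprS; [apply: coefs_in1 | apply: coefs_inM].
Qed.

Lemma meval_in n (v : 'I_n -> R) (p : {mpoly R[n]}) :
  coefs_in p -> (forall i, S (v i)) -> S p.@[v].
Proof.
move=> hp hv; rewrite mevalE; apply: subring_sum => m _; apply: SM => //.
by apply: subring_prod => i _; apply: subringX.
Qed.

End SubringCoefs.

Lemma meval2_eq (R : comNzRingType) (p : {mpoly R[2]}) (v w : 'I_2 -> R) :
  v 0 = w 0 -> v 1 = w 1 -> p.@[v] = p.@[w].
Proof.
move=> h0 h1; rewrite !mevalE; apply: eq_bigr => m _; congr (_ * _).
by apply: eq_bigr => i _; case: (ord2P i) => ->; rewrite ?h0 ?h1.
Qed.

Section Order.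
Variable R : comNzRingType.
Implicit Types p q : {mpoly R[2]}.

Definition order_ge d p := forall m : 'X_{1..2}, (mdeg m < d)%N -> p@_m = 0.

Lemma order_geM d e p q : order_ge d p -> order_ge e q -> order_ge (d + e) (p * q).
Proof.
move=> hp hq m lm; rewrite mcoeffM big1 // => k /eqP em.
have [lt1|ge1] := ltnP (mdeg k.1) d; first by rewrite hp ?mul0r.
rewrite hq ?mulr0 //; have := congr1 (@mdeg 2) em; rewrite mdegD => em'.
rewrite -(ltn_add2l d); apply: leq_ltn_trans lm; apply: leq_trans (eq_leq (esym em')).
by rewrite leq_add2r.
Qed.

Lemma order_geD d p q : order_ge d p -> order_ge d q -> order_ge d (p + q).
Proof. by move=> hp hq m lm; rewrite mcoeffD hp ?hq ?addr0. Qed.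

Lemma order_ge_le d e p : (e <= d)%N -> order_ge d p -> order_ge e p.
Proof. by move=> le hp m lm; apply: hp; apply: leq_trans le. Qed.

Lemma order_geX (m : 'X_{1..2}) : order_ge (mdeg m) ('X_[m] : {mpoly R[2]}).
Proof. by move=> k lk; rewrite mcoeffX; case: eqP => // e; rewrite e ltnn in lk. Qed.

Lemma order_ge_pow p q d e n : order_ge d (p - q) -> order_ge e p -> order_ge e q ->
  order_ge (n * e + d) (p ^+ n.+1 - q ^+ n.+1).
Proof.
move=> hpq hp hq.
have hpow r k : order_ge e r -> order_ge (k * e) (r ^+ k).
  move=> hr; elim: k => [|k IH]; first by rewrite mul0n => m.
  by rewrite exprS mulSn; apply: order_geM.
elim: n => [|n IH]; first by rewrite !expr1 mul0n add0n.
have -> : p ^+ n.+2 - q ^+ n.+2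
  = p ^+ n.+1 * (p - q) + (p ^+ n.+1 - q ^+ n.+1) * q.
  by rewrite ![_ ^+ n.+2]exprSr; ring.
apply: order_geD; first by apply: order_geM => //; apply: hpow.
by have -> : (n.+1 * e + d = n * e + d + e)%N; [lia | apply: order_geM].
Qed.

Lemma tangent_id_monomial p q (m : 'X_{1..2}) :
  order_ge 2 (p - 'X_0) -> order_ge 2 (q - 'X_1) ->
  order_ge (mdeg m).+1 (p ^+ m 0 * q ^+ m 1 - 'X_[m]).
Proof.
move=> hp hq; rewrite mpolyX2.
have o1 (i : 'I_2) : order_ge 1 ('X_i : {mpoly R[2]}).
  by have := @order_geX U_(i)%MM; rewrite mdeg1.
have o1' (r : {mpoly R[2]}) i : order_ge 2 (r - 'X_i) -> order_ge 1 r.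
  move=> hr; rewrite -(subrK 'X_i r); apply: order_geD => //.
  exact: order_ge_le hr.
have hpow r k : order_ge 1 r -> order_ge k (r ^+ k).
  move=> hr; elim: k => [|k IH]; first by [].
  by rewrite exprS -add1n; apply: order_geM.
have hd (r : {mpoly R[2]}) i k : order_ge 2 (r - 'X_i) -> order_ge k.+1 (r ^+ k - 'X_i ^+ k).
  move=> hr; case: k => [|k].
    by rewrite !expr0 subrr => j _; rewrite mcoeff0.
  have := @order_ge_pow r 'X_i 2 1 k hr (o1' _ _ hr) (o1 i).
  by rewrite muln1 addn2.
have -> : mdeg m = (m 0%R + m 1%R)%N.
  rewrite mdegE !big_ord_recl big_ord0 addn0.
  by have -> : lift ord0 ord0 = 1 :> 'I_2 by apply: val_inj.
have -> : p ^+ m 0 * q ^+ m 1 - 'X_0 ^+ m 0 * 'X_1 ^+ m 1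
  = (p ^+ m 0 - 'X_0 ^+ m 0) * q ^+ m 1 + 'X_0 ^+ m 0 * (q ^+ m 1 - 'X_1 ^+ m 1).
  by ring.
apply: order_geD.
  rewrite -addSn; apply: order_geM; first exact: hd.
  by apply: hpow; apply: o1' hq.
rewrite -addnS; apply: order_geM; last exact: hd.
exact: hpow.
Qed.

Variable S : R -> Prop.
Hypothesis S1 : S 1.
Hypothesis SB : forall a b, S a -> S b -> S (a - b).
Hypothesis SM : forall a b, S a -> S b -> S (a * b).

(** As p, q are x, y up to order 2, the coefficient of g o (p, q) at m is that
    of g at m plus a combination, with entries in S, of coefficients of g of
    smaller degree: a unitriangular system. *)
Lemma coefs_in_comp p q (g : {mpoly R[2]}) :
  order_ge 2 (p - 'X_0) -> order_ge 2 (q - 'X_1) ->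
  coefs_in S p -> coefs_in S q -> coefs_in S (g \mPo [tuple p; q]) ->
  coefs_in S g.
Proof.
move=> hp hq Sp Sq Sg m.
have [n] := ubnP (mdeg m); elim: n m => // n IH m; rewrite ltnS => lm.
have E (k : 'X_{1..2}) : 'X_[k] \mPo [tuple p; q] = p ^+ k 0 * q ^+ k 1.
  by rewrite mpolyX2 rmorphM !rmorphXn /= !comp_mpolyXU.
have eg : g@_m = (g \mPo [tuple p; q])@_m
   - \sum_(k <- msupp g) g@_k * (p ^+ k 0 * q ^+ k 1 - 'X_[k])@_m.
  rewrite comp_mpolyEX raddf_sum /= -sumrB {1}(mpolyE g) raddf_sum /=.
  apply: eq_bigr => k _; rewrite E !mcoeffZ mcoeffB; ring.
rewrite eg; apply: SB => //; apply: subring_sum => // k _.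
have [lk|gek] := ltnP (mdeg k) (mdeg m); last first.
  rewrite tangent_id_monomial ?ltnS // mulr0; exact: subring0.
apply: SM; first by apply: IH; apply: leq_trans lm.
rewrite mcoeffB; apply: SB.
  by apply: coefs_inM => //; apply: coefs_inXn.
rewrite mcoeffX; exact: subring_nat.
Qed.

End Order.

Lemma order_ge2 (R : comNzRingType) (p : {mpoly R[2]}) :
  p@_0%MM = 0 -> (forall i : 'I_2, p@_U_(i) = 0) -> order_ge 2 p.
Proof.
move=> h0 h1 m; rewrite ltnS leq_eqVlt => /orP[/mdeg1P[i /eqP ->] //|].
by rewrite ltnS leqn0 mdeg_eq0 => /eqP ->.
Qed.

Lemma jacobian_at0 (R : comNzRingType) (P Q : {mpoly R[2]}) :
  (jacobian_det P Q)@_0%MM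
  = P@_(U_(0)) * Q@_(U_(1)) - P@_(U_(1)) * Q@_(U_(0)).
Proof.
have [e _] := mcoeff0_is_multiplicative 2 R.
rewrite /jacobian_det mcoeffB !e !mcoeff_mderiv !add0m !mnm0E.
by rewrite !mulr1n.
Qed.

Lemma cramer2_l (R : comNzRingType) (a b c e u v : R) :
  a * (e * u - b * v) + b * (a * v - c * u) = (a * e - b * c) * u.
Proof. by ring. Qed.

Lemma cramer2_r (R : comNzRingType) (a b c e u v : R) :
  c * (e * u - b * v) + e * (a * v - c * u) = (a * e - b * c) * v.
Proof. by ring. Qed.

Section IntegralPoints.
Variable K : fieldExtType rat.
Local Notation OK := (@ring_of_integers K).

Lemma integers1 : OK 1. Proof. exact: integral1. Qed.
Lemma integersB a b : OK a -> OK b -> OK (a - b).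
Proof. exact: integral_sub. Qed.
Lemma integersM a b : OK a -> OK b -> OK (a * b).
Proof. exact: integral_mul. Qed.

(** Applied to the two components of the inverse map.  The affine map A = (A0,
    A1) is the first-order part of (P, Q), which factors as A o (P', Q') with
    (P', Q') tangent to the identity; so G o A has integral
    coefficients. *)
Lemma integral_inverse (P Q G : {mpoly K[2]}) :
  integral_coefs P -> integral_coefs Q -> jacobian_det P Q = 1 ->
  integral_coefs (G \mPo [tuple P; Q]) ->
  forall v : 'I_2 -> K, (forall i, OK (v i)) -> OK G.@[v].
Proof.
move=> iP iQ jac1 iG v iv.
pose p0 := P@_0%MM; pose q0 := Q@_0%MM.
pose a := P@_(U_(0)); pose b := P@_(U_(1)).
pose c := Q@_(U_(0)); pose e := Q@_(U_(1)).
have det1 : a * e - b * c = 1.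
  by rewrite -jacobian_at0 jac1 mcoeff1 eqxx.
have int0 : OK 0 by apply: (subring0 integers1 integersB).
have iC x : OK x -> coefs_in OK (x%:MP : {mpoly K[2]}) by move=> ?; apply: (coefs_inC integers1 integersB integersM).
have iaff (x y : K) (p q : {mpoly K[2]}) : OK x -> OK y -> coefs_in OK p ->
    coefs_in OK q -> coefs_in OK (x%:MP * p - y%:MP * q).
  move=> ix iy ip iq; apply: (coefs_inB integersB).
    exact: (coefs_inM integers1 integersB integersM (iC _ ix) ip).
  exact: (coefs_inM integers1 integersB integersM (iC _ iy) iq).
pose P' := e%:MP * (P - p0%:MP) - b%:MP * (Q - q0%:MP).
pose Q' := a%:MP * (Q - q0%:MP) - c%:MP * (P - p0%:MP).
have iP0 : coefs_in OK (P - p0%:MP).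
  by apply: (coefs_inB integersB) => //; apply: iC; apply: iP.
have iQ0 : coefs_in OK (Q - q0%:MP).
  by apply: (coefs_inB integersB) => //; apply: iC; apply: iQ.
have iP' : coefs_in OK P' by apply: iaff => //; [apply: iQ | apply: iP].
have iQ' : coefs_in OK Q' by apply: iaff => //; [apply: iP | apply: iQ].
have nU i : (U_(i)%MM == 0%MM :> 'X_{1..2}) = false by rewrite -mdeg_eq0 mdeg1.
have U01 : (U_(0%R)%MM == U_(1%R)%MM :> 'X_{1..2}) = false.
  by apply/negP => /eqP /mnmP /(_ 0%R); rewrite !mnm1E.
have U10 : (U_(1%R)%MM == U_(0%R)%MM :> 'X_{1..2}) = false by rewrite eq_sym U01.
have oP : order_ge 2 (P' - 'X_0).
  apply: order_ge2 => [|i]; rewrite /P' !(mcoeffB, mcoeffCM, mcoeffC, mcoeffX).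
    by rewrite eqxx nU /p0 /q0 /=; ring.
  rewrite nU !mulr0 !subr0; case: (ord2P i) => -> /=.
    by rewrite eqxx -det1 /a /b /c /e /=; ring.
  by rewrite U01 /a /b /c /e /=; ring.
have oQ : order_ge 2 (Q' - 'X_1).
  apply: order_ge2 => [|i]; rewrite /Q' !(mcoeffB, mcoeffCM, mcoeffC, mcoeffX).
    by rewrite eqxx nU /p0 /q0 /=; ring.
  rewrite nU !mulr0 !subr0; case: (ord2P i) => -> /=.
    by rewrite U10 /a /b /c /e /=; ring.
  by rewrite eqxx -det1 /a /b /c /e /=; ring.
pose A0 : {mpoly K[2]} := a%:MP * 'X_0 + b%:MP * 'X_1 + p0%:MP.
pose A1 : {mpoly K[2]} := c%:MP * 'X_0 + e%:MP * 'X_1 + q0%:MP.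
have det1' : a%:MP * e%:MP - b%:MP * c%:MP = 1 :> {mpoly K[2]}.
  by rewrite -!mpolyCM -mpolyCB det1 mpolyC1.
have hA : (G \mPo [tuple A0; A1]) \mPo [tuple P'; Q'] = G \mPo [tuple P; Q].
  have [t ->] := mpoly2_ev G.
  rewrite !comp_ev2 rmorph_ev2 /=.
  have -> : A0 \mPo [tuple P'; Q'] = P.
    rewrite !(comp_mpolyD, comp_mpolyC, rmorphM) /= !comp_mpolyC !comp_mpolyXU /=.
    by rewrite cramer2_l det1' mul1r subrK.
  have -> : A1 \mPo [tuple P'; Q'] = Q.
    rewrite !(comp_mpolyD, comp_mpolyC, rmorphM) /= !comp_mpolyC !comp_mpolyXU /=.
    by rewrite cramer2_r det1' mul1r subrK.
  by apply: eq_ev2 => x /=; rewrite comp_mpolyC.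
have ig : coefs_in OK (G \mPo [tuple A0; A1]).
  apply: (coefs_in_comp integers1 integersB integersM oP oQ iP' iQ').
  by rewrite hA.
pose w (i : 'I_2) := if i == 0 then e * (v 0 - p0) - b * (v 1 - q0)
                     else a * (v 1 - q0) - c * (v 0 - p0).
have -> : G.@[v] = (G \mPo [tuple A0; A1]).@[w].
  rewrite comp_mpoly_meval; apply: meval2_eq.
    rewrite /= !(mevalD, mevalM, mevalC, mevalXU) /w /=.
    by rewrite cramer2_l det1 mul1r subrK.
  rewrite /= !(mevalD, mevalM, mevalC, mevalXU) /w /=.
  by rewrite cramer2_r det1 mul1r subrK.
apply: (meval_in integers1 integersB integersM) => // i.
have iv0 : OK (v 0 - p0) by apply: integersB => //; apply: iP.
have iv1 : OK (v 1 - q0) by apply: integersB => //; apply: iQ.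
by rewrite /w; case: eqP => _; apply: integersB; apply: integersM => //;
  first [apply: iP | apply: iQ].
Qed.

Lemma invertible_two_integral_points (P Q : {mpoly K[2]}) :
  integral_coefs P -> integral_coefs Q -> jacobian_det P Q = 1 ->
  invertible_map P Q ->
  exists c d : K * K, c <> d /\ integral_point P c /\ integral_point P d.
Proof.
move=> iP iQ jac1 [G1 [G2 [[PG QG] [GP GQ]]]].
pose pt (t : K) := tnth [tuple 0; t].
pose q t := (G1.@[pt t], G2.@[pt t]).
have iX (i : 'I_2) : integral_coefs ('X_i : {mpoly K[2]}).
  exact: (coefs_inX integers1 integersB).
have i0 : OK 0 by apply: (subring0 integers1 integersB).
have ipt t : OK t -> forall i, OK (pt t i).
  by move=> it i; case: (ord2P i) => ->.
have ipq t : OK t -> integral_point P (q t).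
  move=> it; split.
  - apply: (integral_inverse iP iQ jac1) (ipt _ it); rewrite GP; exact: iX.
  - apply: (integral_inverse iP iQ jac1) (ipt _ it); rewrite GQ; exact: iX.
  have -> : P.@[tnth [tuple (q t).1; (q t).2]] = (P \mPo [tuple G1; G2]).@[pt t].
    by rewrite comp_mpoly_meval; apply: meval2_eq.
  by rewrite PG mevalXU.
have Qq t : Q.@[tnth [tuple (q t).1; (q t).2]] = t.
  have -> : Q.@[tnth [tuple (q t).1; (q t).2]] = (Q \mPo [tuple G1; G2]).@[pt t].
    by rewrite comp_mpoly_meval; apply: meval2_eq.
  by rewrite QG mevalXU.
exists (q 0), (q 1); split; last by split; apply: ipq => //; apply: integers1.
move=> e; have := Qq 1; rewrite -e Qq => /eqP.
by rewrite eq_sym oner_eq0.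
Qed.

End IntegralPoints.

(** * Norms of complex polynomials *)
Section RealNorm.

(** The modulus with values in [algR], which unlike [algC] is totally ordered. *)
Definition nm (z : algC) : algR := in_algR (normr_real z).

Lemma nm_ge0 z : 0 <= nm z. Proof. exact: normr_ge0. Qed.
Lemma nmM x y : nm (x * y) = nm x * nm y.
Proof. by apply: val_inj; rewrite /= normrM. Qed.
Lemma nm0 : nm 0 = 0. Proof. by apply: val_inj; rewrite /= normr0. Qed.
Lemma nm1 : nm 1 = 1. Proof. by apply: val_inj; rewrite /= normr1. Qed.
Lemma ler_nmD x y : nm (x + y) <= nm x + nm y. Proof. exact: ler_normD. Qed.
Lemma nmN x : nm (- x) = nm x.
Proof. by apply: val_inj; rewrite /= normrN. Qed.
Lemma nm_eq0 x : (nm x == 0) = (x == 0).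
Proof. by rewrite -(normr_eq0 x) -val_eqE. Qed.
Lemma nmX x n : nm (x ^+ n) = nm x ^+ n.
Proof. by elim: n => [|n IH]; rewrite ?expr0 ?nm1 // !exprS nmM IH. Qed.
Lemma nm_real (r : algR) : 0 <= r -> nm (algRval r) = r.
Proof. by move=> r0; apply: val_inj; apply: ger0_norm. Qed.
Lemma nm_nat n : nm n%:R = n%:R.
Proof. by apply: val_inj; rewrite /= rmorph_nat normr_nat. Qed.
Lemma nmV x : nm x^-1 = (nm x)^-1.
Proof. by apply: val_inj; rewrite /= normfV. Qed.
Lemma nm_sum (I : Type) (r : seq I) (p : pred I) (F : I -> algC) :
  nm (\sum_(i <- r | p i) F i) <= \sum_(i <- r | p i) nm (F i).
Proof.
elim/big_rec2: _ => [|i x y _ h]; first by rewrite nm0.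
by apply: le_trans (ler_nmD _ _) _; rewrite lerD2l.
Qed.

Lemma bernoulli (R : realFieldType) (h : R) N : 0 <= h ->
  1 + N%:R * h <= (1 + h) ^+ N.
Proof.
move=> h0; elim: N => [|N IH]; first by rewrite mul0r addr0 expr0.
rewrite exprS; apply: le_trans (_ : (1 + h) * (1 + N%:R * h) <= _); last first.
  by rewrite ler_wpM2l // addr_ge0 ?ler01.
have : 0 <= N%:R * h * h by rewrite !mulr_ge0 ?ler0n.
rewrite -natr1; lra.
Qed.

(** Limits are avoided: an explicit rank is all that is used. *)
Lemma exp_small (q W : algR) : 0 <= q -> q < 1 ->
  exists N0, forall N, (N0 <= N)%N -> W * q ^+ N <= 1.
Proof.
move=> q0 q1; have [qz|qn] := eqVneq q 0.
  exists 1%N => N; case: N => // N _; rewrite qz expr0n /= mulr0; exact: ler01.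
have qp : 0 < q by rewrite lt_def qn.
pose h := q^-1 - 1; have h0 : 0 < h by rewrite subr_gt0 invf_gt1.
have bern N : 1 + N%:R * h <= q^-1 ^+ N.
  by have := bernoulli N (ltW h0); rewrite [1 + h]addrC subrK.
have := archi_boundP (_ : 0 <= `|W| / h); set N0 := Num.bound _.
rewrite divr_ge0 ?(ltW h0) // => /(_ isT) hN0.
exists N0 => N leN; apply: le_trans (_ : `|W| * q ^+ N <= 1).
  by rewrite ler_wpM2r ?exprn_ge0 ?ler_norm.
rewrite -ler_pdivlMr ?exprn_gt0 // mul1r -exprVn.
apply: le_trans (bern N); rewrite ltr_pdivrMr // in hN0.
apply: le_trans (ltW hN0) _.
have : N0%:R * h <= N%:R * h by rewrite ler_pM2r // ler_nat.
lra.
Qed.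

Lemma linear_exp_bounded (q : algR) : 0 <= q -> q < 1 ->
  exists B, forall M, M.+1%:R * q ^+ M <= B.
Proof.
move=> q0 q1; have [qz|qn] := eqVneq q 0.
  exists 1 => -[|M]; rewrite qz ?expr0 ?mulr1 // expr0n /= mulr0; exact: ler01.
have qp : 0 < q by rewrite lt_def qn.
pose h := q^-1 - 1; have h0 : 0 < h by rewrite subr_gt0 invf_gt1.
have bern N : 1 + N%:R * h <= q^-1 ^+ N.
  by have := bernoulli N (ltW h0); rewrite [1 + h]addrC subrK.
exists (1 + h^-1) => M.
rewrite -ler_pdivlMr ?exprn_gt0 // -exprVn.
have hi0 : 0 < h^-1 by rewrite invr_gt0.
apply: le_trans (_ : (1 + h^-1) * (1 + M%:R * h) <= _); last first.
  by rewrite ler_pM2l ?bern // addr_gt0.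
have e : h^-1 * (M%:R * h) = M%:R by rewrite mulrCA mulVf ?gt_eqF // mulr1.
rewrite -natr1 mulrDl mul1r [h^-1 * _]mulrDr e.
have : 0 <= M%:R * h by rewrite mulr_ge0 ?ler0n // ltW.
lra.
Qed.

End RealNorm.

Section WienerNorm.
Implicit Types (f g : {poly algC}) (r : algR).

(** The Wiener norm on the disc of radius r: it is submultiplicative and bounds
    the values on the disc. *)
Definition wn r f : algR := \sum_(i < size f) nm f`_i * r ^+ i.

Lemma wnE n r f : (size f <= n)%N -> wn r f = \sum_(i < n) nm f`_i * r ^+ i.
Proof.
move=> le; rewrite /wn (big_ord_widen n (fun i => nm f`_i * r ^+ i) le).
rewrite [RHS](bigID (fun i : 'I_n => (i < size f)%N)) /= [X in _ + X]big1 ?addr0 //.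
by move=> i; rewrite -leqNgt => h; rewrite nth_default // nm0 mul0r.
Qed.

Lemma wn_ge0 r f : 0 <= r -> 0 <= wn r f.
Proof. by move=> r0; apply: sumr_ge0 => i _; rewrite mulr_ge0 ?nm_ge0 ?exprn_ge0. Qed.

Lemma wn0 r : wn r 0 = 0.
Proof. by rewrite /wn size_poly0 big_ord0. Qed.

Lemma wnC r c : wn r c%:P = nm c.
Proof. by rewrite (@wnE 1) ?size_polyC ?leq_b1 // big_ord1 coefC /= mulr1. Qed.

Lemma wnD r f g : 0 <= r -> wn r (f + g) <= wn r f + wn r g.
Proof.
move=> r0; pose n := maxn (size f) (size g).
rewrite !(@wnE n) ?leq_maxl ?leq_maxr ?size_polyD // -big_split /=.
apply: ler_sum => i _; rewrite -mulrDl coefD ler_wpM2r ?exprn_ge0 //.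
exact: ler_nmD.
Qed.

Lemma wnMX r f : wn r (f * 'X) = wn r f * r.
Proof.
rewrite (@wnE (size f).+1) ?size_mulX_leq //; last first.
  by apply: leq_trans (size_polyMleq _ _) _; rewrite size_polyX addn2.
rewrite big_ord_recl coefMX /= nm0 mul0r add0r mulr_suml.
by apply: eq_bigr => i _; rewrite coefMX /= exprS; ring.
Qed.

Lemma wnCM r c f : wn r (c%:P * f) = nm c * wn r f.
Proof.
rewrite (@wnE (size f)); last first.
  have [->|c0] := eqVneq c 0; first by rewrite mul0r size_poly0.
  by rewrite size_Cmul.
by rewrite mulr_sumr; apply: eq_bigr => i _; rewrite coefCM nmM mulrA.
Qed.

Lemma wnM r f g : 0 <= r -> wn r (f * g) <= wn r f * wn r g.
Proof.
move=> r0; elim/poly_ind: f => [|f c IH]; first by rewrite mul0r wn0 mul0r.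
have e : wn r (f * 'X + c%:P) = wn r f * r + nm c.
  rewrite (@wnE (size f).+1); last first.
    apply: leq_trans (size_polyD _ _) _; rewrite geq_max.
    rewrite (leq_trans (size_polyMleq _ _)) ?size_polyX ?addn2 //=.
    by rewrite (leq_trans (size_polyC_leq1 _)).
  rewrite big_ord_recl coefD coefMX coefC /= add0r mulr1 addrC mulr_suml.
  congr (_ + _); apply: eq_bigr => i _; rewrite coefD coefMX coefC /= addr0 exprS.
  by ring.
rewrite e (mulrDl (f * 'X)) (mulrAC f) (mulrDl (wn r f * r)) (mulrAC (wn r f)).
apply: le_trans (wnD _ _ r0) _; rewrite wnMX wnCM lerD2r.
by rewrite ler_wpM2r.
Qed.

Lemma wnX r f n : 0 <= r -> wn r (f ^+ n) <= wn r f ^+ n.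
Proof.
move=> r0; elim: n => [|n IH]; first by rewrite !expr0 -polyC1 wnC nm1.
rewrite !exprS; apply: le_trans (wnM _ _ r0) _.
by rewrite ler_wpM2l ?wn_ge0.
Qed.

Lemma wn_sum r (I : Type) (s : seq I) (F : I -> {poly algC}) : 0 <= r ->
  wn r (\sum_(i <- s) F i) <= \sum_(i <- s) wn r (F i).
Proof.
move=> r0; elim/big_rec2: _ => [|i x y _ h]; first by rewrite wn0.
by apply: le_trans (wnD _ _ r0) _; rewrite lerD2l.
Qed.

Lemma nm_horner_wn r f t : nm t <= r -> nm f.[t] <= wn r f.
Proof.
move=> tr; rewrite horner_coef; apply: le_trans (nm_sum _ _ _) _.
apply: ler_sum => i _; rewrite nmM nmX ler_wpM2l ?nm_ge0 //.
by rewrite lerXn2r // ?nnegrE ?nm_ge0 // (le_trans (nm_ge0 t)).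
Qed.

(** Schwarz's lemma for the Wiener norm. *)
Lemma wn_vanish r r1 f N : 0 < r -> 0 <= r1 -> r1 <= r ->
  (forall i, (i <= N)%N -> f`_i = 0) -> wn r1 f <= (r1 / r) ^+ N * wn r f.
Proof.
move=> r0 r10 le hf; rewrite mulr_sumr; apply: ler_sum => i _.
have [iN|Ni] := leqP i N; first by rewrite hf // nm0 !mul0r mulr0.
have er (x : algR) : x ^+ i = x ^+ (i - N) * x ^+ N by rewrite -exprD subnK // ltnW.
rewrite mulrCA ler_wpM2l ?nm_ge0 // !er expr_div_n mulrCA divfK; last first.
  by rewrite expf_neq0 ?gt_eqF.
rewrite ler_wpM2r ?exprn_ge0 //.
by rewrite lerXn2r // nnegrE // ltW.
Qed.

Lemma wn_le r r1 f : 0 <= r -> r <= r1 -> wn r f <= wn r1 f.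
Proof.
move=> r0 le; apply: ler_sum => i _; rewrite ler_wpM2l ?nm_ge0 //.
by rewrite lerXn2r // nnegrE // (le_trans r0).
Qed.

Lemma wn_growth r f n : 0 <= r -> (size f <= n.+1)%N ->
  wn r f <= wn 1 f * (1 + r) ^+ n.
Proof.
move=> r0 le; rewrite !(wnE _ le) mulr_suml; apply: ler_sum => i _.
rewrite expr1n mulr1 ler_wpM2l ?nm_ge0 //.
apply: le_trans (_ : (1 + r) ^+ i <= _).
  by rewrite lerXn2r ?nnegrE ?addr_ge0 ?ler01 // lerDr ler01.
by rewrite ler_weXn2l // ?lerDl // -ltnS.
Qed.

End WienerNorm.

(** Cauchy's estimate; the mean over the circle is replaced by the mean over
    the L-th roots of unity, which is exact for polynomials of size L. *)
Lemma cauchy_coef (f : {poly algC}) (r B : algR) m : 0 <= r -> 0 <= B ->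
  (forall t, nm t = r -> nm f.[t] <= B) -> nm f`_m * r ^+ m <= B.
Proof.
move=> r0 B0 hB.
have [sm|ms] := leqP (size f) m; first by rewrite nth_default // nm0 mul0r.
pose L := size f; have L0 : (0 < L)%N by apply: leq_ltn_trans ms.
have [w wL] := C_prim_root_exists L0.
have nw j : nm (w ^+ j) = 1.
  rewrite nmX; have : nm w ^+ L = 1 by rewrite -nmX (prim_expr_order wL) nm1.
  move/eqP; rewrite pexpr_eq1 ?nm_ge0 // => /eqP ->; exact: expr1n.
pose rc := algRval r.
have E : \sum_(j < L) f.[rc * w ^+ j] * (w ^+ j) ^+ (L - m) = L%:R * (f`_m * rc ^+ m).
  under eq_bigr => j _ do rewrite horner_coef mulr_suml.
  rewrite exchange_big /= (bigD1 (Ordinal ms)) //= [X in _ + X]big1 ?addr0.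
    under eq_bigr => j _ do rewrite exprMn -!mulrA -exprD subnKC ?(ltnW ms) // -exprM
      mulnC exprM (prim_expr_order wL) expr1n mulr1.
    by rewrite sumr_const card_ord mulr_natl.
  move=> i ne.
  under eq_bigr => j _ do rewrite exprMn -!mulrA -exprD -exprM mulnC exprM mulrA.
  rewrite -mulr_sumr; set z := w ^+ (i + (L - m)).
  suff -> : \sum_(j < L) z ^+ j = 0 by rewrite mulr0.
  have z1 : z != 1.
    rewrite -(prim_order_dvd wL); apply/negP => /dvdnP [k hk].
    move: ne; rewrite -val_eqE /= => /eqP; apply.
    have hi : (i < L)%N := ltn_ord i; have hm : (m < L)%N := ms.
    move: hk hi hm; move: (nat_of_ord i) => i'; clearbody L => hk hi hm.
    by case: k hk => [|[|k]] hk; [lia | lia | nia].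
  have := subrX1 z L; rewrite -exprM mulnC exprM (prim_expr_order wL) expr1n subrr.
  move/esym/eqP; rewrite mulf_eq0 subr_eq0 (negPf z1) /= => /eqP h.
  exact: h.
have : nm (L%:R * (f`_m * rc ^+ m)) <= L%:R * B.
  rewrite -E; apply: le_trans (nm_sum _ _ _) _.
  rewrite mulr_natl -[L in B *+ L]card_ord -sumr_const; apply: ler_sum => j _.
  rewrite nmM nmX nw expr1n mulr1; apply: hB.
  by rewrite nmM nw mulr1 nm_real.
by rewrite !nmM nmX nm_real // nm_nat ler_pM2l ?ltr0n.
Qed.

(** * Majorant norm and iterates of a Jacobian derivation *)
Section DegreeBound.
Variable R : comNzRingType.
Implicit Types f g : {mpoly R[2]}.

Definition deg_le d f := forall m : 'X_{1..2}, (d < mdeg m)%N -> f@_m = 0.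

Lemma deg_leM d e f g : deg_le d f -> deg_le e g -> deg_le (d + e) (f * g).
Proof.
move=> hf hg m lm; rewrite mcoeffM big1 // => k /eqP em.
have [lt1|ge1] := ltnP d (mdeg k.1); first by rewrite hf ?mul0r.
rewrite hg ?mulr0 //; have := congr1 (@mdeg 2) em; rewrite mdegD => em'.
rewrite -(ltn_add2l (mdeg k.1)); apply: leq_trans (eq_leq em').
by apply: leq_ltn_trans lm; rewrite leq_add2r.
Qed.

Lemma deg_leB d f g : deg_le d f -> deg_le d g -> deg_le d (f - g).
Proof. by move=> hf hg m lm; rewrite mcoeffB hf ?hg ?subrr. Qed.

Lemma deg_le_mderiv d f i : deg_le d f -> deg_le d f^`M(i).
Proof.
move=> hf m lm; rewrite mcoeff_mderiv hf ?mul0rn // mdegD.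
exact: leq_trans lm (leq_addr _ _).
Qed.

Lemma deg_le_msize f : deg_le (msize f) f.
Proof. by move=> m lm; apply: memN_msupp_eq0; apply: msize_mdeg_ge; apply: ltnW. Qed.

Lemma deg_le_X i : deg_le 1 ('X_i : {mpoly R[2]}).
Proof. by move=> m lm; rewrite mcoeffX; case: eqP lm => // <-; rewrite mdeg1. Qed.

Lemma deg_le_jacobian s d P f : deg_le s P -> deg_le d f ->
  deg_le (s + d) (jacobian_det P f).
Proof.
by move=> hP hf; apply: deg_leB; apply: deg_leM; apply: deg_le_mderiv.
Qed.

Lemma deg_le_iter s P f n : deg_le s P -> deg_le 1 f ->
  deg_le (1 + n * s) (iter n (jacobian_det P) f).
Proof.
move=> hP hf; elim: n => [|n IH] //=.
by rewrite mulSn addnCA; apply: deg_le_jacobian.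
Qed.

End DegreeBound.

Section MajorantNorm.
Variable w : algR.
Hypothesis w1 : 1 <= w.
Implicit Types f g : {mpoly algC[2]}.

Let w0 : 0 <= w. Proof. exact: le_trans ler01 w1. Qed.

(** Sum of the moduli of the terms on the polydisc of radius w. *)
Definition mn f : algR := \sum_(m <- msupp f) nm f@_m * w ^+ mdeg m.

Lemma mnE k f : (msize f <= k)%N ->
  mn f = \sum_(m : 'X_{1..2 < k}) nm f@_m * w ^+ mdeg m.
Proof.
move=> le; pose I : subFinType _ := 'X_{1..2 < k}.
rewrite /mn (big_mksub I) ?msupp_uniq //=; first last.
  by move=> x /msize_mdeg_lt /leq_trans; apply.
by rewrite big_rmcond //= => j /memN_msupp_eq0 ->; rewrite nm0 mul0r.
Qed.

Lemma mn_ge0 f : 0 <= mn f.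
Proof. by apply: sumr_ge0 => m _; rewrite mulr_ge0 ?nm_ge0 ?exprn_ge0. Qed.

Lemma mn0 : mn 0 = 0.
Proof. by rewrite /mn msupp0 big_nil. Qed.

Lemma mnD f g : mn (f + g) <= mn f + mn g.
Proof.
pose k := maxn (maxn (msize f) (msize g)) (msize (f + g)).
rewrite !(@mnE k) ?leq_max ?leqnn ?orbT // -big_split /=.
apply: ler_sum => m _; rewrite -mulrDl mcoeffD ler_wpM2r ?exprn_ge0 //.
exact: ler_nmD.
Qed.

Lemma mn_sum (I : Type) (s : seq I) (F : I -> {mpoly algC[2]}) :
  mn (\sum_(i <- s) F i) <= \sum_(i <- s) mn (F i).
Proof.
elim/big_rec2: _ => [|i x y _ h]; first by rewrite mn0.
by apply: le_trans (mnD _ _) _; rewrite lerD2l.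
Qed.

Lemma mn_monomial c (m : 'X_{1..2}) : mn (c *: 'X_[m]) = nm c * w ^+ mdeg m.
Proof.
have [->|c0] := eqVneq c 0; first by rewrite scale0r mn0 nm0 mul0r.
by rewrite /mn msuppMCX // big_seq1 mcoeffZ mcoeffX eqxx mulr1.
Qed.

Lemma mnM f g : mn (f * g) <= mn f * mn g.
Proof.
rewrite mpolyME big_allpairs; apply: le_trans (mn_sum _ _) _.
rewrite /mn mulr_suml; apply: ler_sum => m1 _.
apply: le_trans (mn_sum _ _) _; rewrite mulr_sumr; apply: ler_sum => m2 _ /=.
by rewrite mn_monomial nmM mdegD exprD mulrACA.
Qed.

Lemma mnZ c f : mn (c *: f) <= nm c * mn f.
Proof.
rewrite -mul_mpolyC; apply: le_trans (mnM _ _) _.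
by rewrite -[c%:MP]mulr1 mul_mpolyC -mpolyX0 mn_monomial mdeg0 expr0 mulr1.
Qed.

Lemma mn_mderiv d f i : deg_le d f -> mn f^`M(i) <= d%:R * mn f.
Proof.
move=> hf; rewrite /mderiv; apply: le_trans (mn_sum _ _) _.
rewrite {2}/mn mulr_sumr big_seq [leRHS]big_seq; apply: ler_sum => m hm.
rewrite mn_monomial nmM nm_nat -mulrA.
have md : (m i <= d)%N.
  have [//|lt] := leqP (mdeg m) d; last by move: hm; rewrite mcoeff_msupp hf ?eqxx.
  by apply: leq_trans; rewrite mdegE (bigD1 i) //= leq_addr.
apply: ler_pM; rewrite ?ler0n ?mulr_ge0 ?nm_ge0 ?exprn_ge0 ?ler_nat //.
rewrite ler_wpM2l ?nm_ge0 // ler_weXn2l // !mdegE leq_sum // => j _.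
by rewrite mnmBE leq_subr.
Qed.

Lemma nm_meval f (s : 'I_2 -> algC) : (forall i, nm (s i) <= w) -> nm f.@[s] <= mn f.
Proof.
move=> hs; rewrite mevalE; apply: le_trans (nm_sum _ _ _) _.
apply: ler_sum => m _; rewrite nmM ler_wpM2l ?nm_ge0 //.
rewrite mdegE -prodrXr.
have -> : nm (\prod_i s i ^+ m i) = \prod_i nm (s i) ^+ m i.
  by elim/big_rec2: _ => [|i x y _ <-]; rewrite ?nm1 // nmM nmX.
apply: ler_prod => i _; rewrite exprn_ge0 ?nm_ge0 //=.
by rewrite lerXn2r // nnegrE ?nm_ge0.
Qed.

Variables (P : {mpoly algC[2]}) (s : nat).
Hypothesis degP : deg_le s P.
Local Notation D := (jacobian_det P).
Let p := mn P^`M(0) + mn P^`M(1).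

Lemma mn_jacobian d f : deg_le d f -> mn (D f) <= d%:R * p * mn f.
Proof.
move=> hf; rewrite /jacobian_det.
apply: le_trans (mnD _ _) _.
have -> : - (P^`M(1) * f^`M(0)) = (-1) *: (P^`M(1) * f^`M(0)) by rewrite scaleN1r.
have h1 := mnM P^`M(0) f^`M(1).
have h2 := mnZ (-1) (P^`M(1) * f^`M(0)); rewrite nmN nm1 mul1r in h2.
have h3 := mnM P^`M(1) f^`M(0).
have h4 : mn P^`M(0) * mn f^`M(1) <= mn P^`M(0) * (d%:R * mn f).
  by rewrite ler_wpM2l ?mn_ge0 ?mn_mderiv.
have h5 : mn P^`M(1) * mn f^`M(0) <= mn P^`M(1) * (d%:R * mn f).
  by rewrite ler_wpM2l ?mn_ge0 ?mn_mderiv.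
rewrite /p; lra.
Qed.

(** The n-th iterate has degree at most 1 + n s, so that each further derivative
    costs a factor proportional to n: the Taylor series of the flow has a
    positive radius of convergence, uniformly on bounded sets. *)
Lemma mn_iter f n : deg_le 1 f ->
  mn (iter n D f) <= n`!%:R * (s.+1%:R * p) ^+ n * mn f.
Proof.
move=> hf; elim: n => [|n IH]; first by rewrite /= fact0 expr0 !mul1r.
rewrite iterS; apply: le_trans (mn_jacobian (@deg_le_iter _ s P f n degP hf)) _.
have p0 : 0 <= p by rewrite addr_ge0 ?mn_ge0.
apply: le_trans (_ : (n.+1%:R * (s.+1%:R * p)) * mn (iter n D f) <= _).
  rewrite ler_wpM2r ?mn_ge0 // mulrA ler_wpM2r // -natrM ler_nat.
  by nia.
rewrite factS natrM exprS.
apply: le_trans (_ : (n.+1%:R * (s.+1%:R * p)) *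
   (n`!%:R * (s.+1%:R * p) ^+ n * mn f) <= _).
  by rewrite ler_wpM2l ?mulr_ge0 ?ler0n.
by rewrite le_eqVlt; apply/orP; left; apply/eqP; ring.
Qed.

End MajorantNorm.

(** * The flow of a Jacobian derivation *)
Section Truncation.
Variables (R : comNzRingType) (N : nat).
Implicit Types p q : {poly R}.

(** Equality modulo the power N + 1 of the variable: truncated series form a
    ring, and Phi below plays the part of a ring morphism into it. *)
Definition eqN p q := forall i, (i <= N)%N -> p`_i = q`_i.

Lemma eqN_trans p q r : eqN p q -> eqN q r -> eqN p r.
Proof. by move=> h1 h2 i le; rewrite h1 // h2. Qed.

Lemma eqND p p' q q' : eqN p p' -> eqN q q' -> eqN (p + q) (p' + q').
Proof. by move=> h1 h2 i le; rewrite !coefD h1 // h2. Qed.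

Lemma eqNM p p' q q' : eqN p p' -> eqN q q' -> eqN (p * q) (p' * q').
Proof.
move=> h1 h2 i le; rewrite !coefM; apply: eq_bigr => j _.
by rewrite h1 ?h2 // (leq_trans _ le) ?leq_subr // -ltnS.
Qed.

Variables (S : comNzRingType) (f : {rmorphism R -> S}) (Phi : S -> {poly R}).
Hypothesis PhiD : forall a b, eqN (Phi (a + b)) (Phi a + Phi b).
Hypothesis PhiM : forall a b, eqN (Phi (a * b)) (Phi a * Phi b).
Hypothesis PhiC : forall c, eqN (Phi (f c)) c%:P.

Lemma eqN0 : eqN (Phi 0) 0.
Proof. by rewrite -(rmorph0 f) -polyC0. Qed.

Lemma eqN_ev1 (p : S) a : eqN (Phi (ev1 f p a)) (ev1 (@polyC R) (Phi p) a).
Proof.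
elim/poly_ind: a => [|a c IH]; first by rewrite !rmorph0; apply: eqN0.
rewrite !rmorphD !rmorphM /= !ev1X !ev1C.
by apply: eqN_trans (PhiD _ _) _; apply: eqND => //; apply: eqN_trans (PhiM _ _) _; apply: eqNM.
Qed.

Lemma eqN_ev2 (p q : S) a : eqN (Phi (ev2 f p q a)) (ev2 (@polyC R) (Phi p) (Phi q) a).
Proof.
elim/poly_ind: a => [|a c IH]; first by rewrite !rmorph0; apply: eqN0.
rewrite !rmorphD !rmorphM /= !ev2X !ev2C.
apply: eqN_trans (PhiD _ _) _; apply: eqND; last exact: eqN_ev1.
by apply: eqN_trans (PhiM _ _) _; apply: eqNM.
Qed.

Lemma eqN_ev3 (p q z : S) a :
  eqN (Phi (ev3 f p q z a)) (ev3 (@polyC R) (Phi p) (Phi q) (Phi z) a).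
Proof.
elim/poly_ind: a => [|a c IH]; first by rewrite !rmorph0; apply: eqN0.
rewrite !rmorphD !rmorphM /= !ev3X !ev3C.
apply: eqN_trans (PhiD _ _) _; apply: eqND; last exact: eqN_ev2.
by apply: eqN_trans (PhiM _ _) _; apply: eqNM.
Qed.

End Truncation.

Lemma ev1_polyC (R : comNzRingType) (u : R) a :
  ev1 (@polyC R) u%:P a = (a.[u])%:P.
Proof.
elim/poly_ind: a => [|a c IH]; first by rewrite rmorph0 horner0.
by rewrite rmorphD rmorphM /= ev1X ev1C IH hornerMXaddC polyCD polyCM.
Qed.

Lemma horner_morphE (R S : comNzRingType) (f : {rmorphism R -> S}) q
    (h : commr_rmorph f q) a :
  horner_morph h a = \sum_(i < size a) f a`_i * q ^+ i.
Proof.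
rewrite /horner_morph (horner_coef_wide _ (size_poly _ _)).
by apply: eq_bigr => i _; rewrite coef_map.
Qed.

Lemma ev2E (R S : comNzRingType) (f : {rmorphism R -> S}) p q a :
  ev2 f p q a = \sum_(i < size a) ev1 f p a`_i * q ^+ i.
Proof. exact: horner_morphE. Qed.

Lemma ev3E (R S : comNzRingType) (f : {rmorphism R -> S}) p q z a :
  ev3 f p q z a = \sum_(i < size a) ev2 f p q a`_i * z ^+ i.
Proof. exact: horner_morphE. Qed.

Lemma size_ev2_shift (R : comNzRingType) (u v : R) (a : {poly {poly R}}) :
  (size (ev2 (@polyC R) u%:P (v%:P + 'X) a) <= size a)%N.
Proof.
rewrite ev2E; apply: leq_trans (size_sum _ _ _) _; apply/bigmax_leqP => i _.
rewrite ev1_polyC; apply: leq_trans (size_polyMleq _ _) _.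
have h1 := size_polyC_leq1 ((a`_i).[u]).
have h2 : (size ((v%:P + 'X) ^+ i) <= i.+1)%N.
  by apply: leq_trans (size_poly_exp_leq _ _) _; rewrite addrC size_XaddC mul1n.
apply: leq_trans (ltn_ord i); rewrite -subn1 leq_subLR.
by apply: leq_trans (leq_add h1 h2) _.
Qed.

(** Cauchy's bound for roots, with a right-hand side e instead of 0 because truncated
    series satisfy their equation up to a small error. *)
Lemma root_bound (x al e : algC) n (b : 'I_n.+1 -> algC) (beta : algR) :
  al != 0 -> nm e <= 1 -> \sum_(j < n.+1) nm (b j) <= beta ->
  \sum_(j < n.+1) b j * x ^+ j + al * x ^+ n.+1 = e ->
  nm x <= 1 + (beta + 1) / nm al.
Proof.
move=> al0 e1 hb E.
have nal : 0 < nm al by rewrite lt_def nm_eq0 al0 nm_ge0.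
have b0 : 0 <= beta by apply: le_trans hb; apply: sumr_ge0 => j _; apply: nm_ge0.
have [x1|x1] := leP (nm x) 1.
  by rewrite ler_wpDr // divr_ge0 ?nm_ge0 // addr_ge0 ?ler01.
have xn : 0 < nm x ^+ n by rewrite exprn_gt0 // (lt_trans ltr01).
suff : nm x <= (beta + 1) / nm al by lra.
rewrite ler_pdivlMr // -(ler_pM2r xn).
have -> : nm x * nm al * nm x ^+ n = nm (al * x ^+ n.+1).
  by rewrite nmM nmX exprS [nm x * nm al]mulrC mulrA.
have -> : al * x ^+ n.+1 = e - \sum_(j < n.+1) b j * x ^+ j by rewrite -E; ring.
apply: le_trans (ler_nmD _ _) _; rewrite nmN mulrDl mul1r addrC lerD //.
  apply: le_trans (nm_sum _ _ _) _.
  apply: le_trans (_ : (\sum_(j < n.+1) nm (b j)) * nm x ^+ n <= _); last first.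
    by rewrite ler_pM2r.
  rewrite mulr_suml; apply: ler_sum => j _.
  by rewrite nmM nmX ler_wpM2l ?nm_ge0 // ler_weXn2l // ?ltW // -ltnS.
by apply: le_trans e1 _; rewrite exprn_ege1 // ltW.
Qed.

Section Flow.
Variables (P Q : {mpoly algC[2]}) (s : 'I_2 -> algC).
Hypothesis jac1 : jacobian_det P Q = 1.
Local Notation D := (jacobian_det P).

(** The n-th Taylor coefficient, in the time, of f along the flow of P that
    starts at s. *)
Definition tc n f : algC := (iter n D f).@[s] / n`!%:R.

Definition flow N f : {poly algC} := \poly_(n < N.+1) tc n f.

Lemma tcS n f : n.+1%:R * tc n.+1 f = tc n (D f).
Proof.
rewrite /tc -iterSr mulrCA; congr (_ * _).
by rewrite factS natrM invfM mulrA mulfV ?mul1r // pnatr_eq0.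
Qed.

Lemma tcD n f g : tc n (f + g) = tc n f + tc n g.
Proof.
rewrite /tc -mulrDl -mevalD; congr (_.@[_] / _).
by elim: n => //= n ->; rewrite jacobianD.
Qed.

Lemma tc0 f : tc 0 f = f.@[s].
Proof. by rewrite /tc /= fact0 divr1. Qed.

(** Leibniz: exp (t D) is a ring morphism. *)
Lemma tcM n f g : tc n (f * g) = \sum_(k < n.+1) tc k f * tc (n - k) g.
Proof.
elim: n f g => [|n IH] f g; first by rewrite big_ord1 !tc0 mevalM.
apply: (@mulfI _ n.+1%:R); first by rewrite pnatr_eq0.
rewrite tcS jacobianM tcD !IH mulr_sumr.
have -> : \sum_(k < n.+1) tc k (D f) * tc (n - k) g
  = \sum_(k < n.+2) k%:R * (tc k f * tc (n.+1 - k) g).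
  rewrite [RHS]big_ord_recl mul0r add0r; apply: eq_bigr => k _.
  by rewrite -tcS /= mulrA subSS.
have -> : \sum_(k < n.+1) tc k f * tc (n - k) (D g)
  = \sum_(k < n.+2) (n.+1 - k)%:R * (tc k f * tc (n.+1 - k) g).
  rewrite [RHS]big_ord_recr /= subnn mul0r addr0; apply: eq_bigr => k _.
  have kn : (k <= n)%N by rewrite -ltnS.
  by rewrite subSn // -tcS mulrCA.
rewrite -big_split /=; apply: eq_bigr => k _.
by rewrite -mulrDl -natrD subnKC // -ltnS.
Qed.

Lemma tcC n c : tc n c%:MP = if n is 0 then c else 0.
Proof.
case: n => [|n]; first by rewrite tc0 mevalC.
by rewrite /tc iterSr jacobianC iter_jacobian0 meval0 mul0r.
Qed.

Lemma tc_iter n m f : tc m (iter n D f) = ('C(n + m, n) * n`!)%:R * tc (n + m) f.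
Proof.
have key (a b c x : algC) : a != 0 -> c != 0 -> x / b = c * a * (x / (c * (a * b))).
  move=> a0 c0; rewrite mulrCA; congr (_ * _).
  by rewrite mulrA invfM mulrA mulfV ?mul1r // mulf_neq0.
rewrite /tc -iterD addnC -(bin_fact (leq_addr m n)) addKn !natrM.
by apply: key; rewrite pnatr_eq0 -lt0n ?fact_gt0 // bin_gt0 leq_addr.
Qed.

Lemma tcZ n c f : tc n (c *: f) = c * tc n f.
Proof.
rewrite /tc mulrA -mevalZ; congr (_.@[_] / _).
by elim: n => //= n ->; rewrite jacobianZ.
Qed.

Lemma flowE N f i : (flow N f)`_i = if (i <= N)%N then tc i f else 0.
Proof. by rewrite coef_poly ltnS. Qed.

Lemma flowD N f g : eqN N (flow N (f + g)) (flow N f + flow N g).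
Proof. by move=> i le; rewrite coefD !flowE le tcD. Qed.

Lemma flowM N f g : eqN N (flow N (f * g)) (flow N f * flow N g).
Proof.
move=> i le; rewrite coefM flowE le tcM; apply: eq_bigr => k _.
have ki : (k <= i)%N by rewrite -ltnS.
by rewrite !flowE (leq_trans ki le) (leq_trans (leq_subr _ _) le).
Qed.

Lemma flowC N c : eqN N (flow N c%:MP) c%:P.
Proof. by move=> i le; rewrite flowE le tcC coefC; case: i le. Qed.

Lemma flowP N : flow N P = (P.@[s])%:P.
Proof.
apply/polyP => i; rewrite flowE coefC; case: i => [|i]; first by rewrite tc0.
by rewrite /tc iterSr jacobian_self iter_jacobian0 meval0 mul0r if_same.
Qed.

(** D Q = 1, so Q is the time up to a constant. *)
Lemma flowQ N : (0 < N)%N -> flow N Q = (Q.@[s])%:P + 'X.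
Proof.
move=> N0; apply/polyP => i; rewrite flowE coefD coefC coefX.
case: i => [|[|i]] /=; first by rewrite tc0 addr0.
  by rewrite N0 /tc /= jac1 meval1 (_ : 1`! = 1%N) // divr1 add0r.
rewrite /tc !iterSr jac1 -mpolyC1 jacobianC iter_jacobian0 meval0 mul0r if_same.
by rewrite addr0.
Qed.

Lemma flow_ev3 N z Pi : (0 < N)%N -> ev3 (@mpolyC 2 algC) P Q z Pi = 0 ->
  eqN N (ev3 (@polyC algC) (P.@[s])%:P ((Q.@[s])%:P + 'X) (flow N z) Pi) 0.
Proof.
move=> N0 h i le.
have := eqN_ev3 (@flowD N) (@flowM N) (@flowC N) P Q z Pi le.
rewrite h flowP flowQ // => <-.
by have := @flowC N 0 i le; rewrite mpolyC0 polyC0.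
Qed.

(** Taylor coefficients of T along the flow can be read on the polynomial
    obtained by substituting the truncated flow in T. *)
Lemma flow_meval N (T : {mpoly algC[2]}) : exists E : {poly algC},
  eqN N (flow N T) E /\
  forall t, E.[t] = T.@[tnth [tuple (flow N 'X_0).[t]; (flow N 'X_1).[t]]].
Proof.
have [a ->] := mpoly2_ev T.
exists (ev2 (@polyC algC) (flow N 'X_0) (flow N 'X_1) a); split.
  exact: eqN_ev2 (@flowD N) (@flowM N) (@flowC N) _ _ _.
move=> t; set v := tnth _.
have e0 : (meval v : {rmorphism {mpoly algC[2]} -> algC}) 'X_0 = (horner_eval t : {rmorphism {poly algC} -> algC}) (flow N 'X_0) by rewrite /= mevalXU.
have e1 : (meval v : {rmorphism {mpoly algC[2]} -> algC}) 'X_1 = (horner_eval t : {rmorphism {poly algC} -> algC}) (flow N 'X_1) by rewrite /= mevalXU.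
rewrite -/(horner_eval t _) (rmorph_ev2 _ (horner_eval t)).
rewrite (rmorph_ev2 _ (meval v)) e0 e1; apply: eq_ev2 => c.
by rewrite /comp /= /horner_eval hornerC mevalC.
Qed.

End Flow.

Section Growth.
Variables (P Q : {mpoly algC[2]}) (s : 'I_2 -> algC).
Hypothesis jac1 : jacobian_det P Q = 1.
Local Notation D := (jacobian_det P).
Local Notation tc := (tc P s).
Local Notation flow := (flow P s).
Variables (Pi : 'I_2 -> {poly {poly {poly algC}}}) (al : 'I_2 -> {poly algC}).
Variable dg : 'I_2 -> nat.
Hypothesis sizePi : forall i, size (Pi i) = (dg i).+2.
Hypothesis leadPi : forall i, (Pi i)`_(dg i).+1 = (al i)%:P.
Hypothesis rel_Pi : forall i, ev3 (@mpolyC 2 algC) P Q 'X_i (Pi i) = 0.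
Hypothesis al0 : forall i, (al i).[P.@[s]] != 0.

Let A i j := ev2 (@polyC algC) (P.@[s])%:P ((Q.@[s])%:P + 'X) (Pi i)`_j.
Let beta i r := \sum_(j < (dg i).+1) wn r (A i j).
(** A bound on the moduli of x and y at any point with time of modulus r that
    satisfies their integral equations over polynomials in the time.  It does
    not refer to the radius of convergence, which makes the continuation
    argument work. *)
Definition flow_bound (r : algR) : algR :=
  \sum_i (1 + (beta i r + 1) / nm (al i).[P.@[s]]).

Let E N i : {poly algC} :=
  \sum_(j < (dg i).+1) A i j * flow N 'X_i ^+ j
  + ((al i).[P.@[s]])%:P * flow N 'X_i ^+ (dg i).+1.

Lemma E_small N i : (0 < N)%N -> eqN N (E N i) 0.
Proof.
move=> N0; have := flow_ev3 s jac1 N0 (rel_Pi i).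
rewrite ev3E sizePi big_ord_recr /= leadPi ev2C ev1_polyC; apply.
Qed.

Lemma beta_ge0 i r : 0 <= r -> 0 <= beta i r.
Proof. by move=> r0; apply: sumr_ge0 => j _; apply: wn_ge0. Qed.

Lemma flow_bound_term_ge1 i r : 0 <= r -> 1 <= 1 + (beta i r + 1) / nm (al i).[P.@[s]].
Proof. by move=> r0; rewrite lerDl divr_ge0 ?nm_ge0 // addr_ge0 ?ler01 ?beta_ge0. Qed.

Lemma flow_bound_term i r : 0 <= r -> 1 + (beta i r + 1) / nm (al i).[P.@[s]] <= flow_bound r.
Proof.
move=> r0; rewrite /flow_bound (bigD1 i) //= lerDl; apply: sumr_ge0 => j _.
exact: le_trans ler01 (flow_bound_term_ge1 _ r0).
Qed.

Lemma flow_bound_ge1 r : 0 <= r -> 1 <= flow_bound r.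
Proof. by move=> r0; apply: le_trans (flow_bound_term 0 r0); apply: flow_bound_term_ge1. Qed.

Lemma flow_bound_le r r1 : 0 <= r -> r <= r1 -> flow_bound r <= flow_bound r1.
Proof.
move=> r0 le; apply: ler_sum => i _; rewrite lerD2l ler_wpM2r ?invr_ge0 ?nm_ge0 //.
by rewrite lerD2r; apply: ler_sum => j _; apply: wn_le.
Qed.

(** A lower bound for the radius of convergence of the flow. *)
Definition good (r : algR) := exists B, forall i n, nm (tc n 'X_i) * r ^+ n <= B.

(** Inside the disc of convergence the truncated flow satisfies the integral
    equations up to an error divisible by a high power of t, which is negligible
    on a smaller disc. *)
Lemma good_flow_bounded (r r1 : algR) : good r -> 0 <= r1 -> r1 < r ->
  exists N0, forall N, (N0 <= N)%N -> forall i t, nm t = r1 ->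
    nm (flow N 'X_i).[t] <= flow_bound r1.
Proof.
move=> [B hB] r10 r1r.
have B0 : 0 <= B.
  by apply: le_trans (hB 0 0%N); rewrite expr0 mulr1 nm_ge0.
have r0 : 0 < r by apply: le_lt_trans r1r.
pose r2 := (r1 + r) / 2%:R.
have r12 : r1 < r2 by rewrite /r2; lra.
have r2r : r2 < r by rewrite /r2; lra.
have r20 : 0 < r2 by apply: le_lt_trans r12.
pose q := r2 / r; have q0 : 0 <= q by rewrite divr_ge0 // ltW.
have q1 : q < 1 by rewrite ltr_pdivrMr // mul1r.
pose W := B / (1 - q).
have W0 : 0 <= W by rewrite divr_ge0 // subr_ge0 ltW.
have hW N i : wn r2 (flow N 'X_i) <= W.
  rewrite (@wnE N.+1) ?size_poly //.
  apply: le_trans (_ : \sum_(k < N.+1) B * q ^+ k <= _).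
    apply: ler_sum => k _; rewrite flowE -ltnS ltn_ord.
    have -> : B * q ^+ k = B / r ^+ k * r2 ^+ k by rewrite /q expr_div_n mulrA mulrAC.
    by rewrite ler_wpM2r ?exprn_ge0 ?(ltW r20) // ler_pdivlMr ?exprn_gt0.
  rewrite -mulr_sumr ler_wpM2l // -[leRHS]mul1r ler_pdivlMr ?subr_gt0 // mulrC.
  have -> : (1 - q) * (\sum_(k < N.+1) q ^+ k) = 1 - q ^+ N.+1.
    by rewrite -[1 - q]opprB mulNr -subrX1 opprB.
  by rewrite gerBl exprn_ge0.
pose V i := \sum_(j < (dg i).+1) wn r2 (A i j) * W ^+ j
   + nm (al i).[P.@[s]] * W ^+ (dg i).+1.
have hE N i : wn r2 (E N i) <= V i.
  have r2' := ltW r20.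
  apply: le_trans (wnD _ _ r2') _; apply: lerD.
    apply: le_trans (wn_sum _ _ r2') _; apply: ler_sum => j _.
    apply: le_trans (wnM _ _ r2') _; rewrite ler_wpM2l ?wn_ge0 //.
    apply: le_trans (wnX _ _ r2') _.
    by rewrite lerXn2r ?nnegrE ?wn_ge0.
  rewrite wnCM ler_wpM2l ?nm_ge0 //; apply: le_trans (wnX _ _ r2') _.
  by rewrite lerXn2r ?nnegrE ?wn_ge0.
have q'1 : r1 / r2 < 1 by rewrite ltr_pdivrMr // mul1r.
have q'0 : 0 <= r1 / r2 by rewrite divr_ge0 // ltW.
have [M0 hM0] := exp_small (V 0) q'0 q'1.
have [M1 hM1] := exp_small (V 1) q'0 q'1.
exists (maxn 1 (maxn M0 M1)) => N; rewrite !geq_max => /and3P[N0 N1 N2] i t tr.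
have small : nm (E N i).[t] <= 1.
  have tr1 : nm t <= r1 by rewrite tr.
  apply: le_trans (nm_horner_wn _ tr1) _.
  have Ez k : (k <= N)%N -> (E N i)`_k = 0.
    by move=> kN; rewrite (E_small i N0 kN) coef0.
  apply: le_trans (wn_vanish r20 r10 (ltW r12) Ez) _.
  apply: le_trans (_ : V i * (r1 / r2) ^+ N <= 1); last first.
    by case: (ord2P i) => ->; auto.
  by rewrite mulrC ler_wpM2r ?exprn_ge0.
apply: le_trans (flow_bound_term i r10).
apply: (@root_bound _ _ (E N i).[t] (dg i) (fun j => (A i j).[t])) => //.
  by apply: ler_sum => j _; apply: nm_horner_wn; rewrite tr.
rewrite /E hornerD horner_sum hornerM hornerC horner_exp; congr (_ + _).
by apply: eq_bigr => j _; rewrite hornerM horner_exp.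
Qed.

Lemma good_coef (r r1 : algR) i n : good r -> 0 <= r1 -> r1 < r ->
  nm (tc n 'X_i) * r1 ^+ n <= flow_bound r1.
Proof.
move=> gr r10 r1r; have [N0 hN] := good_flow_bounded gr r10 r1r.
have := @cauchy_coef (flow (maxn N0 n) 'X_i) r1 (flow_bound r1) n r10.
rewrite flowE leq_maxr; apply; first exact: le_trans ler01 (flow_bound_ge1 r10).
by move=> t tr; apply: hN => //; apply: leq_maxl.
Qed.

Variables (dP : nat).
Hypothesis degP : deg_le dP P.

Lemma tc_local_bound w : 1 <= w -> exists2 C, 1 <= C &
  forall i n (v : 'I_2 -> algC), (forall j, nm (v j) <= w) ->
    nm (iter n D 'X_i).@[v] <= n`!%:R * C ^+ n * w.
Proof.
move=> w1; pose p := mn w P^`M(0) + mn w P^`M(1).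
have p0 : 0 <= p by rewrite addr_ge0 ?mn_ge0.
exists (1 + dP.+1%:R * p); first by rewrite lerDl mulr_ge0 ?ler0n.
move=> i n v hv; apply: le_trans (nm_meval w1 _ hv) _.
apply: le_trans (mn_iter w1 degP n (@deg_le_X _ i)) _.
have -> : mn w 'X_i = w.
  by rewrite -[X in mn w X]scale1r mn_monomial nm1 mul1r mdeg1 expr1.
have w0 : 0 <= w by apply: le_trans ler01 w1.
rewrite ler_wpM2r // ler_wpM2l ?ler0n //.
by rewrite lerXn2r ?nnegrE ?addr_ge0 ?ler01 ?mulr_ge0 ?ler0n // lerDr ler01.
Qed.

(** Restarting the flow from a point at time t continues it by C^-1, with C
    depending only on the size of that point, which [flow_bound] controls for
    all times of modulus at most rmax.  The expansions at all points of a circle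
    are combined by Cauchy's estimate, giving the bound on 'C(n + m, n) times
    the coefficient of rank n + m; the sum over n + m = M is a binomial sum with
    r1 + C^-1. *)
Lemma good_extend (rmax : algR) : 0 <= rmax -> exists2 e, 0 < e &
  good e /\ forall r, 0 <= r -> r <= rmax -> good r -> good (r + e).
Proof.
move=> rm0; pose w := flow_bound rmax + nm (s 0) + nm (s 1).
have w1 : 1 <= w.
  by have := flow_bound_ge1 rm0; have := nm_ge0 (s 0); have := nm_ge0 (s 1); rewrite /w; lra.
have [C C1 hC] := tc_local_bound w1.
have C0 : 0 < C by apply: lt_le_trans C1.
have hs j : nm (s j) <= w.
  have := flow_bound_ge1 rm0; have := nm_ge0 (s 0); have := nm_ge0 (s 1).
  by rewrite /w; case: (ord2P j) => ->; lra.
have start i n : nm (tc n 'X_i) <= C ^+ n * w.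
  rewrite /tc nmM nmV nm_nat ler_pdivrMr ?ltr0n ?fact_gt0 //.
  by apply: le_trans (hC i n s hs) _; rewrite le_eqVlt; apply/orP; left; apply/eqP; ring.
pose e := C^-1 / 4%:R.
have e0 : 0 < e by rewrite divr_gt0 ?invr_gt0 ?ltr0n.
have eC : C^-1 = 4%:R * e by rewrite mulrC divfK // pnatr_eq0.
exists e => //; split.
  exists w => i n; apply: le_trans (_ : C ^+ n * w * e ^+ n <= _).
    by rewrite ler_wpM2r ?start // exprn_ge0 // ltW.
  rewrite mulrAC -exprMn -[leRHS]mul1r ler_wpM2r ?(le_trans ler01 w1) //.
  have Ce0 : 0 <= C * e by rewrite mulr_ge0 ?(ltW C0) ?(ltW e0).
  have Ce1 : C * e <= 1.
    by rewrite /e mulrA mulfV ?gt_eqF // mul1r invf_le1 ?ltr0n // ler1n.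
  exact: exprn_ile1.
move=> r r0 rm gr.
have [re|re] := leP r e.
  exists w => i n; apply: le_trans (_ : C ^+ n * w * (r + e) ^+ n <= _).
    by rewrite ler_wpM2r ?start // exprn_ge0 // addr_ge0 // ltW.
  rewrite mulrAC -exprMn -[leRHS]mul1r ler_wpM2r ?(le_trans ler01 w1) //.
  have Ce0 : 0 <= C * (r + e) by rewrite mulr_ge0 ?addr_ge0 ?(ltW C0) ?(ltW e0).
  have Ce1 : C * (r + e) <= 1 by rewrite mulrC -ler_pdivlMr // mul1r eC; lra.
  exact: exprn_ile1.
pose r1 := r - e.
have r10 : 0 <= r1 by rewrite subr_ge0 ltW.
have r1r : r1 < r by rewrite /r1; lra.
have key i n m : 'C(n + m, n)%:R * nm (tc (n + m) 'X_i) * r1 ^+ m <= C ^+ n * w.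
  have [N0 hN] := good_flow_bounded gr r10 r1r.
  pose f := n`!%:R^-1 *: iter n D 'X_i.
  have [T [eT hT]] := flow_meval P s (maxn N0 m) f.
  have := @cauchy_coef T r1 (C ^+ n * w) m r10.
  rewrite -eT ?leq_maxr // flowE leq_maxr /f tcZ tc_iter.
  rewrite natrM [X in nm X](_ : _ = 'C(n + m, n)%:R * tc (n + m) 'X_i); last first.
    by rewrite mulrA [_^-1 * _]mulrC mulfK // pnatr_eq0 -lt0n fact_gt0.
  rewrite nmM nm_nat; apply.
    by rewrite mulr_ge0 ?exprn_ge0 ?(ltW C0) // (le_trans ler01 w1).
  move=> t tr; rewrite hT mevalZ nmM nmV nm_nat mulrC ler_pdivrMr ?ltr0n ?fact_gt0 //.
  apply: le_trans (hC i n _ _) _; last first.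
    by rewrite le_eqVlt; apply/orP; left; apply/eqP; ring.
  move=> j; apply: le_trans (_ : flow_bound r1 <= _); last first.
    apply: le_trans (flow_bound_le r10 (_ : r1 <= rmax)) _; first by rewrite /r1; lra.
    have := nm_ge0 (s 0); have := nm_ge0 (s 1); rewrite /w; lra.
  by case: (ord2P j) => ->; apply: hN => //; apply: leq_maxl.
have sumkey i M : nm (tc M 'X_i) * (r1 + C^-1) ^+ M <= M.+1%:R * w.
  have -> : M.+1%:R * w = \sum_(n < M.+1) w by rewrite sumr_const card_ord mulr_natl.
  rewrite exprDn mulr_sumr.
  apply: ler_sum => n _.
  have nM : (n <= M)%N by rewrite -ltnS.
  have := key i n (M - n)%N; rewrite subnKC // => h.
  have Cn : 0 < C ^+ n by rewrite exprn_gt0.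
  rewrite exprVn -mulr_natl.
  have -> : nm (tc M 'X_i) * ('C(M, n)%:R * (r1 ^+ (M - n) * (C ^+ n)^-1))
    = 'C(M, n)%:R * nm (tc M 'X_i) * r1 ^+ (M - n) / C ^+ n.
    by rewrite mulrCA !mulrA.
  by rewrite ler_pdivrMr // [w * _]mulrC.
pose q := (r + e) / (r1 + C^-1).
have d0 : 0 < r1 + C^-1 by rewrite eC /r1; lra.
have q0 : 0 <= q.
  by apply: divr_ge0; [rewrite addr_ge0 // (ltW e0) | exact: ltW].
have q1 : q < 1 by rewrite /q (ltr_pdivrMr _ _ d0) mul1r eC /r1; lra.
have [B hB] := linear_exp_bounded q0 q1.
exists (w * B) => i M.
have -> : r + e = (r1 + C^-1) * q by rewrite mulrC divfK // gt_eqF.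
rewrite exprMn mulrA; apply: le_trans (_ : M.+1%:R * w * q ^+ M <= _).
  by rewrite ler_wpM2r ?exprn_ge0.
by rewrite mulrAC mulrC ler_wpM2l // (le_trans ler01 w1).
Qed.

(** The gain e is the same at every step. *)
Lemma good_all (r : algR) : 0 <= r -> good r.
Proof.
move=> r0; have [e e0 [ge gs]] := good_extend r0.
have good_mult n : (n%:R * e <= r) -> good (n.+1%:R * e).
  elim: n => [|n IH] hn; first by rewrite mul1r.
  rewrite -natr1 mulrDl mul1r; apply: gs => //.
    by rewrite mulr_ge0 ?ler0n // ltW.
  by apply: IH; apply: le_trans hn; rewrite ler_pM2r // ler_nat.
have le_good a b : 0 <= a -> a <= b -> good b -> good a.
  move=> a0 ab [B hB]; exists B => i n; apply: le_trans (hB i n).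
  rewrite ler_wpM2l ?nm_ge0 // lerXn2r // nnegrE //.
  exact: le_trans ab.
pose n := Num.truncn (r / e).
have := truncn_itv (divr_ge0 r0 (ltW e0)); rewrite -/n => /andP[n1 n2].
rewrite ler_pdivlMr // in n1; rewrite ltr_pdivrMr // in n2.
exact: le_good r0 (ltW n2) (good_mult n n1).
Qed.

(** Liouville: the flow is entire by [good_all], and [flow_bound] grows like
    (1 + r) ^ k. *)
Lemma tc_eq0 k i n : (forall i j, (size (nth 0%R (Pi i) j) <= k.+1)%N) -> (k < n)%N ->
  tc n 'X_i = 0.
Proof.
move=> hk kn; apply/eqP; rewrite -nm_eq0 eq_le nm_ge0 andbT.
pose c := flow_bound 1.
have c1 : 1 <= c by apply: flow_bound_ge1; apply: ler01.
have bndk r : 0 <= r -> flow_bound r <= c * (1 + r) ^+ k.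
  move=> r0; have r1 : 1 <= (1 + r) ^+ k by rewrite exprn_ege1 // lerDl.
  rewrite /c /flow_bound mulr_suml; apply: ler_sum => j _.
  rewrite [leRHS]mulrDl mul1r; apply: lerD => //.
  rewrite [leRHS]mulrAC ler_wpM2r ?invr_ge0 ?nm_ge0 // [leRHS]mulrDl mul1r; apply: lerD => //.
  rewrite /beta mulr_suml; apply: ler_sum => l _; apply: wn_growth => //.
  exact: leq_trans (size_ev2_shift _ _ _) (hk _ _).
have key (r : algR) : 1 <= r -> nm (tc n 'X_i) * r <= c * 2%:R ^+ k.
  move=> r1; have r0 : 0 <= r by apply: le_trans r1.
  have := good_coef i n (good_all (_ : 0 <= r + 1)) r0 (_ : r < r + 1).
  rewrite addr_ge0 ?ler01 // ltrDl ltr01 => /(_ isT isT) h.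
  have rk : 0 < r ^+ k by rewrite exprn_gt0 // (lt_le_trans ltr01).
  rewrite -(ler_pM2r rk) -mulrA -exprS.
  apply: le_trans (_ : nm (tc n 'X_i) * r ^+ n <= _).
    by rewrite ler_wpM2l ?nm_ge0 // ler_weXn2l.
  apply: le_trans h _; apply: le_trans (bndk _ r0) _.
  rewrite -mulrA ler_wpM2l ?(le_trans ler01 c1) // -exprMn lerXn2r ?nnegrE; lra.
rewrite leNgt; apply/negP => pos.
pose M := c * 2%:R ^+ k.
have M0 : 0 <= M by rewrite mulr_ge0 ?exprn_ge0 ?ler0n // (le_trans ler01).
have := key (1 + (M + 1) / nm (tc n 'X_i)); rewrite lerDl divr_ge0 ?nm_ge0 ?addr_ge0 ?ler01 //.
move=> /(_ isT); rewrite mulrDr mulr1 [_ * ((M + 1) / _)]mulrC divfK ?gt_eqF // -/M.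
lra.
Qed.

End Growth.

(** * Integral coordinates make the derivation nilpotent *)
Section MapCoefficients.
Variables (R S T : comNzRingType) (s : {rmorphism R -> S}) (f : {rmorphism S -> T}).

Lemma ev1_map p a : ev1 (f \o s) p a = ev1 f p (map_poly s a).
Proof.
elim/poly_ind: a => [|a c IH]; first by rewrite !rmorph0.
by rewrite !rmorphD !rmorphM /= map_polyX map_polyC !ev1X !ev1C IH.
Qed.

Lemma ev2_map p q a : ev2 (f \o s) p q a = ev2 f p q (map_poly (map_poly s) a).
Proof.
elim/poly_ind: a => [|a c IH]; first by rewrite !rmorph0.
by rewrite !rmorphD !rmorphM /= map_polyX map_polyC !ev2X !ev2C IH ev1_map.
Qed.

Lemma ev3_map p q z a :
  ev3 (f \o s) p q z a = ev3 f p q z (map_poly (map_poly (map_poly s)) a).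
Proof.
elim/poly_ind: a => [|a c IH]; first by rewrite !rmorph0.
by rewrite !rmorphD !rmorphM /= map_polyX map_polyC !ev3X !ev3C IH ev2_map.
Qed.

Lemma mderiv_map (p : {mpoly R[2]}) i : (map_mpoly s p)^`M(i) = map_mpoly s p^`M(i).
Proof.
by apply/mpolyP => m; rewrite mcoeff_mderiv !mcoeff_map_mpoly mcoeff_mderiv /= raddfMn.
Qed.

Lemma jacobian_map (p q : {mpoly R[2]}) :
  jacobian_det (map_mpoly s p) (map_mpoly s q) = map_mpoly s (jacobian_det p q).
Proof. by rewrite /jacobian_det !mderiv_map rmorphB !rmorphM. Qed.

End MapCoefficients.

Lemma poly_nat_zeros (F : idomainType) (p : {poly F}) : [pchar F] =i pred0 ->
  (forall n : nat, p.[n%:R] = 0) -> p = 0.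
Proof.
move=> char0 h; apply/eqP; apply: contraT => p0.
have := @max_poly_roots _ p [seq n%:R | n <- iota 0 (size p)] p0.
rewrite size_map size_iota ltnn; apply.
  by apply/allP => _ /mapP [n _ ->]; rewrite /root h.
rewrite map_inj_uniq ?iota_uniq // => m n /eqP.
wlog mn : m n / (m <= n)%N.
  by move=> W; case: (leqP m n) => [|/ltnW] /W // WW; rewrite eq_sym => /WW.
rewrite -subr_eq0 -opprB oppr_eq0 -natrB // ((pcharf0P F).1 char0) subn_eq0 => nm.
by apply/eqP; rewrite eqn_leq mn.
Qed.

Lemma mpoly2_zeros (F : fieldType) (f : {mpoly F[2]}) : [pchar F] =i pred0 ->
  (forall v, f.@[v] = 0) -> f = 0.
Proof.
move=> char0; have [a ->] := mpoly2_ev f => h.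
have hE (x y : F) : (map_poly (horner_eval x) a).[y] = 0.
  rewrite -[RHS](h (tnth [tuple x; y])).
  rewrite (rmorph_ev2 _ (meval _)) /= !mevalXU /ev2 /= /horner_morph.
  congr _.[_]; apply: eq_map_poly => c /=.
  rewrite /horner_eval /horner_morph map_poly_id // => k _.
  exact: mevalC.
suff -> : a = 0 by rewrite rmorph0.
apply/polyP => i; rewrite coef0; apply: (poly_nat_zeros char0) => n.
have -> : (a`_i).[n%:R] = (map_poly (horner_eval n%:R) a)`_i by rewrite coef_map.
by rewrite (poly_nat_zeros char0 (fun m => hE n%:R m%:R)) coef0.
Qed.

Section IntegralNilpotent.
Variables (F : fieldType) (s : {rmorphism F -> algC}).
Hypothesis char0 : [pchar F] =i pred0.
Variables (P Q : {mpoly F[2]}).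
Hypothesis jac1 : jacobian_det P Q = 1.

(** The leading coefficient is a nonzero polynomial in u alone: z is integral
    over F(P)[Q]. *)
Definition integral_along_v (z : {mpoly F[2]}) :=
  exists Pi : {poly {poly {poly F}}}, [/\ Pi != 0, size (lead_coef Pi) = 1%N
               & ev3 (@mpolyC 2 F) P Q z Pi = 0].

(** The degree k of [tc_eq0] does not depend on the starting point v of the flow,
    provided that the leading coefficients do not vanish at P (v).  The iterate
    of rank k + 1 thus vanishes outside a curve, hence everywhere. *)
Lemma integral_nilpotent : (forall i, integral_along_v 'X_i) ->
  exists n, forall i, iter n (jacobian_det P) 'X_i = 0.
Proof.
move=> h.
have [Pi hPi] : exists Pi : 'I_2 -> {poly {poly {poly F}}}, forall i,
    [/\ Pi i != 0, size (lead_coef (Pi i)) = 1%N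
      & ev3 (@mpolyC 2 F) P Q 'X_i (Pi i) = 0].
  have [p0 h0] := h 0; have [p1 h1] := h 1.
  by exists (fun i => if i == 0 then p0 else p1) => i; case: (ord2P i) => ->.
pose al i := (lead_coef (Pi i))`_0.
have leadE i : lead_coef (Pi i) = (al i)%:P.
  by have [_ hs _] := hPi i; apply: size1_polyC; rewrite hs.
have al0 i : al i != 0.
  by have [hn _ _] := hPi i; rewrite -polyC_eq0 -leadE lead_coef_eq0.
have sz i : (1 < size (Pi i))%N.
  have [hn _ hz] := hPi i; rewrite ltnNge; apply/negP => /size1_polyC hc.
  have e : Pi i = (al i)%:P%:P by rewrite -leadE {2}hc lead_coefC.
  by move: hz; rewrite e ev3C ev2C => /(ev1_inj char0 jac1) /eqP; rewrite (negPf (al0 i)).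
pose k := \max_i \max_(j < size (Pi i)) size (nth 0%R (Pi i) j).
exists k.+1 => i.
pose PiC i := map_poly (map_poly (map_poly s)) (Pi i).
pose P' := map_mpoly s P; pose Q' := map_mpoly s Q.
have X' j : map_mpoly s 'X_j = 'X_j by rewrite map_mpolyX.
have jac1' : jacobian_det P' Q' = 1 by rewrite jacobian_map jac1 rmorph1.
have al0' j : map_poly s (al j) != 0 by rewrite map_poly_eq0.
have char0C : [pchar algC] =i pred0 := Cpchar.
have rel j : ev3 (@mpolyC 2 algC) P' Q' 'X_j (PiC j) = 0.
  have [_ _ /(congr1 (map_mpoly s))] := hPi j; rewrite rmorph0 => hz.
  rewrite -hz (rmorph_ev3 _ (map_mpoly s)) /PiC -ev3_map /= X'.
  by apply: eq_ev3 => c /=; rewrite map_mpolyC.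
pose g : {mpoly algC[2]} := map_mpoly s (iter k.+1 (jacobian_det P) 'X_i).
pose l j := ev1 (@mpolyC 2 algC) P' (map_poly s (al j)).
have l0 j : l j != 0.
  by apply/eqP => /(ev1_inj char0C jac1') /eqP; rewrite (negPf (al0' j)).
have : g * l 0 * l 1 = 0.
  apply: (mpoly2_zeros char0C) => v.
  have lv j : (l j).@[v] = (map_poly s (al j)).[P'.@[v]].
    rewrite /l (rmorph_ev1 _ (meval v)) /= /horner_morph; congr _.[_].
    by rewrite map_poly_id // => c _; apply: mevalC.
  have [lz|] := eqVneq ((l 0).@[v]) 0; first by rewrite !mevalM lz mulr0 mul0r.
  have [lz|] := eqVneq ((l 1).@[v]) 0; first by rewrite !mevalM lz mulr0.
  rewrite !lv => n1 n0.
  have gE : g = iter k.+1 (jacobian_det P') 'X_i.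
    rewrite /g; elim: k.+1 => [|n IH]; first exact: X'.
    by rewrite !iterS -IH jacobian_map.
  suff : tc P' v k.+1 'X_i = 0.
    rewrite /tc -gE !mevalM => /eqP; rewrite mulf_eq0 invr_eq0 pnatr_eq0.
    by rewrite [_ == 0%N]eqn0Ngt fact_gt0 orbF => /eqP ->; rewrite !mul0r.
  apply: (@tc_eq0 P' Q' v jac1' PiC (fun j => map_poly s (al j))
    (fun j => (size (Pi j)).-2) _ _ rel _ (msize P') _ k).
  - move=> j; rewrite size_map_inj_poly ?rmorph0 //; last first.
      by apply: map_inj_poly (rmorph0 _); apply: map_inj_poly (rmorph0 _); apply: fmorph_inj.
    by case: (size (Pi j)) (sz j) => [|[|m]].
  - move=> j; rewrite coef_map /=.
    have -> : (Pi j)`_(size (Pi j)).-2.+1 = (al j)%:P.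
      by rewrite -leadE lead_coefE; case: (size (Pi j)) (sz j) => [|[|m]].
    by rewrite map_polyC.
  - by move=> j; case: (ord2P j) => ->.
  - exact: deg_le_msize.
  - move=> a j; rewrite coef_map /=.
    apply: leq_trans (leqnSn k); apply: leq_trans (_ : (size (nth 0%R (Pi a) j) <= k)%N); last first.
      have [js|sj] := ltnP j (size (Pi a)); last by rewrite nth_default ?size_poly0.
      apply: leq_trans (leq_bigmax a).
      exact: (leq_bigmax (Ordinal js)).
    by apply: leq_trans (size_poly _ _) _.
  - exact: ltnSn.
move=> /eqP; rewrite !mulf_eq0 (negPf (l0 0)) (negPf (l0 1)) !orbF => /eqP gz.
apply/mpolyP => m; have := congr1 (mcoeff m) gz.
rewrite mcoeff_map_mpoly !mcoeff0 => e; apply: (fmorph_inj s).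
by rewrite rmorph0.
Qed.

End IntegralNilpotent.

(** * Minimal algebraic relations *)
(** More unknowns than equations: Gaussian elimination without division. *)
Lemma lin_dep_ord (R : idomainType) m n (A : 'I_n -> 'I_m -> R) : (m < n)%N ->
  exists2 c : 'I_n -> R, exists t, c t != 0 & forall u, \sum_t c t * A t u = 0.
Proof.
elim: m n A => [|m IH] [|n] A //.
  by move=> _; exists (fun=> 1); [exists ord0; apply: oner_neq0 | case].
rewrite ltnS => mn.
case: (pickP (fun t => A t ord0 != 0)) => [t0 At0|A0]; last first.
  have [|c nzc hc] := IH n.+1 (fun t u => A t (lift ord0 u)); first exact: ltnW.
  exists c => // u; case: (unliftP ord0 u) => [v ->|->]; first exact: hc.
  by apply: big1 => t _; move/negbFE/eqP: (A0 t) => ->; rewrite mulr0.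
have [//|c [t ct] hc] := IH n (fun t u => A t0 ord0 * A (lift t0 t) (lift ord0 u)
   - A (lift t0 t) ord0 * A t0 (lift ord0 u)).
pose d := - \sum_t c t * A (lift t0 t) ord0.
exists (fun s => if unlift t0 s is Some s' then A t0 ord0 * c s' else d).
  by exists (lift t0 t); rewrite liftK mulf_neq0.
move=> u; rewrite (bigD1_ord t0) //= unlift_none.
under eq_bigr => s _ do rewrite liftK.
case: (unliftP ord0 u) => [v ->|->]; last first.
  rewrite /d mulNr mulr_suml -sumrN -big_split big1 //= => s _.
  by ring.
rewrite /d mulNr mulr_suml -sumrN -big_split /= -[RHS](hc v).
apply: eq_bigr => s _; ring.
Qed.

Lemma lin_dep (R : idomainType) (T U : finType) (A : T -> U -> R) :
  (#|U| < #|T|)%N ->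
  exists2 c : T -> R, exists t, c t != 0 & forall u, \sum_t c t * A t u = 0.
Proof.
move=> UT.
have [c [t ct] hc] := lin_dep_ord (fun i j => A (enum_val i) (enum_val j)) UT.
exists (fun t => c (enum_rank t)); first by exists (enum_val t); rewrite enum_valK.
move=> u; rewrite -[RHS](hc (enum_rank u)).
rewrite (reindex (@enum_val T predT)) /=; last first.
  by apply: onW_bij; apply: enum_val_bij.
by apply: eq_bigr => j _; rewrite enum_rankK enum_valK.
Qed.

Lemma exists_least (p : nat -> Prop) : (exists n, p n) ->
  exists2 n, p n & forall m, p m -> (n <= m)%N.
Proof.
move=> [n pn]; have [k] := ubnP n; elim: k n pn => // k IH n pn; rewrite ltnS => nk.
have [[m [pm mn]]|h] := classic (exists m, p m /\ (m < n)%N).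
  by apply: (IH m) => //; apply: leq_trans nk.
exists n => // m pm; rewrite leqNgt; apply/negP => mn; apply: h; by exists m.
Qed.

Section EvPoly.
Variables (R S : comNzRingType) (f : {rmorphism R -> S}).

Lemma ev1_poly p n a : ev1 f p (\poly_(i < n) a i) = \sum_(i < n) f (a i) * p ^+ i.
Proof.
rewrite poly_def rmorph_sum; apply: eq_bigr => i _.
by rewrite -mul_polyC rmorphM rmorphXn /= ev1C ev1X.
Qed.

Lemma ev2_poly p q n a :
  ev2 f p q (\poly_(i < n) a i) = \sum_(i < n) ev1 f p (a i) * q ^+ i.
Proof.
rewrite poly_def rmorph_sum; apply: eq_bigr => i _.
by rewrite -mul_polyC rmorphM rmorphXn /= ev2C ev2X.
Qed.

Lemma ev3_poly p q z n a :
  ev3 f p q z (\poly_(i < n) a i) = \sum_(i < n) ev2 f p q (a i) * z ^+ i.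
Proof.
rewrite poly_def rmorph_sum; apply: eq_bigr => i _.
by rewrite -mul_polyC rmorphM rmorphXn /= ev3C ev3X.
Qed.

End EvPoly.

Section Relation.
Variable F : fieldType.
Hypothesis char0 : [pchar F] =i pred0.
Variables (P Q z : {mpoly F[2]}).
Hypothesis jac1 : jacobian_det P Q = 1.
Local Notation ev := (ev3 (@mpolyC 2 F) P Q z).

Lemma deg_leX d n (f : {mpoly F[2]}) : deg_le d f -> deg_le (n * d) (f ^+ n).
Proof.
move=> hf; elim: n => [|n IH].
  by rewrite expr0 => m lm; rewrite mcoeff1; case: eqP lm => // ->; rewrite mdeg0.
by rewrite exprS mulSn; apply: deg_leM.
Qed.

Lemma deg_le_le d e (f : {mpoly F[2]}) : (d <= e)%N -> deg_le d f -> deg_le e f.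
Proof. by move=> de hf m lm; apply: hf; apply: leq_ltn_trans lm. Qed.

(** The monomials P^i Q^j z^k with i, j, k < N are N^3 polynomials in a space of
    dimension quadratic in N. *)
Lemma relation_exists : exists2 Pi, Pi != 0 & ev Pi = 0.
Proof.
pose s := maxn (msize P) (maxn (msize Q) (msize z)).
have [dP dQ dz] : [/\ deg_le s P, deg_le s Q & deg_le s z].
  by split; apply: deg_le_le (@deg_le_msize _ _); rewrite !leq_max leqnn ?orbT.
pose N := ((3 * s + 1) ^ 2).+1; pose W := (3 * N * s + 1)%N.
pose f (t : 'I_N * 'I_N * 'I_N) := P ^+ t.1.1 * Q ^+ t.1.2 * z ^+ t.2.
pose m2 (u : 'I_W * 'I_W) : 'X_{1..2} := (U_(0%R) *+ u.1 + U_(1%R) *+ u.2)%MM.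
have [|c [t ct] hc] := @lin_dep F _ _ (fun t u => (f t)@_(m2 u)).
  rewrite !card_prod !card_ord /W /N; nia.
have df t' : deg_le (3 * N * s) (f t').
  have b (i : 'I_N) : (i * s <= N * s)%N by rewrite leq_mul2r ltnW ?orbT.
  have h1 := @deg_leX s t'.1.1 P dP; have h2 := @deg_leX s t'.1.2 Q dQ.
  have h3 := @deg_leX s t'.2 z dz.
  apply: deg_le_le (deg_leM (deg_leM h1 h2) h3).
  have := b t'.1.1; have := b t'.1.2; have := b t'.2; lia.
have cf0 : \sum_t c t *: f t = 0.
  apply/mpolyP => m; rewrite raddf_sum mcoeff0 /=.
  under eq_bigr => t' _ do rewrite mcoeffZ.
  have [mW|Wm] := leqP W (mdeg m).
    by apply: big1 => t' _; rewrite df ?mulr0 //; move: mW; rewrite /W addn1.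
  have mi (i : 'I_2) : (m i < W)%N.
    by apply: leq_ltn_trans Wm; rewrite mdegE (bigD1 i) //= leq_addr.
  rewrite -[RHS](hc (Ordinal (mi 0), Ordinal (mi 1))); apply: eq_bigr => t' _.
  congr (_ * _@__); apply/mnmP => i; rewrite /m2 mnmDE !mulmnE !mnm1E /=.
  by case: (ord2P i) => ->; rewrite ?mul1n ?mul0n ?muln1 ?muln0 ?addn0 ?add0n.
pose C (i j k : nat) := c (inord i, inord j, inord k).
exists (\poly_(k < N) \poly_(j < N) \poly_(i < N) C i j k).
  apply: contra ct => /eqP /(congr1 (fun p : {poly {poly {poly F}}} => ((p`_t.2)`_t.1.2)`_t.1.1)).
  rewrite !coef0 !coef_poly !ltn_ord !coef_poly !ltn_ord coef_poly ltn_ord => <-.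
  by rewrite /C !inord_val; case: t => [[? ?] ?].
have e : \sum_t c t *: f t = \sum_k \sum_j \sum_i c (i, j, k) *: f (i, j, k).
  rewrite (eq_bigr (fun t => c (t.1, t.2) *: f (t.1, t.2))); last by case.
  rewrite -(pair_bigA _ (fun p k => c (p, k) *: f (p, k))) /= exchange_big /=.
  apply: eq_bigr => k _.
  rewrite (eq_bigr (fun p => c (p.1, p.2, k) *: f (p.1, p.2, k))); last by case.
  by rewrite -(pair_bigA _ (fun i j => c (i, j, k) *: f (i, j, k))) /= exchange_big.
rewrite ev3_poly -[RHS]cf0 e; apply: eq_bigr => k _.
rewrite ev2_poly mulr_suml; apply: eq_bigr => j _.
rewrite ev1_poly !mulr_suml; apply: eq_bigr => i _.
by rewrite /C !inord_val -mul_mpolyC /f /= !mulrA.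
Qed.

(** Over the fraction field of R this is the gcd of s as a combination of the
    elements of s; denominators are cleared by c. *)
Lemma bezout_seq (R : idomainType) (s : seq {poly R}) :
  exists (b : seq {poly R}) (c : R), c != 0 /\
  let g := \sum_(i < size s) b`_i * s`_i in
  exists q : nat -> {poly R}, forall i, (i < size s)%N -> c *: s`_i = q i * g.
Proof.
elim: s => [|a s [b [c [c0 /= [q hq]]]]]; first by exists [::], 1; split; [apply: oner_neq0 | exists (fun=> 0)].
set g := \sum_(i < size s) _ in hq.
have [[u1 u2] /= hu] := Pdiv.Idomain.Bezoutp a g.
pose g' := u1 * a + u2 * g.
have [/= da dg] : Pdiv.Idomain.dvdp g' a /\ Pdiv.Idomain.dvdp g' g.
  by rewrite !(Pdiv.Idomain.eqp_dvdl _ hu) Pdiv.Idomain.dvdp_gcdl Pdiv.Idomain.dvdp_gcdr.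
have /Pdiv.Idomain.dvdpP [[c1 q1] /= c10 e1] := da.
have /Pdiv.Idomain.dvdpP [[c2 q2] /= c20 e2] := dg.
exists (u1 :: [seq u2 * x | x <- b]), (c * c1 * c2); split.
  by rewrite !mulf_neq0.
have -> : \sum_(i < size (a :: s)) (u1 :: [seq u2 * x | x <- b])`_i * (a :: s)`_i = g'.
  rewrite big_ord_recl /= /g' /g mulr_sumr; congr (_ + _); apply: eq_bigr => i _ /=.
  suff -> : [seq u2 * x | x <- b]`_i = u2 * b`_i by rewrite mulrA.
  have [ib|bi] := ltnP i (size b); first by rewrite (nth_map 0).
  by rewrite !nth_default ?size_map // mulr0.
exists (fun i => if i is j.+1 then c1 *: (q j * q2) else c * c2 *: q1).
move=> [|i] /= hi.
  by rewrite -scalerAl -e1 scalerA; congr (_ *: _); rewrite mulrAC.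
have e : q i * q2 * g' = c2 *: (q i * g) by rewrite -mulrA -e2 scalerAr.
rewrite -scalerAl e -hq // !scalerA; congr (_ *: _); ring.
Qed.

Lemma ev2_neq0 a : a != 0 -> ev2 (@mpolyC 2 F) P Q a != 0.
Proof. by apply: contra => /eqP /(ev2_inj char0 jac1) ->. Qed.

(** The degree in z is minimised first, then the degree in v of the leading
    coefficient.  The coefficients then have no common factor over F(u), as
    dividing by it would lower the latter degree; this is the Bezout
    identity. *)
Lemma primitive_relation : exists Pi : {poly {poly {poly F}}},
  [/\ Pi != 0, ev Pi = 0, forall G, G != 0 -> ev G = 0 -> (size Pi <= size G)%N
    & exists (b : nat -> {poly {poly F}}) (d : {poly F}), d != 0 /\
        \sum_(i < size Pi) b i * Pi`_i = d%:P].
Proof.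
have [Pi0 Pi0n Pi00] := relation_exists.
have [n [Pi1 [Pi1n Pi10 sPi1]] hn] := @exists_least
  (fun n => exists G, [/\ G != 0, ev G = 0 & size G = n])
  (ex_intro _ _ (ex_intro _ Pi0 (And3 Pi0n Pi00 (erefl _)))).
have [m [Pi [Pin Pi_0 sPi sl]] hm] := @exists_least
  (fun m => exists G, [/\ G != 0, ev G = 0, size G = n & size (lead_coef G) = m])
  (ex_intro _ _ (ex_intro _ Pi1 (And4 Pi1n Pi10 sPi1 (erefl _)))).
exists Pi; split=> //.
  by move=> G Gn G0; rewrite sPi; apply: hn; exists G.
have [b [c [c0 /= [q hq]]]] := bezout_seq Pi.
set g := \sum_(i < size Pi) _ in hq.
have g0 : g != 0.
  apply/eqP => gz.
  have := hq (size Pi).-1; rewrite prednK ?size_poly_gt0 // => /(_ (leqnn _)).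
  rewrite gz mulr0 => /eqP; rewrite -mul_polyC mulf_eq0 polyC_eq0 (negPf c0) /=.
  by rewrite -lead_coefE lead_coef_eq0 (negPf Pin).
have [/size1_polyC gC|g1] := leqP (size g) 1.
  exists (nth 0 b), g`_0; split; last by rewrite -gC.
  by apply: contra g0 => /eqP e; rewrite gC e polyC0.
pose G := \poly_(i < size Pi) q i.
have GE : (c%:P%:P : {poly {poly {poly F}}}) * Pi = G * g%:P.
  apply/polyP => i; rewrite coefCM coefMC coef_poly mul_polyC.
  by case: ltnP => [/hq|?] //; rewrite nth_default // scaler0 mul0r.
have cP0 : c%:P != 0 by rewrite polyC_eq0.
have Gn : G != 0.
  apply/eqP => Gz; move: GE; rewrite Gz mul0r => /eqP.
  by rewrite mulf_eq0 !polyC_eq0 (negPf c0) (negPf Pin).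
have sG : size G = n.
  have := congr1 (fun p : {poly {poly {poly F}}} => size p) GE.
  by rewrite [G * _]mulrC !size_Cmul // sPi => ->.
have G0 : ev G = 0.
  have := congr1 ev GE; rewrite !rmorphM /= Pi_0 mulr0 ev3C => /esym/eqP.
  by rewrite mulf_eq0 (negPf (ev2_neq0 g0)) orbF => /eqP.
have := hm _ (ex_intro _ G (And4 Gn G0 sG (erefl _))).
have := congr1 (fun p : {poly {poly {poly F}}} => size (lead_coef p)) GE.
rewrite !lead_coefM !lead_coefC size_Cmul // size_mul ?lead_coef_eq0 // sl => ->.
by case: (size g) g1 => [|[|k]] // _; rewrite !addnS /= ltnNge leq_addr.
Qed.

End Relation.

(** * Algebra of Runge's method *)
Lemma poly_divisible_coefs (R : comNzRingType) (r : R) (q : {poly {poly R}}) :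
  map_poly (horner_eval r) q = 0 -> exists q', q = ('X - r%:P)%:P * q'.
Proof.
elim/poly_ind: q => [|q c IH]; first by exists 0; rewrite mulr0.
rewrite rmorphD rmorphM /= map_polyX map_polyC /= => h.
have c0 : c.[r] = 0.
  by have := congr1 (fun p : {poly R} => p`_0) h; rewrite coefD coefMX coefC coef0 /= add0r.
have [q1 hq1] : exists q', q = ('X - r%:P)%:P * q'.
  apply: IH; apply/polyP => i; have := congr1 (fun p : {poly R} => p`_i.+1) h.
  by rewrite coefD coefMX coefC !coef0 /= addr0.
have /factor_theorem [c1 hc1] : root c r by apply/eqP.
by exists (q1 * 'X + c1%:P); rewrite hq1 hc1 polyCM; ring.
Qed.

(** Gauss's lemma at the prime 'X - r: this prime divides no multiple p * q to a
    higher power than it divides q, as it does not divide p; so s may be freed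
    from it, and then the leading coefficient of p divides that of g up to a
    unit at r. *)
Lemma gauss_root (R : idomainType) (r : R) (s : {poly R}) (p g q : {poly {poly R}}) :
  s != 0 -> s%:P * g = p * q -> (lead_coef p).[r] = 0 ->
  map_poly (horner_eval r) p != 0 -> (lead_coef g).[r] = 0.
Proof.
move=> s0 e lp hp; have [n] := ubnP (size s).
elim: n s s0 q e => // n IH s s0 q e; rewrite ltnS => sn.
have [/factor_theorem [s' hs]|nr] := boolP (root s r); last first.
  have := congr1 (fun t : {poly {poly R}} => (lead_coef t).[r]) e.
  rewrite !lead_coefM lead_coefC !hornerM lp mul0r => /eqP.
  by rewrite mulf_eq0 -[_ == 0]/(root s r) (negPf nr) /= => /eqP.
have : map_poly (horner_eval r) p * map_poly (horner_eval r) q = 0.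
  rewrite -rmorphM /= -e rmorphM /= map_polyC /= hs /horner_eval hornerM.
  by rewrite hornerXsubC subrr mulr0 mul0r.
move/eqP; rewrite mulf_eq0 (negPf hp) /= => /eqP /poly_divisible_coefs [q' hq].
have X0 : ('X - r%:P)%:P != 0 :> {poly {poly R}} by rewrite polyC_eq0 polyXsubC_eq0.
have s'0 : s' != 0 by apply: contra s0 => /eqP z; rewrite hs z mul0r.
apply: (IH s' s'0 q').
  apply: (mulfI X0); rewrite mulrA -polyCM [_ * s']mulrC -hs e hq.
  by rewrite mulrCA.
by apply: leq_trans sn; rewrite hs size_Mmonic ?monicXsubC // size_XsubC addn2.
Qed.

Lemma nat_nonroot (F : idomainType) (p : {poly F}) : [pchar F] =i pred0 -> p != 0 ->
  exists N, forall n, (N <= n)%N -> p.[n%:R] != 0.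
Proof.
move=> char0; have [k] := ubnP (size p); elim: k p => // k IH p; rewrite ltnS => sp p0.
have [[n rn]|h] := classic (exists n : nat, root p n%:R); last first.
  by exists 0%N => n _; apply/negP => r; apply: h; exists n.
have /factor_theorem [q hq] := rn.
have q0 : q != 0 by apply: contra p0 => /eqP z; rewrite hq z mul0r.
have [|N hN] := IH q _ q0.
  by apply: leq_trans sp; rewrite hq size_Mmonic ?monicXsubC // size_XsubC addn2.
exists (maxn N n.+1) => m; rewrite geq_max => /andP[Nm nm].
rewrite hq hornerM mulf_neq0 ?hN // hornerXsubC -natrB; last exact: ltnW.
by rewrite ((pcharf0P F).1 char0) subn_eq0 -ltnNge.
Qed.

Lemma poly_crt (F : fieldType) m (p : 'I_m -> {poly F}) (q : {poly F}) (a : 'I_m -> {poly F}) :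
  (forall i j, i != j -> coprimep (p i) (p j)) -> (forall i, coprimep (p i) q) ->
  exists h, forall i, exists k, q * h = a i + p i * k.
Proof.
move=> cop copq.
have he i : exists e, exists k, q * (\prod_(j | j != i) p j) * e = 1 + p i * k.
  have /Bezout_eq1_coprimepP [[u v] /= uv] :
      coprimep (p i) (q * \prod_(j | j != i) p j).
    rewrite coprimepMr copq /=; elim/big_rec: _ => [|j x ji cx].
      exact: coprimep1.
    by rewrite coprimepMr cx andbT; apply: cop; rewrite eq_sym.
  exists v, (- u); move: uv; set M := q * _ => <-; ring.
have [e he'] := @fin_all_exists 'I_m (fun=> {poly F})
  (fun i e => exists k, q * (\prod_(j | j != i) p j) * e = 1 + p i * k) he.
exists (\sum_i a i * (\prod_(j | j != i) p j) * e i) => i.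
have [k hk] := he' i.
have [r hr] : exists r, \sum_(i' | i' != i) a i' * (\prod_(j | j != i') p j) * e i' = p i * r.
  elim/big_rec: _ => [|j x ji [r ->]]; first by exists 0; rewrite mulr0.
  rewrite (bigD1 i) /=; last by rewrite eq_sym.
  by eexists (_ + r); rewrite mulrDr; congr (_ + _); rewrite mulrCA -mulrA; congr (_ * _).
exists (a i * k + q * r).
rewrite (bigD1 i) //= mulrDr hr.
have -> : q * (a i * (\prod_(j | j != i) p j) * e i) = a i * (1 + p i * k).
  by rewrite -hk; ring.
ring.
Qed.

(** The function z satisfies an equation with leading coefficient D = p E and
    other coefficients al_i, so z has poles at the zeros of p, while e = D z
    satisfies a monic equation.  The auxiliary function g is a polynomial in z
    for which p^N g, written in the basis 1, e, ..., e^(n-1), has coefficients of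
    degree at most N deg p - k - 1: g is small at infinity.  For every m, the
    reduction of e^m gives e^m = sum (p^m s_i + r_i) e^i with r_i of degree
    less than m deg p, hence the polynomial (E z)^m - sum s_i (D z)^i in z, equal to
    p^-m sum r_i e^i.  A combination of n k + 1 of these cancels the n k highest
    coefficients. *)
Section AuxiliaryFunction.
Variable A : idomainType.
Local Notation B := {poly A}.
Variables (n : nat) (al : nat -> B) (D E p : B).
Hypothesis n0 : (0 < n)%N.
Hypothesis p_monic : p \is monic.
Hypothesis p_size : (1 < size p)%N.
Hypothesis DE : D = p * E.
Hypothesis E0 : E != 0.

(** Coefficients of the monic equation of e = D z. *)
Definition shifted_coef i := al i * D ^+ (n.-1 - i).
Let Phi : {poly B} := \poly_(i < n) shifted_coef i + 'X^n.

Lemma Phi_monic : Phi \is monic.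
Proof.
by rewrite monicE lead_coefDr ?lead_coefXn // size_polyXn ltnS size_poly.
Qed.

Lemma size_Phi : size Phi = n.+1.
Proof. by rewrite /Phi addrC size_polyDl size_polyXn // ltnS size_poly. Qed.

Let rem m : {poly B} := Pdiv.CommonRing.rmodp 'X^m Phi.

Lemma size_rem m : (size (rem m) <= n)%N.
Proof.
by rewrite -ltnS -size_Phi Pdiv.Ring.ltn_rmodp monic_neq0 ?Phi_monic.
Qed.

Section Point.
Variables (S : comNzRingType) (w : {rmorphism B -> S}) (z : S).
Hypothesis eqz : w D * z ^+ n + \sum_(i < n) w (al i) * z ^+ i = 0.
Let e := w D * z.

Lemma shifted_equation : e ^+ n + \sum_(i < n) w (shifted_coef i) * e ^+ i = 0.
Proof.
transitivity (w D ^+ n.-1 * (w D * z ^+ n + \sum_(i < n) w (al i) * z ^+ i));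
  last by rewrite eqz mulr0.
rewrite mulrDr mulrA -exprSr prednK // /e exprMn mulr_sumr; congr (_ + _).
apply: eq_bigr => i _; rewrite /shifted_coef rmorphM rmorphXn /= exprMn.
have -> : w D ^+ n.-1 = w D ^+ (n.-1 - i) * w D ^+ i.
  by rewrite -exprD subnK // -ltnS prednK.
by ring.
Qed.

Lemma power_reduction m : e ^+ m = \sum_(i < n) w (rem m)`_i * e ^+ i.
Proof.
have PhiZ : (map_poly w Phi).[e] = 0.
  rewrite rmorphD /= map_polyXn hornerD hornerXn addrC -[RHS]shifted_equation.
  congr (_ + _); rewrite (horner_coef_wide _ (_ : size _ <= n)%N); last first.
    by apply: leq_trans (size_poly _ _) (size_poly _ _).
  by apply: eq_bigr => i _; rewrite coef_map coef_poly ltn_ord.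
have := congr1 (fun t => (map_poly w t).[e]) (Pdiv.RingMonic.rdivp_eq Phi_monic 'X^m).
rewrite map_polyXn hornerXn rmorphD rmorphM /= hornerD hornerM PhiZ mulr0 add0r => ->.
rewrite (horner_coef_wide _ (_ : size _ <= n)%N); last first.
  by apply: leq_trans (size_poly _ _) (size_rem m).
by apply: eq_bigr => i _; rewrite coef_map.
Qed.

End Point.

Variable k : nat.
Let N := (n + n * k)%N.
Let sq m i : B := Pdiv.CommonRing.rdivp (rem m)`_i (p ^+ m).
Let sr m i : B := Pdiv.CommonRing.rmodp (rem m)`_i (p ^+ m).

Lemma quotient_remainder m i : (rem m)`_i = sq m i * p ^+ m + sr m i.
Proof. by apply: Pdiv.RingMonic.rdivp_eq; apply: monic_exp. Qed.

Lemma size_monic_power m : size (p ^+ m) = (m * (size p).-1).+1.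
Proof.
rewrite -[LHS]prednK ?size_exp ?[(_ * m)%N]mulnC //.
by rewrite size_poly_gt0 expf_neq0 // monic_neq0.
Qed.

Lemma size_sr m i : (size (sr m i) <= m * (size p).-1)%N.
Proof.
by rewrite -ltnS -size_monic_power Pdiv.Ring.ltn_rmodp monic_neq0 // monic_exp.
Qed.

Lemma auxiliary_function : exists (g : {poly B}) (eta : nat -> B) (ga : A) (m : nat),
  [/\ ga != 0, lead_coef g = ga%:P * E ^+ m,
      forall i, (i < n)%N -> (size (eta i) <= N * (size p).-1 - k)%N
    & forall (S : comNzRingType) (w : {rmorphism B -> S}) z,
      w D * z ^+ n + \sum_(i < n) w (al i) * z ^+ i = 0 ->
      w p ^+ N * (map_poly w g).[z] = \sum_(i < n) w (eta i) * (w D * z) ^+ i].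
Proof.
pose de := (size p).-1.
have de0 : (0 < de)%N by rewrite /de -subn1 subn_gt0.
pose tm (t : 'I_(n * k).+1) := (n + t)%N.
have [|c [t0 ct0] hc] := @lin_dep A 'I_(n * k).+1 ('I_n * 'I_k)%type
    (fun t u => (sr (tm t) u.1 * p ^+ (N - tm t))`_(N * de - k + u.2)).
  by rewrite card_prod !card_ord.
pose eta i := \sum_t (c t)%:P * (sr (tm t) i * p ^+ (N - tm t)).
pose g : {poly B} := \sum_t (c t)%:P%:P * ((E%:P * 'X) ^+ tm t
    - \poly_(i < n) (sq (tm t) i * D ^+ i)).
(* The terms have distinct degrees tm t in z, so the last nonzero one leads. *)
pose t1 := [arg max_(t > t0 | c t != 0) nat_of_ord t].
have [ct1 maxt1] : c t1 != 0 /\ forall t, c t != 0 -> (t <= t1)%N.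
  by rewrite /t1; case: arg_maxnP => // t' ct' h; split => // t ct; apply: h.
have coefX t i : ((E%:P * 'X) ^+ tm t - \poly_(i < n) (sq (tm t) i * D ^+ i))`_i
   = (i == tm t)%:R * E ^+ tm t - (if (i < n)%N then sq (tm t) i * D ^+ i else 0).
  rewrite coefB coef_poly exprMn -polyC_exp coefCM coefXn mulrC.
  by [].
have gtop : g`_(tm t1) = (c t1)%:P * E ^+ tm t1.
  rewrite /g coef_sum (bigD1 t1) //= [X in _ + X]big1 ?addr0 => [|t tt1].
    by rewrite coefCM coefX eqxx ltnNge leq_addr /= mul1r subr0.
  rewrite coefCM coefX ltnNge leq_addr /= subr0 eqn_add2l val_eqE eq_sym (negPf tt1).
  by rewrite mul0r mulr0.
have gbig i : (tm t1 < i)%N -> g`_i = 0.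
  move=> hi; rewrite /g coef_sum big1 // => t _; rewrite coefCM coefX.
  have ni : (n <= i)%N by apply: leq_trans (ltnW hi); apply: leq_addr.
  rewrite ltnNge ni /= subr0.
  have [->|ct] := eqVneq (c t) 0; first by rewrite polyC0 mul0r.
  case: eqP => [e|_]; last by rewrite mul0r mulr0.
  by move: hi; rewrite e ltn_add2l ltnNge maxt1.
have gt0 : g`_(tm t1) != 0.
  by rewrite gtop mulf_neq0 ?polyC_eq0 // expf_neq0.
have sg : size g = (tm t1).+1.
  apply/anti_leq/andP; split; last first.
    by rewrite ltnNge; apply: contra gt0 => h; rewrite nth_default.
  by apply/leq_sizeP => i; apply: gbig.
exists g, eta, (c t1), (tm t1); split => //.
- by rewrite lead_coefE sg.
- move=> i ni; apply/leq_sizeP => l hl.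
  have tmN (t : 'I_(n * k).+1) : (tm t <= N)%N by rewrite leq_add2l -ltnS.
  have [lN|Nl] := ltnP l (N * de).
    have lk : (l - (N * de - k) < k)%N.
      by move: lN hl; rewrite -/de; move: (N * de)%N => X; lia.
    have := hc (Ordinal ni, Ordinal lk); rewrite /= subnKC // => h0.
    by rewrite -[RHS]h0 /eta coef_sum; apply: eq_bigr => t _; rewrite coefCM.
  rewrite /eta coef_sum big1 // => t _; rewrite coefCM.
  rewrite [X in _ * X]nth_default ?mulr0 //; apply: leq_trans Nl.
  apply: leq_trans (size_polyMleq _ _) _; rewrite size_monic_power addnS /=.
  have h := size_sr (tm t) i; rewrite -/de in h *.
  apply: leq_trans (leq_add h (leqnn _)) _.
  by rewrite -mulnDl subnKC.
move=> S w z eqz.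
have redu := power_reduction eqz; set e := w D * z in redu *.
have tmN (t : 'I_(n * k).+1) : (tm t <= N)%N by rewrite leq_add2l -ltnS.
rewrite /g rmorph_sum horner_sum mulr_sumr.
under [RHS]eq_bigr => i _ do rewrite rmorph_sum mulr_suml.
rewrite exchange_big /=; apply: eq_bigr => t _.
rewrite rmorphM /= map_polyC hornerCM mulrCA.
under [RHS]eq_bigr => i _ do rewrite rmorphM /= -mulrA.
rewrite -mulr_sumr; congr (_ * _).
rewrite rmorphB rmorphXn rmorphM /= map_polyC map_polyX hornerD hornerN horner_exp hornerCM hornerX.
rewrite mulrBr -(subnK (tmN t)) exprD -mulrA -exprMn.
have -> : w p * (w E * z) = e by rewrite mulrA -rmorphM /= -DE.
rewrite redu (horner_coef_wide _ (_ : size _ <= n)%N); last first.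
  by apply: leq_trans (size_poly _ _) (size_poly _ _).
rewrite -mulrA -mulrBr subnK // [_ ^+ tm t * _]mulr_sumr -sumrB mulr_sumr.
apply: eq_bigr => i _; rewrite coef_map coef_poly ltn_ord /= quotient_remainder rmorphD !rmorphM !rmorphXn /=.
by rewrite /e exprMn; ring.
Qed.

End AuxiliaryFunction.

(** * The auxiliary functions along a family of curves *)
Lemma ev2_idfun (R : comNzRingType) (x y : R) a :
  ev2 idfun x y a = (map_poly (horner_eval x) a).[y].
Proof.
rewrite /ev2 /= /horner_morph; congr _.[_]; apply: eq_map_poly => c /=.
by rewrite /horner_morph /horner_eval map_poly_id.
Qed.

Lemma ev1_idfun (R : comNzRingType) (x : R) a : ev1 idfun x a = a.[x].
Proof. by rewrite /ev1 /= /horner_morph map_poly_id. Qed.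

Lemma bipoly_zeros (F : fieldType) (a : {poly {poly F}}) : [pchar F] =i pred0 ->
  (forall x y, ev2 idfun x y a = 0) -> a = 0.
Proof.
move=> char0 h; apply/polyP => i; rewrite coef0; apply: (poly_nat_zeros char0) => n.
have -> : (a`_i).[n%:R] = (map_poly (horner_eval n%:R) a)`_i by rewrite coef_map.
rewrite (poly_nat_zeros char0 (p := map_poly (horner_eval n%:R) a)) ?coef0 // => k.
by rewrite -ev2_idfun.
Qed.

Section Congruence.
Variables (R S : comNzRingType) (f : {rmorphism R -> S}) (M : S).
Definition cong a b := exists k, a = b + M * k.

Lemma cong_ev1 p p' a : cong p p' -> cong (ev1 f p a) (ev1 f p' a).
Proof.
move=> [k hk]; elim/poly_ind: a => [|a c [l hl]].
  by exists 0; rewrite !rmorph0 mulr0 addr0.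
rewrite !rmorphD !rmorphM /= !ev1X !ev1C hl hk.
by exists (ev1 f p' a * k + l * p' + M * l * k); ring.
Qed.

Lemma cong_ev2 p p' q q' a : cong p p' -> cong q q' -> cong (ev2 f p q a) (ev2 f p' q' a).
Proof.
move=> hp [k hk]; elim/poly_ind: a => [|a c [l hl]].
  by exists 0; rewrite !rmorph0 mulr0 addr0.
have [r hr] := cong_ev1 c hp.
rewrite !rmorphD !rmorphM /= !ev2X !ev2C hl hr hk.
by exists (ev2 f p' q' a * k + l * q' + M * l * k + r); ring.
Qed.

End Congruence.

Lemma map_poly_step (R S : comNzRingType) (g : {rmorphism R -> S}) a b G :
  map_poly g (a%:P * G * 'X + b%:P) = (g a)%:P * map_poly g G * 'X + (g b)%:P.
Proof. by rewrite rmorphD !rmorphM /= map_polyX !map_polyC. Qed.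

Lemma map_polyCM (R S : comNzRingType) (g : {rmorphism R -> S}) a G :
  map_poly g (a%:P * G) = (g a)%:P * map_poly g G.
Proof. by rewrite rmorphM /= map_polyC. Qed.

Lemma map_polyCMM (R S : comNzRingType) (g : {rmorphism R -> S}) a G T :
  map_poly g (a%:P * G * T) = (g a)%:P * map_poly g G * map_poly g T.
Proof. by rewrite rmorphM /= map_polyCM. Qed.

Lemma trivial_combination (R : comNzRingType) (a b : R) : b = 0 * a + 1 * b.
Proof. by rewrite mul0r mul1r add0r. Qed.

Lemma product_size a b n : (a + b).-1 = n -> (1 < b)%N ->
  (n <= a)%N || (n <= b)%N -> (a <= 1)%N.
Proof. by move=> <- b1 /orP[] h; lia. Qed.

Section Substitution.
Variable F : fieldType.
Hypothesis char0 : [pchar F] =i pred0.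
Local Notation B := {poly {poly F}}.
Variables (h w : {poly F}) (th : F).
Hypothesis w0 : w != 0.

(** From here on {poly {poly F}} is also read as F[c][v]: c is the parameter of
    a family of curves, whose members all have the required contact with the
    lines u = kappa_j. *)
Definition const2 : {rmorphism F -> B} := (@polyC {poly F} \o @polyC F)%FUN.
Definition emb : {rmorphism {poly F} -> B} := ev1 const2 'X.

(** The family u = h (v) + c w (v), in the coordinates P and Q + th P.  The shear
    by th separates the points with different kappa_j.  The parameter c makes
    the substitution [psi] injective. *)
Definition curve_u : B := emb h + emb w * 'X%:P.
Definition psi : {rmorphism B -> B} := ev2 const2 curve_u ('X - const2 th * curve_u).

Lemma embX : emb 'X = 'X. Proof. exact: ev1X. Qed.
Lemma embC c : emb c%:P = const2 c. Proof. exact: ev1C. Qed.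

Lemma embE p : emb p = map_poly polyC p.
Proof.
elim/poly_ind: p => [|p c IH]; first by rewrite !rmorph0.
by rewrite !rmorphD !rmorphM /= embX embC map_polyX map_polyC IH.
Qed.

Lemma psi_cc c : psi (const2 c) = const2 c.
Proof. by rewrite /psi /const2 /= ev2C ev1C. Qed.

(** A preimage of the variable v under [psi]. *)
Definition line : B := 'X + const2 th * 'X%:P.
Lemma psi_line : psi line = 'X.
Proof.
rewrite /line rmorphD rmorphM psi_cc /psi ev2X ev2C ev1X; ring.
Qed.

Definition back (p : {poly F}) : B := ev1 const2 line p.
Lemma psi_back p : psi (back p) = emb p.
Proof.
rewrite /back (rmorph_ev1 _ psi) psi_line /emb; apply: eq_ev1 => c /=.
exact: psi_cc.
Qed.

Lemma psi_u : psi 'X%:P = curve_u.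
Proof. by rewrite /psi ev2C ev1X. Qed.

(** After inverting w, [psi] is onto, as c = (u - h) / w. *)
Lemma psi_lift a : exists e b, psi b = emb w ^+ e * a.
Proof.
have liftD a1 a2 : (exists e b, psi b = emb w ^+ e * a1) ->
    (exists e b, psi b = emb w ^+ e * a2) -> exists e b, psi b = emb w ^+ e * (a1 + a2).
  move=> [e1 [b1 h1]] [e2 [b2 h2]].
  exists (e1 + e2)%N, (back w ^+ e2 * b1 + back w ^+ e1 * b2).
  by rewrite rmorphD !rmorphM !rmorphXn /= !psi_back h1 h2 exprD; ring.
have liftM a1 a2 : (exists e b, psi b = emb w ^+ e * a1) ->
    (exists e b, psi b = emb w ^+ e * a2) -> exists e b, psi b = emb w ^+ e * (a1 * a2).
  move=> [e1 [b1 h1]] [e2 [b2 h2]]; exists (e1 + e2)%N, (b1 * b2).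
  by rewrite rmorphM h1 h2 exprD; ring.
elim/poly_ind: a => [|a c IH]; first by exists 0%N, 0; rewrite rmorph0 mulr0.
apply: (liftD); first apply: liftM => //.
  by exists 0%N, line; rewrite psi_line mul1r.
elim/poly_ind: c => [|c k IHc]; first by exists 0%N, 0; rewrite rmorph0 mulr0.
rewrite polyCD polyCM; apply: liftD; first apply: liftM => //.
  exists 1%N, ('X%:P - back h); rewrite rmorphB psi_u psi_back /curve_u; ring.
by exists 0%N, (const2 k); rewrite psi_cc mul1r.
Qed.

Lemma psi_point c t a :
  ev2 idfun c t (psi a)
  = ev2 idfun (h.[t] + c * w.[t]) (t - th * (h.[t] + c * w.[t])) a.
Proof.
have ci p : ev2 idfun c t (emb p) = p.[t].
  rewrite /emb (rmorph_ev1 _ (ev2 idfun c t)) ev2X.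
  rewrite (@eq_ev1 _ _ _ idfun) => [|k]; last by rewrite /= ev2C ev1C.
  exact: ev1_idfun.
have cu : ev2 idfun c t curve_u = h.[t] + c * w.[t].
  by rewrite /curve_u rmorphD rmorphM /= !ci ev2C ev1X mulrC.
rewrite /psi (rmorph_ev2 _ (ev2 idfun c t)) cu rmorphB rmorphM cu ev2X.
rewrite (_ : ev2 idfun c t (const2 th) = th) ?ev2C ?ev1C //.
by apply: eq_ev2 => k; rewrite /= ev2C ev1C.
Qed.

(** A point (x, y) with w nonzero lies on the curve with a suitable parameter. *)
Lemma psi_inj a : psi a = 0 -> a = 0.
Proof.
move=> pa; have bw : back w != 0.
  apply: contra w0 => /eqP bz; have := psi_back w; rewrite bz rmorph0 embE => /esym e.
  apply/eqP/polyP => i; have /(congr1 (fun p : {poly {poly F}} => p`_i)) := e.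
  by rewrite coef_map !coef0 /= => /eqP; rewrite polyC_eq0 => /eqP.
suff /eqP : a * back w = 0 by rewrite mulf_eq0 (negPf bw) orbF => /eqP.
apply: (bipoly_zeros char0) => x y; rewrite rmorphM /=.
pose t := y + th * x.
have -> : ev2 idfun x y (back w) = w.[t].
  rewrite /back (rmorph_ev1 _ (ev2 idfun x y)).
  rewrite (@eq_ev1 _ _ _ idfun) => [|k]; last by rewrite /= ev2C ev1C.
  rewrite ev1_idfun /line; congr _.[_].
  by rewrite rmorphD rmorphM /= ev2X !ev2C ev1X ev1C.
have [->|wt] := eqVneq w.[t] 0; first by rewrite mulr0.
have := psi_point ((x - h.[t]) / w.[t]) t a; rewrite pa rmorph0.
rewrite divfK // addrC subrK (_ : t - th * x = y) => [<-|]; first by rewrite mul0r.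
by rewrite /t addrK.
Qed.

Lemma psi_injective : injective psi.
Proof.
move=> x y e; apply/eqP; rewrite -subr_eq0; apply/eqP/psi_inj.
by rewrite rmorphB e subrr.
Qed.

Lemma psi_lift_poly (G : {poly B}) : exists e G',
  map_poly psi G' = (emb w ^+ e)%:P * G.
Proof.
elim/poly_ind: G => [|G c [e [G' hG]]]; first by exists 0%N, 0; rewrite rmorph0 mulr0.
have [e' [c' hc]] := psi_lift c.
exists (e + e')%N, ((back w ^+ e')%:P * G' * 'X + (back w ^+ e * c')%:P).
rewrite map_poly_step rmorphM !rmorphXn psi_back hc hG.
by rewrite exprD !polyCM !polyC_exp; ring.
Qed.

End Substitution.

Arguments const2 {F}.
Arguments emb {F}.

Section RungeLocal.
Variable F : fieldType.
Hypothesis char0 : [pchar F] =i pred0.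
Local Notation B := {poly {poly F}}.
Variables P Q z : {mpoly F[2]}.
Hypothesis jac1 : jacobian_det P Q = 1.
Local Notation ev := (ev3 (@mpolyC 2 F) P Q z).
Variable Pi : {poly B}.
Hypothesis PiN : Pi != 0.
Hypothesis Pi0 : ev Pi = 0.
Hypothesis Pimin : forall G, G != 0 -> ev G = 0 -> (size Pi <= size G)%N.
Variables (b : nat -> B) (d : {poly F}).
Hypothesis bd : \sum_(i < size Pi) b i * Pi`_i = d%:P.
Variables (h w : {poly F}) (th : F).
Hypothesis w0 : w != 0.
Local Notation psi := (psi h w th).

Lemma emb_neq0 (p : {poly F}) : p != 0 -> emb p != 0.
Proof.
apply: contra => /eqP e; apply/eqP/polyP => i.
have /(congr1 (fun q : B => q`_i)) := e; rewrite embE coef_map !coef0 /= => /eqP.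
by rewrite polyC_eq0 => /eqP.
Qed.

Lemma back_neq0 : back th w != 0.
Proof.
apply: contra (emb_neq0 w0) => /eqP bz.
by rewrite -(psi_back h w th) bz rmorph0.
Qed.

Lemma size_map_psi G : size (map_poly psi G) = size G.
Proof. exact: (size_map_inj_poly (@psi_injective _ char0 h w th w0) (rmorph0 _)). Qed.

Lemma size_relation : (1 < size Pi)%N.
Proof.
rewrite ltnNge; apply/negP => /size1_polyC e; have := Pi0; rewrite e ev3C.
have c0 : Pi`_0 != 0 by have := PiN; rewrite {1}e polyC_eq0.
by move=> /eqP; apply/negP; apply: ev2_neq0.
Qed.

Lemma size_CXM (f : B) e G : f != 0 -> size ((f ^+ e)%:P * G) = size G.
Proof. by move=> f0; rewrite size_Cmul // expf_neq0. Qed.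

(** Minimality of Pi means irreducibility over the fraction field of F[P, Q];
    [psi] is an isomorphism on fraction fields, so irreducibility persists. *)
Lemma substituted_irreducible s G T : s != 0 ->
  s%:P * map_poly psi Pi = G * T -> (size Pi <= size G)%N || (size Pi <= size T)%N.
Proof.
move=> s0 e.
have iw0 := emb_neq0 w0.
have [e1 [G' hG]] := psi_lift_poly h w th G.
have [e2 [T' hT]] := psi_lift_poly h w th T.
have [e3 [s' hs]] := psi_lift h w th s.
have s'0 : s' != 0.
  apply: contra s0 => /eqP z0; move: hs; rewrite z0 rmorph0 => /esym/eqP.
  by rewrite mulf_eq0 expf_eq0 (negPf iw0) andbF.
have Pi'0 : map_poly psi Pi != 0 by rewrite -size_poly_eq0 size_map_psi size_poly_eq0.
have GT0 : G * T != 0 by rewrite -e mulf_neq0 // polyC_eq0.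
have [Gn Tn] : G != 0 /\ T != 0 by apply/andP; rewrite -negb_or -mulf_eq0.
have sG : size G' = size G by rewrite -size_map_psi hG size_CXM.
have sT : size T' = size T by rewrite -size_map_psi hT size_CXM.
have key : (back th w ^+ e3)%:P * G' * T' = (back th w ^+ (e1 + e2) * s')%:P * Pi.
  apply: (map_inj_poly (@psi_injective _ char0 h w th w0) (rmorph0 _)).
  rewrite map_polyCMM map_polyCM.
  rewrite hG hT rmorphM !rmorphXn !psi_back hs.
  rewrite !polyCM !polyC_exp exprD.
  transitivity (((emb w)%:P ^+ e1 * (emb w)%:P ^+ e2 * (emb w)%:P ^+ e3) * (G * T)).
    by ring.
  by rewrite -e; ring.
have := congr1 ev key; rewrite !rmorphM /= Pi0 mulr0 => /eqP.
rewrite !mulf_eq0 => /orP[/orP[|]|] /eqP h0.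
- by move: h0 => /eqP; rewrite ev3C (negPf (ev2_neq0 _ _ _)) // expf_neq0 // back_neq0.
- by apply/orP; left; rewrite -sG Pimin // -size_poly_eq0 sG size_poly_eq0.
by apply/orP; right; rewrite -sT Pimin // -size_poly_eq0 sT size_poly_eq0.
Qed.

Variables (kp lc : F) (p : {poly F}).
Hypothesis p_monic : p \is monic.
Hypothesis p_size : (1 < size p)%N.
Hypothesis lc0 : lc != 0.
Hypothesis hk : cong (p ^+ 2) h kp%:P.
Hypothesis wk : cong (p ^+ 2) w 0.
Hypothesis spec : ev2 (@polyC F) kp%:P ('X - (th * kp)%:P) (lead_coef Pi) = lc *: p.
Hypothesis dk : d.[kp] != 0.

Lemma cong_u : cong (emb p ^+ 2) (curve_u h w) (const2 kp).
Proof.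
have [k1 e1] := hk; have [k2 e2] := wk.
exists (emb k1 + emb k2 * 'X%:P); rewrite /curve_u e1 e2.
rewrite add0r rmorphD !rmorphM ?rmorphXn embC; ring.
Qed.

(** Modulo p^2 all the curves coincide with the line u = kappa. *)
Lemma psi_cong a : cong (emb p ^+ 2) (psi a)
  (emb (ev2 (@polyC F) kp%:P ('X - (th * kp)%:P) a)).
Proof.
have [k hku] := cong_u.
rewrite (rmorph_ev2 _ emb) rmorphB embX !embC (@eq_ev2 _ _ _ const2) => [|c]; last exact: embC.
apply: cong_ev2; first exact: cong_u.
exists (- const2 th * k); rewrite hku rmorphM; ring.
Qed.

(** The contact is of order 2, not 1, so that the cofactor E is a nonzero constant
    modulo p. *)
Lemma lead_factor : exists E k, psi (lead_coef Pi) = emb p * E /\ E = const2 lc + emb p * k.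
Proof.
have [k e] := psi_cong (lead_coef Pi).
exists (const2 lc + emb p * k), k; split=> //.
rewrite e spec -mul_polyC rmorphM embC; ring.
Qed.

(** If g had a factor in common with the irreducible Pi, Pi would divide it up
    to scalars.  At a root rho of p the leading coefficient of Pi vanishes, but
    Pi itself does not, by the Bezout identity at u = kappa; whereas the leading
    coefficient of g does not vanish.  This contradicts [gauss_root].  So the
    resultant Psi of Pi and g is not zero, and g = 0 at a point forces Psi = 0
    there. *)
Lemma local_auxiliary (s : {rmorphism F -> algC}) k :
  let n := (size Pi).-1 in let N := (n + n * k)%N in
  exists (g : {poly B}) (eta : nat -> B) (Psi : B),
  [/\ Psi != 0,
      forall i, (i < n)%N -> (size (eta i) <= N * (size p).-1 - k)%N,
      forall (S : comNzRingType) (ev : {rmorphism B -> S}) y,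
        ev (psi (lead_coef Pi)) * y ^+ n + \sum_(i < n) ev (psi Pi`_i) * y ^+ i = 0 ->
        ev (emb p) ^+ N * (map_poly ev g).[y]
          = \sum_(i < n) ev (eta i) * (ev (psi (lead_coef Pi)) * y) ^+ i
    & exists U V, Psi%:P = U * map_poly psi Pi + V * g].
Proof.
move=> n N.
have [E [kE [DE hE]]] := lead_factor.
have eps : size (emb p) = size p.
  by rewrite embE; apply: size_map_inj_poly => //; apply: polyC_inj.
have pm : emb p \is monic by rewrite embE; apply: monic_map.
have [rho hrho] : exists rho, root (map_poly s p) rho.
  apply/closed_rootP; rewrite size_map_poly.
  by move: p_size; case: (size p) => [|[|]].
pose mu : {rmorphism B -> {poly {poly algC}}} := map_poly (map_poly s).
pose chi : {rmorphism B -> {poly algC}} := horner_eval rho%:P \o mu.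
have chi_cc c : chi (const2 c) = (s c)%:P.
  by rewrite /chi /mu /const2 /= !map_polyC /= map_polyC /horner_eval hornerC.
have chi_emb q : chi (emb q) = (map_poly s q).[rho]%:P.
  have chiX : chi 'X = rho%:P by rewrite /chi /mu /= map_polyX /horner_eval hornerX.
  rewrite /emb (rmorph_ev1 _ chi) chiX -ev1_polyC -ev1_map.
  by apply: eq_ev1 => c; apply: chi_cc.
have p_rho : (map_poly s p).[rho] = 0 by apply/eqP.
have chi_E : chi E = (s lc)%:P.
  by rewrite hE rmorphD rmorphM chi_cc chi_emb p_rho polyC0 mul0r addr0.
have E0 : E != 0.
  apply: contra lc0 => /eqP z0; move: chi_E; rewrite z0 rmorph0 => /esym/eqP.
  by rewrite polyC_eq0 fmorph_eq0.
have n0 : (0 < n)%N by rewrite /n -subn1 subn_gt0 size_relation.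
have [|g [eta [ga [m [ga0 lg seta heta]]]]] :=
  @auxiliary_function {poly F} n (fun i => psi Pi`_i) (psi (lead_coef Pi)) E (emb p)
    n0 pm _ DE E0 k.
  by rewrite eps.
pose Pp := map_poly psi Pi.
have sPp : size Pp = size Pi by exact: size_map_psi.
have lPp : lead_coef Pp = psi (lead_coef Pi).
  rewrite /lead_coef sPp /Pp coef_map //.
have nodiv s1 q : s1 != 0 -> s1%:P * g = Pp * q -> False.
  move=> s10 e.
  have mui : injective mu.
    exact: (map_inj_poly (map_inj_poly (fmorph_inj s) (rmorph0 s)) (rmorph0 _)).
  have leadmu (G : {poly B}) : (lead_coef (map_poly mu G)).[rho%:P] = chi (lead_coef G).
    by rewrite (lead_coef_map_inj mui (rmorph0 _)).
  (* Bezout: the coefficients of Pi at u = kappa have no common zero *)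
  have hN : map_poly (horner_eval rho%:P) (map_poly mu Pp) != 0.
    apply/negP => /eqP z0.
    have z1 i : chi (psi Pi`_i) = 0.
      have := congr1 (fun G : {poly {poly algC}} => G`_i) z0.
      by rewrite coef0 !coef_map.
    have : chi (psi d%:P) = 0.
      rewrite -bd !rmorph_sum big1 // => i _.
      by rewrite !rmorphM z1 mulr0.
    have -> : chi (psi d%:P) = (s d.[kp])%:P.
      rewrite /psi ev2C (rmorph_ev1 _ chi).
      have [k1 ->] := cong_u.
      rewrite rmorphD rmorphM expr2 rmorphM chi_cc chi_emb p_rho polyC0 !mul0r addr0.
      rewrite -horner_map -ev1_polyC -ev1_map; apply: eq_ev1 => c; exact: chi_cc.
    by move/eqP; rewrite polyC_eq0 fmorph_eq0 (negPf dk).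
  have := @gauss_root {poly algC} rho%:P (mu s1) (map_poly mu Pp) (map_poly mu g) (map_poly mu q).
  rewrite !leadmu lPp DE rmorphM chi_emb p_rho polyC0 mul0r => hg.
  have : chi (lead_coef g) = 0.
    apply: hg => //; first by apply: contra s10 => /eqP z0; apply/eqP/mui; rewrite rmorph0.
    by rewrite -map_polyCM e rmorphM.
  rewrite lg rmorphM rmorphXn chi_E => /eqP.
  rewrite mulf_eq0 expf_eq0 polyC_eq0 fmorph_eq0 (negPf lc0) andbF orbF.
  rewrite /chi /mu /= map_polyC /horner_eval hornerC /= map_poly_eq0.
  exact/negP.
have g0 : g != 0.
  by rewrite -lead_coef_eq0 lg mulf_neq0 ?polyC_eq0 // expf_neq0.
exists g, eta.
have [sg|sg] := leqP (size g) 1.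
  exists g`_0; split=> //.
  - by have := g0; rewrite {1}(size1_polyC sg) polyC_eq0.
  - by rewrite -eps.
  by exists 0, 1; rewrite -(size1_polyC sg); apply: trivial_combination.
exists (resultant Pp g); split=> //.
- rewrite resultant_eq0 -leqNgt leqNgt; apply/negP => sgcd.
  have /Pdiv.Idomain.dvdpP [[c1 T1] /= c10 e1] := Pdiv.Idomain.dvdp_gcdl Pp g.
  have /Pdiv.Idomain.dvdpP [[c2 T2] /= c20 e2] := Pdiv.Idomain.dvdp_gcdr Pp g.
  move: sgcd e1 e2; set G := Pdiv.Idomain.gcdp Pp g; move: G => G sgcd e1 e2.
  rewrite -!mul_polyC in e1 e2.
  have TG0 : T1 * G != 0.
    by rewrite -e1 mulf_neq0 ?polyC_eq0 // -size_poly_eq0 sPp size_poly_eq0.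
  have [T10 G0] : T1 != 0 /\ G != 0 by apply/andP; rewrite -negb_or -mulf_eq0.
  have sTG : (size T1 + size G).-1 = size Pi.
    by rewrite -sPp -(size_Cmul Pp c10) e1 size_mul.
  have := substituted_irreducible c10 e1.
  move=> /(product_size sTG sgcd) /size1_polyC eT.
  have t0 : T1`_0 != 0 by have := T10; rewrite {1}eT polyC_eq0.
  apply: (nodiv (T1`_0 * c2) (c1%:P * T2)); first by rewrite mulf_neq0.
  rewrite polyCM -mulrA e2 -eT mulrCA -e1; ring.
- by rewrite -eps.
have [|//|[U V] /= _ ->] := @resultant_in_ideal _ Pp g.
  by rewrite sPp size_relation.
by exists U, V.
Qed.

End RungeLocal.

(** * Choice of the Runge curve *)
Definition eventually (A : nat -> Prop) := exists N, forall n, (N <= n)%N -> A n.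

Lemma eventuallyI A1 A2 : eventually A1 -> eventually A2 ->
  eventually (fun n => A1 n /\ A2 n).
Proof.
move=> [N1 h1] [N2 h2]; exists (maxn N1 N2) => n; rewrite geq_max => /andP[a b].
by split; [apply: h1 | apply: h2].
Qed.

Lemma eventually_seq (T : eqType) (s : seq T) (A : T -> nat -> Prop) :
  (forall x, x \in s -> eventually (A x)) ->
  eventually (fun n => forall x, x \in s -> A x n).
Proof.
elim: s => [|x s IH] h; first by exists 0%N.
have [|N hN] := eventuallyI (h x (mem_head x s)) (IH _).
  by move=> y ys; apply: h; rewrite inE ys orbT.
exists N => n Nn y; rewrite inE => /orP[/eqP ->|ys]; first by case: (hN n Nn).
by case: (hN n Nn) => _; apply.
Qed.

Lemma eventually_fin (T : finType) (A : T -> nat -> Prop) :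
  (forall x, eventually (A x)) -> eventually (fun n => forall x, A x n).
Proof.
move=> h; have [N hN] := @eventually_seq _ (enum T) A (fun x _ => h x).
by exists N => n Nn x; apply: hN => //; rewrite mem_enum.
Qed.

Lemma common_root (F : fieldType) (s : {rmorphism F -> algC}) (p q : {poly F}) :
  ~~ coprimep p q -> exists r, root (map_poly s p) r /\ root (map_poly s q) r.
Proof.
rewrite -(coprimep_map s) /coprimep => /closed_rootP [r].
by rewrite root_gcd => /andP[]; exists r.
Qed.

Lemma root_mem_seq (p : {poly algC}) : p != 0 ->
  exists rs : seq algC, forall x, root p x -> x \in rs.
Proof.
move=> p0; have [rs hp] := closed_field_poly_normal p.
exists rs => x; rewrite hp rootZ ?lead_coef_eq0 //.
by rewrite root_prod_XsubC.
Qed.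

(** Roots translated at distinct nonzero speeds kp i are, at large times th,
    pairwise distinct and different from 0. *)
Lemma generic_shear (F : fieldType) (s : {rmorphism F -> algC}) m
    (q : 'I_m -> {poly F}) (kp : 'I_m -> F) :
  (forall i, q i != 0) -> (forall i, kp i != 0) -> injective kp ->
  exists th : nat,
    (forall i j, i != j -> coprimep (q i \Po ('X - (th%:R * kp i)%:P))
                                    (q j \Po ('X - (th%:R * kp j)%:P))) /\
    (forall i, coprimep (q i \Po ('X - (th%:R * kp i)%:P)) 'X).
Proof.
move=> q0 kp0 kpi.
have [rs hrs] := @fin_all_exists 'I_m (fun=> seq algC) _
  (fun i => @root_mem_seq (map_poly s (q i)) (eq_ind_r is_true (q0 i) (congr1 negb (map_poly_eq0 s (q i))))).
have lin (a b : algC) : a != 0 -> eventually (fun n => n%:R * a + b != 0).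
  move=> a0; have l0 : a *: 'X + b%:P != 0 :> {poly algC}.
    apply: contra a0 => /eqP /(congr1 (fun p : {poly algC} => p`_1)).
    by rewrite coefD coefZ coefX coefC coef0 mulr1 addr0 => ->.
  have [N hN] := nat_nonroot (pchar_num algC) l0.
  by exists N => n /hN; rewrite hornerD hornerZ hornerX hornerC mulrC.
have shift i th r : root (map_poly s (q i \Po ('X - (th%:R * kp i)%:P))) r ->
    r - th%:R * s (kp i) \in rs i.
  rewrite map_comp_poly rmorphB /= map_polyX map_polyC /= rmorphM rmorph_nat => h.
  apply: hrs; move: h; rewrite /root horner_comp hornerD hornerX hornerN hornerC.
  by [].
have [N1 h1] : eventually (fun th => forall ij : 'I_m * 'I_m, forall x, x \in rs ij.1 ->
    forall y, y \in rs ij.2 -> ij.1 != ij.2 ->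
    th%:R * (s (kp ij.1) - s (kp ij.2)) + (x - y) != 0).
  apply: eventually_fin => -[i j] /=; apply: eventually_seq => x _.
  apply: eventually_seq => y _.
  have [->|ij] := eqVneq i j; first by exists 0%N.
  have [|N hN] := lin (s (kp i) - s (kp j)) (x - y).
    by rewrite -rmorphB fmorph_eq0 subr_eq0 (inj_eq kpi).
  by exists N => n Nn _; apply: hN.
have [N2 h2] : eventually (fun th => forall i, forall x, x \in rs i -> th%:R * s (kp i) + x != 0).
  apply: eventually_fin => i; apply: eventually_seq => x _.
  by apply: lin; rewrite fmorph_eq0.
exists (maxn N1 N2); split=> [i j ij|i]; apply: contraT => /(common_root s) [r [r1 r2]].
  have := h1 _ (leq_maxl N1 N2) (i, j) _ (shift _ _ _ r1) _ (shift _ _ _ r2) ij.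
  by case/eqP => /=; ring.
have := h2 _ (leq_maxr N1 N2) i _ (shift _ _ _ r1).
move: r2; rewrite map_polyX /root hornerX => /eqP ->.
by rewrite sub0r addrN eqxx.
Qed.

Lemma specialise_first (F : comNzRingType) (x : F) q (a : {poly {poly F}}) :
  ev2 (@polyC F) x%:P q a = (map_poly (horner_eval x) a) \Po q.
Proof.
elim/poly_ind: a => [|a c IH]; first by rewrite !rmorph0.
rewrite [LHS]rmorphD [ev2 _ _ _ (a * 'X)]rmorphM ev2X ev2C ev1_polyC IH.
by rewrite rmorphD rmorphM /= map_polyX map_polyC comp_polyD comp_polyM comp_polyX comp_polyC.
Qed.

Lemma ev3_recr (R S : comNzRingType) (f : {rmorphism R -> S}) u v y
    (Pi : {poly {poly {poly R}}}) n :
  size Pi = n.+1 -> ev3 f u v y Pi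
  = \sum_(i < n) ev2 f u v Pi`_i * y ^+ i + ev2 f u v (lead_coef Pi) * y ^+ n.
Proof. by move=> e; rewrite ev3E /lead_coef e big_ord_recr. Qed.

Lemma ev3_horner (R S : comNzRingType) (f : {rmorphism R -> S}) u v y a :
  ev3 f u v y a = (map_poly (ev2 f u v) a).[y].
Proof. by []. Qed.

Lemma eval_combination (R S : comNzRingType) (f : {rmorphism R -> S}) a (U A V G : {poly R}) y :
  a%:P = U * A + V * G -> (map_poly f A).[y] = 0 -> (map_poly f G).[y] = 0 -> f a = 0.
Proof.
move=> e hA hG; have := congr1 (fun G => (map_poly f G).[y]) e.
by rewrite rmorphD !rmorphM /= map_polyC hornerC hornerD !hornerM hA hG !mulr0 addr0.
Qed.

Section Runge.
Variable F : fieldType.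
Hypothesis char0 : [pchar F] =i pred0.
Variable s : {rmorphism F -> algC}.
Variables P Q z : {mpoly F[2]}.
Hypothesis jac1 : jacobian_det P Q = 1.

(** The data of Runge's method.  The parameter of the family of curves is
    specialised to an integer at which no resultant vanishes.  The factor 'X^2
    of h is used as h (0) = 0 in the end: it preserves the base point. *)
Lemma runge_curve m : ~ integral_along_v P Q z ->
  exists Pi : {poly {poly {poly F}}}, ev3 (@mpolyC 2 F) P Q z Pi = 0 /\
  exists (th : nat) (h D : {poly F}) (n N k1 k : nat) (phi : nat -> {poly F})
    (p be : 'I_m -> {poly F}) (g : 'I_m -> {poly {poly F}})
    (eta : 'I_m -> nat -> {poly F}),
  [/\ (0 < n)%N /\ k = (n * k1).+1, exists h0, h = 'X^2 * h0,
      forall i, (i < n)%N -> (size (phi i) <= k1.+1)%N,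
      forall j, [/\ p j \is monic, (1 < size (p j))%N, be j != 0,
        forall i, i != j -> coprimep (p i) (p j)
        & forall i, (i < n)%N -> (size (eta j i) <= N * (size (p j)).-1 - k)%N]
    & forall t y, ev3 idfun h.[t] (t - th%:R * h.[t]) y Pi = 0 ->
        (D.[t] * y) ^+ n + \sum_(i < n) (phi i).[t] * (D.[t] * y) ^+ i = 0 /\
        forall j, (p j).[t] ^+ N * ev2 idfun t y (g j)
                  = \sum_(i < n) (eta j i).[t] * (D.[t] * y) ^+ i
             /\ (ev2 idfun t y (g j) = 0 -> (be j).[t] = 0)].
Proof.
move=> nint.
have [Pi [PiN Pi0 Pimin [b [d [d0 bd]]]]] := primitive_relation char0 z jac1.
exists Pi; split=> //.
have sPi := size_relation char0 jac1 PiN Pi0.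
pose an := lead_coef Pi; have an0 : an != 0 by rewrite lead_coef_eq0.
have san : (1 < size an)%N.
  rewrite ltnNge; apply/negP => s1; apply: nint; exists Pi; split=> //.
  by apply/eqP; rewrite eqn_leq s1 size_poly_gt0.
have dl0 : d * lead_coef an != 0 by rewrite mulf_neq0 // lead_coef_eq0.
have [N0 hN0] := nat_nonroot char0 dl0.
pose kp (j : 'I_m) : F := (N0 + j).+1%:R.
have kp0 j : kp j != 0 by rewrite /kp ((pcharf0P F).1 char0).
have kpi : injective kp.
  move=> i j /(congr1 s) /eqP; rewrite /kp !rmorph_nat eqr_nat eqSS eqn_add2l.
  by move=> /eqP/val_inj.
have dlk j : (d.[kp j] != 0) && ((lead_coef an).[kp j] != 0).
  by rewrite -negb_or -mulf_eq0 -hornerM; apply: hN0; rewrite -addnS leq_addr.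
have dk j : d.[kp j] != 0 by case/andP: (dlk j).
have lk j : (lead_coef an).[kp j] != 0 by case/andP: (dlk j).
pose A j := map_poly (horner_eval (kp j)) an.
have lA j : lead_coef (A j) = (lead_coef an).[kp j].
  by rewrite /A lead_coef_map_id0 ?rmorph0 //; apply: lk.
have sA j : size (A j) = size an by rewrite /A size_map_poly_id0 //; apply: lk.
have A0 j : A j != 0 by rewrite -size_poly_gt0 sA size_poly_gt0.
have [th [cop copX]] := generic_shear s A0 kp0 kpi.
pose X_ j : {poly F} := 'X - (th%:R * kp j)%:P.
have sX j : size (X_ j) = 2 by rewrite size_XsubC.
pose p j := (lead_coef (A j))^-1 *: (A j \Po X_ j).
have lA0 j : lead_coef (A j) != 0 by rewrite lead_coef_eq0.
have lAV j : (lead_coef (A j))^-1 != 0 by rewrite invr_eq0.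
have pm j : p j \is monic.
  by rewrite monicE lead_coefZ lead_coef_comp ?sX // lead_coefXsubC expr1n mulr1 mulVf.
have sp j : (1 < size (p j))%N.
  by rewrite size_scale // size_comp_poly2 ?sX // sA.
have copp i j : i != j -> coprimep (p i) (p j).
  by move=> ij; rewrite coprimepZl // coprimepZr //; apply: cop.
have [|j|h0 hh0] := @poly_crt F m (fun j => p j ^+ 2) 'X^2 (fun j => (kp j)%:P).
- by move=> i j ij; apply/coprimep_expl/coprimep_expr/copp.
- by apply/coprimep_expl/coprimep_expr; rewrite coprimepZl //; exact: copX.
pose h := 'X^2 * h0.
pose w := 'X^2 * \prod_j p j ^+ 2.
have w0 : w != 0.
  rewrite mulf_neq0 ?expf_neq0 ?polyX_eq0 // prodf_seq_neq0.
  by apply/allP => j _; rewrite /= expf_neq0 // monic_neq0.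
have wj j : cong (p j ^+ 2) w 0.
  exists ('X^2 * \prod_(i | i != j) p i ^+ 2); rewrite /w (bigD1 j) //=; ring.
have spec j : ev2 (@polyC F) (kp j)%:P (X_ j) an = lead_coef (A j) *: p j.
  by rewrite specialise_first scalerA mulfV // scale1r.
pose psi := psi h w th%:R.
pose n := (size Pi).-1.
have n0 : (0 < n)%N by rewrite /n -subn1 subn_gt0.
have nS : size Pi = n.+1 by rewrite /n prednK // ltnW.
pose al i := psi Pi`_i.
pose sc := shifted_coef n al (psi an).
pose k1 := \max_(i < n) size (sc i).
pose k := (n * k1).+1.
pose N := (n + n * k)%N.
have loc j := @local_auxiliary F char0 P Q z jac1 Pi PiN Pi0 Pimin b d bd h w th%:R w0
  (kp j) (lead_coef (A j)) (p j) (pm j) (sp j) (lA0 j) (hh0 j) (wj j) (spec j) (dk j) s k.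
have /fin_all_exists [g /fin_all_exists [eta /fin_all_exists [Psi hl]]] := loc.
have [c0 hc0] : eventually (fun c0 => forall j, (lead_coef (Psi j)).[c0%:R] != 0).
  apply: eventually_fin => j; apply: nat_nonroot => //.
  by rewrite lead_coef_eq0; case: (hl j).
move: {hc0}(hc0 c0 (leqnn _)) => hc0.
pose ht := h + c0%:R *: w.
pose spz := map_poly (horner_eval (c0%:R : F)).
have spz_size a : (size (spz a) <= size a)%N by apply: size_poly.
exists th, ht, (spz (psi an)), n, N, k1, k, (fun i => spz (sc i)), p, (fun j => spz (Psi j)),
  (fun j => map_poly spz (g j)), (fun j i => spz (eta j i)).
split.
- by [].
- by exists (h0 + c0%:R *: \prod_j p j ^+ 2); rewrite /ht /h /w mulrDr scalerAr.
- move=> i ni; apply: leq_trans (spz_size _) _; apply: leqW.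
  exact: (leq_bigmax (Ordinal ni)).
- move=> j; have [Psi0 seta _ _] := hl j; split=> //.
    apply: contra (hc0 j) => /eqP z0.
    have := congr1 (fun q : {poly F} => q`_(size (Psi j)).-1) z0.
    by rewrite coef_map coef0 => e; apply/eqP.
    by move=> i; apply: copp.
  by move=> i ni; apply: leq_trans (seta i ni); apply: spz_size.
move=> t y; pose om := ev2 (@idfun F) c0%:R t.
have omE a : om a = (spz a).[t] by rewrite /om ev2_idfun.
have htt : ht.[t] = h.[t] + c0%:R * w.[t] by rewrite hornerD hornerZ.
move=> e0; have := e0; rewrite (ev3_recr _ _ _ _ nS) htt => hP.
have hom : om (psi an) * y ^+ n + \sum_(i < n) om (al i) * y ^+ i = 0.
  rewrite addrC -[RHS]hP /om /psi psi_point; congr (_ + _).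
  by apply: eq_bigr => i _; rewrite /al /psi psi_point.
rewrite -omE; split=> [|j].
  rewrite -[RHS](shifted_equation n0 hom); congr (_ + _).
  by apply: eq_bigr => i _; rewrite -omE.
have [_ _ heta [U [V hUV]]] := hl j.
have gE : ev2 idfun t y (map_poly spz (g j)) = (map_poly om (g j)).[y].
  rewrite ev2_idfun -map_poly_comp; congr _.[_].
  by apply: eq_map_poly => a; rewrite omE.
have ompj : om (emb (p j)) = (p j).[t].
  rewrite /om (rmorph_ev1 _ (ev2 (@idfun F) c0%:R t)) ev2X.
  rewrite (@eq_ev1 _ _ _ idfun) => [|x]; last by rewrite /= ev2C ev1C.
  exact: ev1_idfun.
rewrite gE -ompj; split; first rewrite (heta _ om y hom).
  by apply: eq_bigr => i _; rewrite -omE.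
move=> g0; rewrite -omE; apply: (eval_combination hUV _ g0).
transitivity (map_poly (om \o psi) Pi).[y]; first by rewrite map_poly_comp.
rewrite -[RHS]e0 ev3_horner; congr _.[_].
by apply: eq_map_poly => a; rewrite /om [LHS]psi_point htt.
Qed.
End Runge.

(** * Embeddings of a number field *)
Lemma char_poly_horner (R : comNzRingType) n (A : 'M[R]_n) x :
  (char_poly A).[x] = \det (x%:M - A).
Proof.
rewrite /char_poly -horner_evalE -det_map_mx; congr (\det _).
apply/matrixP => i j; rewrite !mxE /= /horner_eval hornerD hornerN hornerC.
by rewrite hornerMn hornerX.
Qed.

Lemma prod_linear_factors (p : {poly algC}) :
  exists c (bs : seq algC), p = c *: \prod_(b <- bs) (b%:P - 'X).
Proof.
have [bs ->] := closed_field_poly_normal p; exists (lead_coef p * (-1) ^+ size bs), bs.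
rewrite -scalerA; congr (_ *: _); elim: bs => [|b bs IH].
  by rewrite !big_nil expr0 scale1r.
rewrite !big_cons IH /= exprS -scalerA scaleN1r -scalerAr.
by rewrite -scalerN -mulNr opprB.
Qed.

(** The product is the determinant of g (C), with C the companion matrix of m.
    Splitting g instead of m over the algebraic numbers yields this without
    diagonalising C. *)
Lemma prod_over_roots_rational (m g : {poly rat}) (rs : seq algC) :
  m \is monic -> (1 < size m)%N ->
  map_poly ratr m = \prod_(r <- rs) ('X - r%:P) ->
  \prod_(r <- rs) (map_poly ratr g).[r] \in Crat.
Proof.
move=> mm sm hrs.
have [n [C hC]] : exists n (C : 'M[rat]_n.+1), char_poly C = m.
  have := companionmxK mm; move: (companionmx m); case: (size m) sm => [|[|n]] // _ C hC.
  by exists n, C.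
pose C' := map_mx (ratr : rat -> algC) C.
have detE (p : {poly algC}) : \det (horner_mx C' p) = \prod_(r <- rs) p.[r].
  have srs : size rs = n.+1.
    have := size_prod_XsubC rs id; rewrite -hrs size_map_poly -hC size_char_poly.
    by case.
  have [c [bs ->]] := prod_linear_factors p.
  rewrite linearZ /= detZ rmorph_prod /=.
  have -> : \prod_(r <- rs) (c *: \prod_(b <- bs) (b%:P - 'X)).[r]
     = c ^+ n.+1 * \prod_(b <- bs) \prod_(r <- rs) (b - r).
    rewrite exchange_big /= -srs; elim: (rs) => [|r s IH].
      by rewrite !big_nil expr0 mulr1.
    rewrite !big_cons IH hornerZ horner_prod /= exprS.
    under eq_bigr do rewrite hornerD hornerN hornerC hornerX.
    by rewrite mulrACA.
  congr (_ * _); elim: bs => [|b bs IH]; first by rewrite !big_nil det1.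
  rewrite !big_cons -[X in \det X]/(_ *m _) det_mulmx IH; congr (_ * _).
  rewrite rmorphB /= horner_mx_X horner_mx_C -char_poly_horner -map_char_poly hC hrs.
  by rewrite horner_prod; apply: eq_bigr => r _; rewrite hornerXsubC.
by rewrite -detE /C' -map_horner_mx det_map_mx Crat_rat.
Qed.

Section Embeddings.
Variable K : fieldExtType rat.

Lemma number_field_char0 : [pchar K] =i pred0.
Proof. by move=> p; rewrite pchar_lalg pchar_num. Qed.

Local Notation inK := (map_poly (in_alg K)).

Lemma primitive_element : exists (th : K) (m : {poly rat}),
  [/\ m \is monic, (1 < size m)%N, root (inK m) th,
      forall p : {poly rat}, root (inK p) th -> m %| p
    & forall a, exists p : {poly rat}, a = (inK p).[th]].
Proof.
have sep : separable 1%AS (fullv : {vspace K}).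
  apply/separableP => y _; exact: (pcharf0_separable _ number_field_char0).
have gen := eq_adjoin_separable_generator (E := {:K}%AS) sep (sub1v _).
set th := separable_generator _ _ in gen.
have /polyOver1P [m hm] := minPolyOver 1%AS th.
have mon := monic_minPoly 1%AS th.
exists th, m; split.
- by move: mon; rewrite hm map_monic.
- rewrite -(size_map_poly (in_alg K)) -hm.
  exact: root_size_gt1 (monic_neq0 mon) (root_minPoly _ _).
- by rewrite -hm root_minPoly.
- move=> p rp; rewrite -(dvdp_map (in_alg K)) -hm; apply: minPoly_dvdp => //.
  by apply/polyOver1P; exists p.
move=> a; have /Fadjoin_polyP [p /polyOver1P [q ->] ->] : a \in <<1; th>>%VS.
  by rewrite -gen memvf.
by exists q.
Qed.

(** The value at al of a representing polynomial does not depend on the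
    representative, as representatives differ by multiples of m. *)
Lemma embedding_of_root (th : K) (m : {poly rat}) (al : algC) :
  (forall p : {poly rat}, root (inK p) th -> m %| p) ->
  (forall a, exists p : {poly rat}, a = (inK p).[th]) ->
  root (map_poly ratr m) al ->
  exists s : {rmorphism K -> algC},
    forall p : {poly rat}, s (inK p).[th] = (map_poly ratr p).[al].
Proof.
move=> mmin gen ral.
have van (p q : {poly rat}) : (inK p).[th] = (inK q).[th] ->
    (map_poly ratr p).[al] = (map_poly ratr q).[al] :> algC.
  move=> e; apply/eqP; rewrite -subr_eq0 -hornerN -hornerD -rmorphB.
  apply: (root_dvdp _ ral); rewrite dvdp_map; apply: mmin.
  by rewrite /root rmorphB hornerD hornerN e subrr.
have ex a : exists p : {poly rat}, a == (inK p).[th] by have [p ->] := gen a; exists p.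
pose rep a := xchoose (ex a).
have repP a : a = (inK (rep a)).[th] by apply/eqP/(xchooseP (ex a)).
pose f a : algC := (map_poly ratr (rep a)).[al].
have fE p : f (inK p).[th] = (map_poly ratr p).[al] by apply: van; rewrite -repP.
have fB : zmod_morphism f.
  move=> x y; rewrite (repP x) (repP y) -hornerN -hornerD -rmorphB !fE.
  by rewrite rmorphB hornerD hornerN.
have fM : monoid_morphism f.
  split=> [|x y].
    by have := fE 1; rewrite !rmorph1 !hornerC.
  by rewrite (repP x) (repP y) -hornerM -rmorphM !fE rmorphM hornerM.
pose fA := GRing.isZmodMorphism.Build K algC f fB.
pose fR := GRing.isMonoidMorphism.Build K algC f fM.
pose s : {rmorphism K -> algC} := HB.pack f fA fR.
by exists s.
Qed.

Lemma embedding_integral (s : {rmorphism K -> algC}) a :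
  ring_of_integers a -> s a \in Aint.
Proof.
move=> [p pm rp]; apply: (@root_monic_Aint (map_poly intr p)).
- have := rmorph_root s rp; rewrite -map_poly_comp.
  by rewrite (eq_map_poly (g := intr)) // => x /=; rewrite rmorph_int.
- exact: monic_map.
by apply/polyOverP => i; rewrite coef_map /= intr_int.
Qed.

(** The norm of an integer is a rational algebraic integer, hence an integer. *)
Lemma embeddings : exists (r : nat) (s : 'I_r.+1 -> {rmorphism K -> algC}),
  forall a, ring_of_integers a -> a != 0 -> 1 <= \prod_i nm (s i a).
Proof.
have [th [m [mm sm rm mmin gen]]] := primitive_element.
have [rs hrs] := closed_field_poly_normal (map_poly (ratr : rat -> algC) m).
rewrite lead_coef_map (monicP mm) rmorph1 scale1r in hrs.
have srs : (0 < size rs)%N.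
  by have := size_prod_XsubC rs id; rewrite -hrs size_map_poly => e; move: sm; rewrite e.
case: rs srs hrs => // r0 rs _; set al := r0 :: rs => hrs.
have [s hs] : exists s : 'I_(size rs).+1 -> {rmorphism K -> algC},
    forall i, forall p : {poly rat}, s i (inK p).[th] = (map_poly ratr p).[al`_i].
  apply: (@fin_all_exists 'I_(size rs).+1 (fun=> {rmorphism K -> algC})
    (fun i s => forall p : {poly rat}, s (inK p).[th] = (map_poly ratr p).[al`_i])).
  move=> i; apply: embedding_of_root mmin gen _.
  by rewrite hrs root_prod_XsubC; apply: mem_nth.
exists (size rs), s => a ia a0.
have [g hg] := gen a.
have prodE : \prod_(r <- al) (map_poly ratr g).[r] = \prod_i s i a.
  rewrite (big_nth 0) big_mkord; apply: eq_bigr => i _.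
  by rewrite -hs -hg.
have int : \prod_i s i a \is a Num.int.
  apply: Cint_rat_Aint; first by rewrite -prodE; apply: (prod_over_roots_rational _ mm sm).
  by apply: rpred_prod => i _; apply: embedding_integral.
have n0 : \prod_i s i a != 0.
  by rewrite prodf_seq_neq0; apply/allP => i _; rewrite /= fmorph_eq0.
have -> : \prod_i nm (s i a) = nm (\prod_i s i a).
  by elim/big_rec2: _ => [|i x y _ ->]; rewrite ?nm1 ?nmM.
by have := norm_intr_ge1 int n0.
Qed.

End Embeddings.

(** * Bounds at one place *)
Section Place.
Variables (F : fieldType) (s : {rmorphism F -> algC}).
Local Notation abs x := (nm (s x)).
Local Notation ht t := (1 + nm (s t)).

Lemma absM x y : abs (x * y) = abs x * abs y. Proof. by rewrite rmorphM nmM. Qed.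
Lemma absX x n : abs (x ^+ n) = abs x ^+ n. Proof. by rewrite rmorphXn nmX. Qed.
Lemma abs_sum (I : Type) (r : seq I) (G : I -> F) :
  abs (\sum_(i <- r) G i) <= \sum_(i <- r) abs (G i).
Proof. by rewrite rmorph_sum; apply: nm_sum. Qed.
Lemma ht_ge1 t : 1 <= ht t :> algR.
Proof. by rewrite lerDl nm_ge0. Qed.

Lemma ht_gt0 t : 0 < ht t :> algR.
Proof. exact: lt_le_trans ltr01 (ht_ge1 t). Qed.

Lemma htX_ge0 t k : 0 <= ht t ^+ k :> algR.
Proof. by rewrite exprn_ge0 // ltW ?ht_gt0. Qed.

Lemma poly_upper (p : {poly F}) k : (size p <= k.+1)%N ->
  exists2 C : algR, 0 <= C & forall t, abs p.[t] <= C * ht t ^+ k.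
Proof.
move=> sp; exists (\sum_(i < k.+1) abs p`_i).
  by apply: sumr_ge0 => i _; apply: nm_ge0.
move=> t; rewrite (horner_coef_wide _ sp) mulr_suml.
apply: le_trans (abs_sum _ _) _; apply: ler_sum => i _.
rewrite absM absX ler_wpM2l ?nm_ge0 //.
apply: le_trans (_ : ht t ^+ i <= _); first by rewrite lerXn2r ?nnegrE ?nm_ge0 ?lerDr ?ler01 // ltW ?ht_gt0.
by apply: ler_weXn2l; [apply: ht_ge1 | rewrite -ltnS].
Qed.

(** Stated as a product so that the truncated subtraction is harmless: if
    M < k then p = 0. *)
Lemma poly_upper_gap (p : {poly F}) k M : (size p <= M - k)%N ->
  exists2 C : algR, 0 <= C & forall t, abs p.[t] * ht t ^+ k <= C * ht t ^+ M.
Proof.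
have [->|p0] := eqVneq p 0 => sp.
  by exists 0 => // t; rewrite horner0 rmorph0 nm0 !mul0r.
have s0 : (0 < size p)%N by rewrite size_poly_gt0.
have kM : (k <= M)%N by move: s0 sp; lia.
have [|C C0 hC] := @poly_upper p (M - k); first exact: leqW.
exists C => // t; rewrite -(subnK kM) exprD mulrA ler_wpM2r ?htX_ge0 //.
Qed.

Lemma linear_factors_lower (rs : seq algC) : exists2 M : algR, 0 <= M &
  forall t, M <= nm t ->
    (1 + nm t) ^+ size rs <= 2 ^+ size rs * nm (\prod_(r <- rs) ('X - r%:P)).[t].
Proof.
elim: rs => [|r rs [M M0 IH]].
  by exists 0 => // t _; rewrite big_nil hornerC nm1 mulr1.
exists (M + (1 + 2 * nm r)); first by rewrite !addr_ge0 ?ler01 ?mulr_ge0 ?nm_ge0 // ler0n.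
move=> t tM; rewrite big_cons /= hornerM nmM hornerXsubC !exprS.
have r0 := nm_ge0 r.
have tr : 1 + nm t <= 2 * nm (t - r).
  have : nm t <= nm (t - r) + nm r by have := ler_nmD (t - r) r; rewrite subrK.
  lra.
have tM' : M <= nm t by lra.
rewrite mulrACA; apply: ler_pM => //; last exact: IH.
  by rewrite addr_ge0 ?ler01 ?nm_ge0.
by rewrite exprn_ge0 // addr_ge0 ?ler01 ?nm_ge0.
Qed.

Lemma poly_lower (p : {poly F}) : p != 0 -> exists M C : algR,
  [/\ 0 <= M, 0 <= C
    & forall t, M <= abs t -> ht t ^+ (size p).-1 <= C * abs p.[t]].
Proof.
move=> p0; have [rs hrs] := closed_field_poly_normal (map_poly s p).
have [M M0 hM] := linear_factors_lower rs.
have : lead_coef (map_poly s p) != 0 by rewrite lead_coef_eq0 map_poly_eq0.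
move: hrs; set l := lead_coef _ => hrs l0.
have srs : (size p).-1 = size rs.
  by rewrite -(size_map_poly s) hrs size_scale // size_prod_XsubC.
exists M, (2 ^+ size rs / nm l); split=> //.
  by rewrite divr_ge0 ?nm_ge0 // exprn_ge0 // ler0n.
move=> t tM; rewrite srs -horner_map /= hrs.
rewrite hornerZ nmM mulrA divfK ?nm_eq0 //; exact: hM.
Qed.

(** For large t every polynomial is of the order of its leading term; for
    bounded t a Bezout relation prevents p and q from being both small. *)
Lemma coprime_lower (p q : {poly F}) : p != 0 -> q != 0 -> coprimep p q ->
  exists2 C : algR, 0 <= C & forall t,
    ht t ^+ (size p).-1 <= C * abs p.[t] \/ ht t ^+ (size q).-1 <= C * abs q.[t].
Proof.
move=> p0 q0 /Bezout_eq1_coprimepP [[u v] /= uv].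
have [M [C [M0 C0 hC]]] := poly_lower p0.
have [Cu Cu0 hu] := @poly_upper u (size u) (leqnSn _).
have [Cv Cv0 hv] := @poly_upper v (size v) (leqnSn _).
pose e := (size p + size q)%N.
pose B := (Cu * (1 + M) ^+ size u + Cv * (1 + M) ^+ size v) * (1 + M) ^+ e.
have M1 : 1 <= 1 + M by rewrite lerDl.
have M1k k : 0 <= (1 + M) ^+ k by rewrite exprn_ge0 // addr_ge0 ?ler01.
have B0 : 0 <= B by rewrite mulr_ge0 ?addr_ge0 ?mulr_ge0.
exists (C + 2 * B); first by apply: addr_ge0 => //; apply: mulr_ge0 => //; apply: ler0n.
move=> t; have [tM|tM] := leP M (abs t).
  left; apply: le_trans (hC t tM) _; rewrite ler_wpM2r ?nm_ge0 //.
  by rewrite lerDl; apply: mulr_ge0 => //; apply: ler0n.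
have htM k : ht t ^+ k <= (1 + M) ^+ k.
  by rewrite lerXn2r ?nnegrE ?ltW ?ht_gt0 //; [exact: lt_le_trans ltr01 M1|rewrite ltrD2l].
have one : 1 <= abs u.[t] * abs p.[t] + abs v.[t] * abs q.[t].
  have := congr1 (fun f : {poly F} => abs f.[t]) uv.
  rewrite hornerD !hornerM hornerC rmorph1 nm1 => <-.
  rewrite rmorphD; apply: le_trans (ler_nmD _ _) _; rewrite -!absM.
  exact: lexx.
set U := Cu * (1 + M) ^+ size u; set V := Cv * (1 + M) ^+ size v.
have U0 : 0 <= U by rewrite mulr_ge0.
have V0 : 0 <= V by rewrite mulr_ge0.
have hU : abs u.[t] <= U by apply: le_trans (hu t) _; rewrite ler_wpM2l.
have hV : abs v.[t] <= V by apply: le_trans (hv t) _; rewrite ler_wpM2l.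
have final (x : algR) k : (k <= e)%N -> 0 <= x -> 1 <= (U + V) * x ->
    ht t ^+ k <= (C + 2 * B) * x.
  move=> ke x0 h; apply: le_trans (htM k) _.
  apply: le_trans (_ : (1 + M) ^+ e <= _); first by apply: ler_weXn2l.
  apply: le_trans (_ : (1 + M) ^+ e * ((U + V) * x) <= _); first by rewrite ler_peMr.
  rewrite mulrA [X in X * x]mulrC -/B ler_wpM2r //.
  by rewrite -[leLHS]add0r lerD // ler_peMl // ler1n.
have p_0 := nm_ge0 (s p.[t]); have q_0 := nm_ge0 (s q.[t]).
have key : 1 <= U * abs p.[t] + V * abs q.[t].
  by apply: le_trans one _; rewrite lerD // ler_wpM2r.
have [pq|pq] := leP (abs q.[t]) (abs p.[t]); [left|right]; apply: final => //.
- by rewrite /e (leq_trans (leq_pred _)) ?leq_addr.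
- by apply: le_trans key _; rewrite mulrDl lerD2l ler_wpM2l.
- by rewrite /e (leq_trans (leq_pred _)) ?leq_addl.
- by apply: le_trans key _; rewrite mulrDl lerD2r ler_wpM2l // ltW.
Qed.

Section GoodPlace.
Variables (n N k1 : nat) (phi : nat -> {poly F}) (p : {poly F}) (eta : nat -> {poly F}).
Let k := (n * k1).+1.
Let de := (size p).-1.
Hypothesis n0 : (0 < n)%N.
Hypothesis phi_size : forall i, (i < n)%N -> (size (phi i) <= k1.+1)%N.
Hypothesis eta_size : forall i, (i < n)%N -> (size (eta i) <= N * de - k)%N.

Lemma monic_root_upper : exists2 C : algR, 0 <= C & forall t e,
  e ^+ n + \sum_(i < n) (phi i).[t] * e ^+ i = 0 -> abs e <= C * ht t ^+ k1.
Proof.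
have hphi (i : 'I_n) := poly_upper (phi_size (ltn_ord i)).
have [Cp Cp0 hCp] := fin_all_exists2 hphi.
exists (2 + \sum_i Cp i); first by rewrite addr_ge0 ?ler0n ?sumr_ge0.
case: n n0 phi_size hphi Cp Cp0 hCp => // n' _ _ _ Cp Cp0 hCp t e E.
have T1 := exprn_ege1 k1 (ht_ge1 t).
pose be := \sum_i Cp i * ht t ^+ k1.
apply: le_trans (_ : 1 + (be + 1) / nm 1 <= _).
  apply: (@root_bound (s e) 1 0 n' (fun i => s (phi i).[t]) be).
  - exact: oner_neq0.
  - by rewrite nm0 ler01.
  - by apply: ler_sum => i _; apply: hCp.
  transitivity (s (e ^+ n'.+1 + \sum_(i < n'.+1) (phi i).[t] * e ^+ i)); last by rewrite E rmorph0.
  rewrite mul1r addrC rmorphD rmorphXn rmorph_sum.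
  by congr (_ + _); apply: eq_bigr => i _; rewrite rmorphM rmorphXn.
rewrite nm1 divr1 /be -mulr_suml mulrDl.
set S := _ * _; lra.
Qed.

(** The gap k in the degrees of the eta_i exceeds by 1 the growth n k1 of the
    powers of e, which leaves a factor 1 + |t| to spare. *)
Lemma good_place_bound (C0 : algR) : 0 <= C0 -> exists2 C : algR, 0 <= C &
  forall t e G, e ^+ n + \sum_(i < n) (phi i).[t] * e ^+ i = 0 ->
    p.[t] ^+ N * G = \sum_(i < n) (eta i).[t] * e ^+ i ->
    ht t ^+ de <= C0 * abs p.[t] -> ht t * abs G <= C.
Proof.
move=> C00; have [C1 C10 he] := monic_root_upper.
have heta (i : 'I_n) := poly_upper_gap (eta_size (ltn_ord i)).
have [Ce Ce0 hCe] := fin_all_exists2 heta.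
pose C3 := \sum_i Ce i * C1 ^+ i.
have C30 : 0 <= C3 by apply: sumr_ge0 => i _; rewrite mulr_ge0 // exprn_ge0.
exists (C3 * C0 ^+ N); first by rewrite mulr_ge0 // exprn_ge0.
move=> t e G E1 E2 good.
have T0 := ht_gt0 t; have T1 := ht_ge1 t.
have p_gt0 : 0 < abs p.[t].
  rewrite lt_def nm_ge0 andbT; apply/negP => /eqP z.
  have := lt_le_trans (exprn_gt0 de T0) good.
  by rewrite z mulr0 ltxx.
have pN_gt0 : 0 < abs p.[t] ^+ N by rewrite exprn_gt0.
have b1 : ht t ^+ k * (abs p.[t] ^+ N * abs G) <= C3 * ht t ^+ (N * de) * ht t ^+ (n * k1).
  rewrite -absX -absM E2; apply: le_trans (ler_wpM2l (htX_ge0 t k) (abs_sum _ _)) _.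
  rewrite mulr_sumr /C3 !mulr_suml; apply: ler_sum => i _.
  rewrite absM absX mulrCA mulrA -[leRHS]mulrA -[leRHS]mulrA.
  rewrite [C1 ^+ i * _]mulrCA [leRHS]mulrA [abs _ * _]mulrC.
  rewrite [ht t ^+ k * _]mulrC; apply: ler_pM; rewrite ?mulr_ge0 ?nm_ge0 ?htX_ge0 ?exprn_ge0 ?nm_ge0 //.
  apply: le_trans (_ : (C1 * ht t ^+ k1) ^+ i <= _).
    by rewrite lerXn2r ?nnegrE ?nm_ge0 ?mulr_ge0 ?htX_ge0 //; apply: he.
  rewrite exprMn ler_wpM2l ?exprn_ge0 // -exprM.
  apply: ler_weXn2l => //; rewrite mulnC leq_mul2r ltnW ?orbT //.
have b2 : ht t * abs G * abs p.[t] ^+ N <= C3 * ht t ^+ (N * de).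
  have Tn : 0 < ht t ^+ (n * k1) by rewrite exprn_gt0.
  rewrite -(ler_pM2r Tn); apply: le_trans b1; rewrite /k exprS.
  by rewrite le_eqVlt; apply/orP; left; apply/eqP; ring.
rewrite -(ler_pM2r pN_gt0); apply: le_trans b2 _.
rewrite -mulrA ler_wpM2l // -exprMn mulnC exprM.
by rewrite lerXn2r ?nnegrE ?htX_ge0 // mulr_ge0 ?nm_ge0.
Qed.

End GoodPlace.

End Place.

(** * Integral points on a Runge curve *)
Section Denominators.
Variable K : fieldExtType rat.
Local Notation OK := (@ring_of_integers K).

Let OK0 : OK 0. Proof. exact: integral0. Qed.
Let OKD a b : OK a -> OK b -> OK (a + b). Proof. exact: integral_add. Qed.

Lemma integersN a : OK a -> OK (- a).
Proof. by move=> h; rewrite -[- a]add0r; apply: integersB. Qed.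
Lemma integers_nat n : OK n%:R.
Proof.
elim: n => [|n IH]; first exact: OK0.
by rewrite -natr1; apply: OKD => //; apply: integers1.
Qed.

(** If l is the leading coefficient of an integral polynomial vanishing at a,
    then l a is integral by [shifted_equation]. *)
Lemma denominator (a : K) : exists2 n : nat, (0 < n)%N & OK (n%:R * a).
Proof.
have /polyOver1P [q hq] := minPolyOver 1%AS a.
have [p [c c0 hp]] := rat_poly_scale q.
have root_p : (map_poly intr p : {poly K}).[a] = 0.
  have : root (minPoly 1%AS a) a := root_minPoly _ _.
  rewrite hq hp map_polyZ rootZ; last by rewrite fmorph_eq0 invr_eq0 intr_eq0.
  rewrite -map_poly_comp => /eqP <-; congr _.[_]; apply: eq_map_poly => x.
  exact: esym (rmorph_int (in_alg K) x).
have q0 : q != 0.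
  by apply: contra (monic_neq0 (monic_minPoly 1%AS a)) => /eqP z0; rewrite hq z0 map_poly0.
have p0 : p != 0 by apply: contra q0 => /eqP z0; rewrite hp z0 map_poly0 scaler0.
have K0 := number_field_char0 K.
have cK x : (x%:~R == 0 :> K) = (x == 0).
  by rewrite -(rmorph_int (in_alg K)) fmorph_eq0 intr_eq0.
set l := lead_coef p.
have l0 : l != 0 by rewrite lead_coef_eq0.
have [n sp] : exists n, size p = n.+1.
  by case: (size p) (size_poly_eq0 p) => [|n]; [rewrite eqxx (negPf p0)|exists n].
have lE : p`_n = l by rewrite /l /lead_coef sp.
have eqa : l%:~R * a ^+ n + \sum_(i < n) (p`_i)%:~R * a ^+ i = 0 :> K.
  rewrite -[RHS]root_p (horner_coef_wide (n := n.+1)) ?(leq_trans (size_poly _ _)) ?sp //.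
  by rewrite big_ord_recr /= addrC coef_map /= lE; congr (_ + _); apply: eq_bigr => i _; rewrite coef_map.
have n0 : (0 < n)%N.
  case: n sp lE eqa => // sp lE; rewrite big_ord0 addr0 mulr1 => /eqP.
  by rewrite cK (negPf l0).
have int : OK (l%:~R * a).
  pose w : {rmorphism {poly int} -> K} := ev1 intr 0.
  have := @shifted_equation int n (fun i => (p`_i)%:P) l%:P n0 K w a.
  rewrite /w ev1C => /(_ _) E.
  have {E} := E _; rewrite (eq_bigr (fun i : 'I_n => (p`_i)%:~R * a ^+ i)) => [E|i _]; last by rewrite ev1C.
  have {}E := E eqa.
  exists ('X^n + \poly_(i < n) (p`_i * l ^+ (n.-1 - i))).
    by rewrite monicE lead_coefDl ?lead_coefXn // size_polyXn ltnS size_poly.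
  apply/eqP; rewrite -[RHS]E rmorphD /= map_polyXn hornerD hornerXn; congr (_ + _).
  rewrite (horner_coef_wide (n := n)) ?(leq_trans (size_poly _ _)) ?size_poly //.
  apply: eq_bigr => i _; rewrite coef_map coef_poly ltn_ord /shifted_coef.
  by rewrite -polyC_exp -polyCM ev1C.
have [m hm] : exists m : nat, l = m%:Z \/ l = - m%:Z.
  by case: (l) => m; [exists m; left | exists m.+1; right; rewrite NegzE].
exists m.
  by rewrite lt0n; apply: contra l0 => /eqP z0; case: hm => ->; rewrite z0.
case: hm int => ->; first by [].
by rewrite mulrNz mulNr => /integersN; rewrite opprK.
Qed.

Lemma denominator_mul n m (a : K) : OK (n%:R * a) -> OK ((n * m)%:R * a).
Proof.
by move=> h; rewrite mulnC natrM -mulrA; apply: integersM => //; apply: integers_nat.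
Qed.

Lemma eval_denominator (g : {poly {poly K}}) : exists2 n : nat, (0 < n)%N &
  forall t y, OK t -> OK y -> OK (n%:R * ev2 idfun t y g).
Proof.
elim/poly_ind: g => [|g c [n n0 hn]].
  by exists 1%N => // t y _ _; rewrite rmorph0 mulr0.
have [m m0 hm] : exists2 m : nat, (0 < m)%N & forall t, OK t -> OK (m%:R * c.[t]).
  elim/poly_ind: c => [|c a [m m0 hm]].
    by exists 1%N => // t _; rewrite horner0 mulr0.
  have [k k0 hk] := denominator a.
  exists (m * k)%N; first by rewrite muln_gt0 m0.
  move=> t it; rewrite hornerD hornerMX hornerC mulrDr; apply: OKD; last first.
    by rewrite mulnC; apply: denominator_mul.
  by rewrite mulrA; apply: integersM => //; apply: denominator_mul; apply: hm.
exists (n * m)%N; first by rewrite muln_gt0 n0.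
move=> t y it iy; rewrite [ev2 _ _ _ _]rmorphD [ev2 _ _ _ (g * 'X)]rmorphM ev2X ev2C ev1_idfun mulrDr; apply: OKD; last first.
  by rewrite mulnC; apply: denominator_mul; apply: hm.
by rewrite mulrA; apply: integersM => //; apply: denominator_mul; apply: hn.
Qed.

End Denominators.

Lemma sum_ge_term (T : finType) (f : T -> algR) x : (forall y, 0 <= f y) ->
  f x <= \sum_y f y.
Proof. by move=> f0; rewrite (bigD1 x) //= lerDl sumr_ge0. Qed.

(** There is one more p_j than there are embeddings, and at each embedding at
    most one of them is not good, so some j is good everywhere.  If g_j is
    nonzero at the point, the norm of its multiple by a denominator is at
    least 1, while each factor is bounded by a constant over |t|; otherwise the
    point is a zero of the resultant be j. *)
Lemma runge_bounded (K : fieldExtType rat) r (s : 'I_r.+1 -> {rmorphism K -> algC})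
    (P Q z : {mpoly K[2]}) :
  (forall a, ring_of_integers a -> a != 0 -> 1 <= \prod_i nm (s i a)) ->
  jacobian_det P Q = 1 -> ~ integral_along_v P Q z ->
  exists Pi : {poly {poly {poly K}}}, ev3 (@mpolyC 2 K) P Q z Pi = 0 /\
  exists (th : nat) (h0 : {poly K}) (L : algR), forall t y,
    ring_of_integers t -> ring_of_integers y ->
    let u := ('X^2 * h0).[t] in
    ev3 idfun u (t - th%:R * u) y Pi = 0 -> \prod_i nm (s i t) <= L.
Proof.
move=> prod1 jac1 nint.
have [Pi [Pi0 [th [h [D [n [N [k1 [k [phi [p [be [g [eta]]]]]]]]]]]]]] :=
  runge_curve (number_field_char0 K) (s 0) jac1 r.+2 nint.
case=> -[n0 kE] [h0 hE] sphi hj hpt.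
exists Pi; split=> //; exists th, h0.
pose de j := (size (p j)).-1.
have cop_bound (x : 'I_r.+1 * ('I_r.+2 * 'I_r.+2)) : exists2 C : algR, 0 <= C &
    x.2.1 != x.2.2 -> forall t,
      (1 + nm (s x.1 t)) ^+ de x.2.1 <= C * nm (s x.1 (p x.2.1).[t]) \/
      (1 + nm (s x.1 t)) ^+ de x.2.2 <= C * nm (s x.1 (p x.2.2).[t]).
  case: x => i [j j'] /=.
  have [->|jj] := eqVneq j j'; first by exists 0.
  have [m1 _ _ _ _] := hj j; have [m2 _ _ cop _] := hj j'.
  by have [C C0 hC] := coprime_lower (s i) (monic_neq0 m1) (monic_neq0 m2) (cop j jj); exists C.
have [Cf Cf0 hCf] := fin_all_exists2 cop_bound.
pose C0 := \sum_x Cf x.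
have C00 : 0 <= C0 by apply: sumr_ge0.
pose good i j t := (1 + nm (s i t)) ^+ de j <= C0 * nm (s i (p j).[t]).
have good2 i j j' t : j != j' -> good i j t \/ good i j' t.
  move=> jj; case: (hCf (i, (j, j')) jj t) => /= h1; [left|right];
    by apply: le_trans h1 _; rewrite ler_wpM2r ?nm_ge0 ?sum_ge_term.
have pigeon t : exists j, forall i, good i j t.
  apply: NNPP => nogood.
  have bad j : exists i, ~~ good i j t.
    apply: NNPP => nb; apply: nogood; exists j => i.
    by apply: contraT => ngood; case: nb; exists i.
  have [b hb] := fin_all_exists bad.
  have binj : injective b.
    move=> j j' e; apply/eqP; apply: contraT => jj.
    by case: (good2 (b j) j j' t jj) => hg; [have := hb j|have := hb j'; rewrite -e]; rewrite hg.
  by have := leq_card b binj; rewrite !card_ord ltnn.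
have g_bound (x : 'I_r.+1 * 'I_r.+2) : exists2 C : algR, 0 <= C &
    forall t y, ev3 idfun h.[t] (t - th%:R * h.[t]) y Pi = 0 -> good x.1 x.2 t ->
      (1 + nm (s x.1 t)) * nm (s x.1 (ev2 idfun t y (g x.2))) <= C.
  case: x => i j /=; have [_ _ _ _ seta] := hj j.
  rewrite kE in seta.
  have [C C0' hC] := good_place_bound (s i) n0 sphi seta C00; exists C => // t y E hg.
  have [E1 /(_ j) [E2 _]] := hpt t y E.
  exact: hC E1 E2 hg.
have [C1f C1f0 hC1f] := fin_all_exists2 g_bound.
pose C1 := \sum_x C1f x.
have C10 : 0 <= C1 by apply: sumr_ge0.
have [nf nf0 hnf] := fin_all_exists2 (fun j => eval_denominator (g j)).
pose n1 := (\sum_j nf j)%N.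
have root_place (x : 'I_r.+1 * 'I_r.+2) : exists2 M : algR, 0 <= M &
    forall t, (be x.2).[t] = 0 -> nm (s x.1 t) <= M.
  case: x => i j /=; have [_ _ b0 _ _] := hj j.
  have [M [C [M0 _ hM]]] := poly_lower (s i) b0; exists M => // t bt.
  rewrite leNgt; apply/negP => /ltW /hM; rewrite bt rmorph0 nm0 mulr0 leNgt.
  by rewrite exprn_gt0 // ht_gt0.
have [Mf Mf0 hMf] := fin_all_exists2 root_place.
pose M := \sum_x Mf x.
have prodC (c : algR) (f : 'I_r.+1 -> algR) :
    (forall i, 0 <= f i <= c) -> \prod_i f i <= c ^+ r.+1.
  move=> hf; apply: le_trans (_ : \prod_(i < r.+1) c <= _).
    by apply: ler_prod => i _; apply: hf.
  by rewrite prodr_const card_ord.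
exists ((n1%:R * C1) ^+ r.+1 + M ^+ r.+1) => t y it iy u.
rewrite /u -hE => E.
have [j goodj] := pigeon t.
have [E1 /(_ j) [E2 E3]] := hpt t y E.
have [g0|gn] := eqVneq (ev2 idfun t y (g j)) 0.
  have bt := E3 g0; apply: le_trans (_ : M ^+ r.+1 <= _); last first.
    by rewrite lerDr exprn_ge0 // mulr_ge0 ?ler0n.
  apply: prodC => i; rewrite nm_ge0 /=.
  by apply: le_trans (hMf (i, j) t bt) _; apply: sum_ge_term.
apply: le_trans (_ : (n1%:R * C1) ^+ r.+1 <= _); last first.
  by rewrite lerDl exprn_ge0 // sumr_ge0.
have nf_n (x : 'I_r.+2) : ((nf x)%:R : algR) <= n1%:R.
  by rewrite ler_nat /n1 (bigD1 x) //= leq_addr.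
have nfj0 : ((nf j)%:R : K) != 0.
  by rewrite ((pcharf0P K).1 (number_field_char0 K)) -lt0n.
have G1 := prod1 _ (hnf j t y it iy) (mulf_neq0 nfj0 gn).
have tprod : 0 <= \prod_i nm (s i t) by apply: prodr_ge0 => i _; apply: nm_ge0.
apply: le_trans (ler_peMr tprod G1) _; rewrite -big_split /=.
apply: prodC => i; rewrite mulr_ge0 ?nm_ge0 //=.
rewrite rmorphM rmorph_nat nmM nm_nat mulrCA; apply: ler_pM; rewrite ?ler0n ?mulr_ge0 ?nm_ge0 //.
apply: le_trans (_ : C1f (i, j) <= _); last exact: sum_ge_term.
apply: le_trans (hC1f (i, j) t y E (goodj i)) => /=.
by rewrite ler_wpM2r ?nm_ge0 // lerDr ler01.
Qed.

(** * Rescaling *)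
Section Chain.
Variable R : comNzRingType.
Implicit Types f g A B : {mpoly R[2]}.

Lemma mderiv_var (k j : 'I_2) : ('X_k : {mpoly R[2]})^`M(j) = (k == j)%:R.
Proof.
rewrite mderivX mnm1E; case: eqP => [->|_]; last by rewrite scale0r.
by rewrite scale1r (_ : (_ - _)%MM = 0%MM) ?mpolyX0 //; apply/mnmP => l; rewrite mnmBE subnn mnm0E.
Qed.

Lemma mderiv_comp f A B i : (f \mPo [tuple A; B])^`M(i)
  = (f^`M(0) \mPo [tuple A; B]) * A^`M(i) + (f^`M(1) \mPo [tuple A; B]) * B^`M(i).
Proof.
have [t ->] := mpoly2_ev f.
have dE j p q : (ev2 (@mpolyC 2 R) p q t)^`M(j)
    = ev2 (@mpolyC 2 R) p q (map_poly (@deriv R) t) * p^`M(j)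
      + ev2 (@mpolyC 2 R) p q t^`() * q^`M(j).
  apply: (@deriv_ev2 _ _ (@mpolyC 2 R) (mderiv j)).
  - exact: mderivD.
  - exact: mderivM.
  - exact: mderivC.
rewrite comp_ev2 !dE !mderiv_var /= !mulr1 !mulr0 addr0 add0r !comp_ev2 //.
Qed.

Lemma jacobian_comp f g A B :
  jacobian_det (f \mPo [tuple A; B]) (g \mPo [tuple A; B])
  = (jacobian_det f g \mPo [tuple A; B]) * jacobian_det A B.
Proof. rewrite /jacobian_det !mderiv_comp rmorphB !rmorphM /=; ring. Qed.

Lemma comp_at0 f A B : A@_0%MM = 0 -> B@_0%MM = 0 ->
  (f \mPo [tuple A; B])@_0%MM = f@_0%MM.
Proof.
move=> A0 B0; have [t ->] := mpoly2_ev f; rewrite comp_ev2.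
pose c0 : {rmorphism {mpoly R[2]} -> R} := mcoeff 0%MM.
have cA : c0 A = 0 := A0; have cB : c0 B = 0 := B0.
have cX i : c0 'X_i = 0 by rewrite [LHS]mcoeffX -mdeg_eq0 mdeg1.
rewrite -[LHS]/(c0 _) -[RHS]/(c0 _) !(rmorph_ev2 _ c0).
by rewrite cA cB !cX.
Qed.

End Chain.

Section Scaling.
Variables (F : fieldType) (lam : F).
Hypothesis lam0 : lam != 0.

(** The polynomial lam^-1 R (lam X), for R without constant term. *)
Definition rescale (R : {mpoly F[2]}) : {mpoly F[2]} :=
  \sum_(m <- msupp R) (lam ^+ (mdeg m).-1 * R@_m) *: 'X_[m].

Lemma mcoeff_rescale R m : (rescale R)@_m = lam ^+ (mdeg m).-1 * R@_m.
Proof.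
rewrite /rescale raddf_sum /=.
have [mR|mR] := boolP (m \in msupp R).
  rewrite (bigD1_seq m) ?msupp_uniq //= big1 => [|k km].
    by rewrite mcoeffZ mcoeffX eqxx mulr1 addr0.
  by rewrite mcoeffZ mcoeffX (negPf km) mulr0.
rewrite (memN_msupp_eq0 mR) mulr0 big_seq big1 // => k kR.
rewrite mcoeffZ mcoeffX; case: eqP => [e|_]; last by rewrite mulr0.
by move: mR; rewrite -e kR.
Qed.

Lemma rescale_comp (R : {mpoly F[2]}) : R@_0%MM = 0 ->
  lam *: rescale R = R \mPo [tuple lam *: 'X_0; lam *: 'X_1].
Proof.
move=> R0; rewrite comp_mpolyE /rescale scaler_sumr big_seq [RHS]big_seq.
apply: eq_bigr => m mR; rewrite scalerA !big_ord_recl big_ord0 mulr1.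
have -> : lift ord0 ord0 = 1 :> 'I_2 by apply: val_inj.
rewrite !(tnth_nth 0) /= !exprZn mpolyX2.
rewrite -scalerAl -scalerAr !scalerA; congr (_ *: _).
have -> : mdeg m = (m 0%R + m 1%R)%N.
  rewrite mdegE !big_ord_recl big_ord0 addn0; congr (_ + m _)%N; exact: val_inj.
have m0 : (m 0%R + m 1%R)%N != 0%N.
  apply: contraTneq mR => h; rewrite mcoeff_msupp negbK -R0; apply/eqP; congr (R@_ _).
  by apply/mnmP => i; rewrite mnm0E; case: (ord2P i) => ->; lia.
by rewrite mulrA -exprS prednK ?lt0n // -mulrA -exprD mulrC.
Qed.

Lemma jacobian_rescale (R1 R2 : {mpoly F[2]}) : R1@_0%MM = 0 -> R2@_0%MM = 0 ->
  jacobian_det R1 R2 = 1 -> jacobian_det (rescale R1) (rescale R2) = 1.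
Proof.
move=> R10 R20 j1.
have : jacobian_det (lam *: rescale R1) (lam *: rescale R2) = (lam * lam)%:MP.
  rewrite !rescale_comp // jacobian_comp j1 rmorph1 mul1r.
  rewrite /jacobian_det !mderivZ !mderiv_var /= !scaler0 mulr0 subr0.
  by rewrite -scalerAl -scalerAr scalerA mulr1 -mul_mpolyC mulr1.
have -> : jacobian_det (lam *: rescale R1) (lam *: rescale R2)
    = (lam * lam)%:MP * jacobian_det (rescale R1) (rescale R2).
  rewrite mpolyCM /jacobian_det !mderivZ -!mul_mpolyC; ring.
move=> e; apply: (mulfI (_ : (lam * lam)%:MP != 0 :> {mpoly F[2]})).
  by rewrite mpolyC_eq0 mulf_neq0.
by rewrite mulr1.
Qed.

Lemma meval_rescale (R : {mpoly F[2]}) v : R@_0%MM = 0 ->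
  lam * (rescale R).@[v] = R.@[fun i => lam * v i].
Proof.
move=> R0; rewrite -mevalZ rescale_comp // comp_mpoly_meval; apply: meval2_eq.
  by rewrite /= mevalZ mevalXU.
by rewrite /= mevalZ mevalXU.
Qed.

End Scaling.

(** * A map with a single integral point *)
Section SingleIntegralPoint.
Variable K : fieldExtType rat.
Local Notation OK := (@ring_of_integers K).

Let OK0 : OK 0. Proof. exact: integral0. Qed.
Let OKD a b : OK a -> OK b -> OK (a + b). Proof. exact: integral_add. Qed.
Let OKX a n : OK a -> OK (a ^+ n).
Proof. exact: (subringX (@integers1 K) (@integersM K)). Qed.

Lemma common_denominator (l : seq K) : exists2 n : nat, (0 < n)%N &
  forall x, x \in l -> OK (n%:R * x).
Proof.
elim: l => [|a l [n n0 hn]]; first by exists 1%N.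
have [m m0 hm] := denominator a.
exists (n * m)%N; first by rewrite muln_gt0 n0.
move=> x; rewrite inE => /orP[/eqP ->|xl]; last by apply: denominator_mul; apply: hn.
by rewrite mulnC; apply: denominator_mul.
Qed.

Definition twice_integral (a : K) := exists2 d, OK d & a = 2 * d.

(** Every monomial of H contains one of the variables, which is factored out. *)
Lemma twice_integral_value (H : {mpoly K[2]}) (v : 'I_2 -> K) : H@_0%MM = 0 ->
  (forall m, twice_integral H@_m) -> (forall i, OK (v i)) ->
  exists A B, [/\ OK A, OK B & H.@[v] = 2 * (A * v 0 + B * v 1)].
Proof.
move=> H0 ev iv; rewrite mevalE.
elim/big_ind: _ => [|x y [A1 [B1 [a1 b1 ->]]] [A2 [B2 [a2 b2 ->]]]|m _].
- by exists 0, 0; split=> //; rewrite !mul0r addr0 mulr0.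
- by exists (A1 + A2), (B1 + B2); split; try exact: OKD; ring.
rewrite !big_ord_recl big_ord0 mulr1.
have -> : lift ord0 ord0 = 1 :> 'I_2 by apply: val_inj.
have [d id hd] := ev m.
have ivX i n : OK (v i ^+ n) by apply: OKX.
case e0: (m 0) => [|n0]; last first.
  exists (d * v 0 ^+ n0 * v 1 ^+ m 1), 0; split=> //.
    by do 2 apply: integersM => //.
  by rewrite hd exprS mul0r addr0; ring.
case e1: (m 1) => [|n1]; last first.
  exists 0, (d * v 1 ^+ n1); split=> //; first exact: integersM.
  by rewrite hd exprS expr0 mul0r add0r; ring.
exists 0, 0; split=> //; rewrite (_ : m = 0%MM) ?H0 ?mul0r ?addr0 ?mulr0 //.
by apply/mnmP => i; rewrite mnm0E; case: (ord2P i) => ->.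
Qed.

Variables (r : nat) (s : 'I_r.+1 -> {rmorphism K -> algC}).
Hypothesis prod1 : forall a, OK a -> a != 0 -> 1 <= \prod_i nm (s i a).

(** Otherwise w = - 1/2 would be integral, with all absolute values below 1. *)
Lemma odd_neq0 w : OK w -> 1 + 2 * w != 0.
Proof.
move=> iw; apply/negP => /eqP e.
have w0 : w != 0.
  by apply/eqP => z; move: e; rewrite z mulr0 addr0 => /eqP; rewrite oner_eq0.
have hw i : 2 * nm (s i w) = 1.
  have : s i (2 * w) = -1 by rewrite (_ : 2 * w = -1) ?rmorphN1 //; apply/eqP; rewrite -addr_eq0 addrC e.
  by rewrite rmorphM rmorph_nat => /(congr1 nm); rewrite nmM nm_nat nmN nm1.
have := prod1 iw w0; rewrite leNgt => /negP; apply.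
rewrite (eq_bigr (fun=> 2^-1)) => [|i _]; last first.
  by apply: (mulfI (_ : 2 != 0)); rewrite ?hw ?divff // pnatr_eq0.
by rewrite prodr_const card_ord exprn_ilt1 ?invr_ge0 ?ler0n ?invf_lt1 ?ltr0n ?ltr1n.
Qed.

(** The equations are linear in v, with matrix congruent to the identity modulo
    2; its determinant is not zero by [odd_neq0]. *)
Lemma tangent_id_zero (G1 G2 : {mpoly K[2]}) (v : 'I_2 -> K) :
  G1@_0%MM = 0 -> G2@_0%MM = 0 ->
  (forall m, twice_integral (G1 - 'X_0)@_m) -> (forall m, twice_integral (G2 - 'X_1)@_m) ->
  (forall i, OK (v i)) -> G1.@[v] = 0 -> G2.@[v] = 0 -> v 0 = 0 /\ v 1 = 0.
Proof.
move=> G10 G20 e1 e2 iv z1 z2.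
have X0 i : ('X_i : {mpoly K[2]})@_0%MM = 0 by rewrite mcoeffX -mdeg_eq0 mdeg1.
have [|A1 [B1 [iA1 iB1]]] := twice_integral_value _ e1 iv; first by rewrite mcoeffB G10 X0 subr0.
have [|A2 [B2 [iA2 iB2]]] := twice_integral_value _ e2 iv; first by rewrite mcoeffB G20 X0 subr0.
rewrite !mevalB !mevalXU z1 z2 !sub0r => h2 h1.
pose w := A1 + B2 + 2 * (A1 * B2 - B1 * A2).
have iw : OK w.
  apply: OKD; first exact: OKD.
  by apply: integersM; [apply: integers_nat | apply: integersB; apply: integersM].
have wn := odd_neq0 iw.
split; apply: (mulfI wn); rewrite mulr0.
  transitivity ((1 + 2 * B2) * (v 0 + 2 * (A1 * v 0 + B1 * v 1))
                - 2 * B1 * (v 1 + 2 * (A2 * v 0 + B2 * v 1))); first by rewrite /w; ring.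
  by rewrite -h1 -h2 !subrr !mulr0 subrr.
transitivity ((1 + 2 * A1) * (v 1 + 2 * (A2 * v 0 + B2 * v 1))
              - 2 * A2 * (v 0 + 2 * (A1 * v 0 + B1 * v 1))); first by rewrite /w; ring.
by rewrite -h1 -h2 !subrr !mulr0 subrr.
Qed.

(** The scaling multiplies a coefficient of degree d by a power d - 1 of 2 D k,
    so all those of degree at least 2 become divisible by 2. *)
Lemma rescale_twice_integral (R : {mpoly K[2]}) (i : 'I_2) D k :
  R@_0%MM = 0 -> (forall j : 'I_2, R@_(U_(j)) = (i == j)%:R) ->
  (forall m, OK (D%:R * R@_m)) ->
  forall m, twice_integral (rescale (2 * D * k)%:R R - 'X_i)@_m.
Proof.
move=> R0 R1 iR m; rewrite mcoeffB mcoeff_rescale mcoeffX.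
case e: (mdeg m) => [|[|n]].
- move/eqP: e; rewrite mdeg_eq0 => /eqP ->; rewrite R0 mulr0 -mdeg_eq0 mdeg1.
  by exists 0 => //; rewrite mulr0 subrr.
- move/eqP: e => /mdeg1P [j /eqP ->]; rewrite expr0 mul1r R1.
  exists 0 => //; rewrite mulr0 (_ : (U_(i)%MM == U_(j)%MM) = (i == j)) ?subrr //.
  apply/eqP/eqP => [/(congr1 (fun m : 'X_{1..2} => m j))|-> //].
  by rewrite !mnm1E eqxx; case: eqP.
have -> : (U_(i)%MM == m) = false.
  by apply/negbTE; apply: contra_eq_neq e => <-; rewrite mdeg1.
exists (k%:R * (2 * D * k)%:R ^+ n * (D%:R * R@_m)).
  apply: integersM => //; apply: integersM; first exact: integers_nat.
  by apply: OKX; apply: integers_nat.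
by rewrite subr0 /= exprS !natrM; ring.
Qed.

End SingleIntegralPoint.

Lemma linear_coef (R : comNzRingType) (f : {mpoly R[2]}) j :
  f@_(U_(j)) = (f^`M(j))@_0%MM.
Proof. by rewrite mcoeff_mderiv add0m mnm0E mulr1n. Qed.

Lemma linear_coef_comp (R : comNzRingType) (f A B : {mpoly R[2]}) j :
  A@_0%MM = 0 -> B@_0%MM = 0 -> (f \mPo [tuple A; B])@_(U_(j))
    = f@_(U_(0)) * A@_(U_(j)) + f@_(U_(1)) * B@_(U_(j)).
Proof.
move=> A0 B0; have [mM _] := mcoeff0_is_multiplicative 2 R.
by rewrite !linear_coef mderiv_comp mcoeffD !mM !comp_at0.
Qed.

Lemma jacobian_shear (R : comNzRingType) (P Q : {mpoly R[2]}) c (h : {poly R}) :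
  jacobian_det (P - ev1 (@mpolyC 2 R) (Q + c *: P) h) (Q + c *: P) = jacobian_det P Q.
Proof.
set Q' := Q + c *: P.
have anti (A B : {mpoly R[2]}) : jacobian_det A B = - jacobian_det B A.
  by rewrite /jacobian_det; ring.
rewrite anti jacobianD jacobianN.
rewrite (deriv_ev1 (jacobianD _) (jacobianM _) (jacobianC _)) jacobian_self mulr0 oppr0 addr0.
by rewrite -anti /Q' jacobianD jacobianZ jacobian_self scaler0 addr0.
Qed.

Lemma jacobian_linear (R : comNzRingType) (a b c e : R) :
  jacobian_det (e *: 'X_0 - b *: 'X_1) (a *: 'X_1 - c *: 'X_0) = (e * a - b * c)%:MP.
Proof.
have d0 (x y : R) : (x *: 'X_0 - y *: 'X_1 : {mpoly R[2]})^`M(0) = x%:MP.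
  by rewrite mderivB !mderivZ !mderiv_var /= scaler0 subr0 -mul_mpolyC mulr1.
have d1 (x y : R) : (x *: 'X_0 - y *: 'X_1 : {mpoly R[2]})^`M(1) = - y%:MP.
  by rewrite mderivB !mderivZ !mderiv_var /= scaler0 sub0r -mul_mpolyC mulr1.
rewrite /jacobian_det -[a *: _ - _]opprB !mderivN !d0 !d1 opprK mulrNN.
by rewrite -!mpolyCM -mpolyCB.
Qed.

Lemma inverse_matrix2 (R : comNzRingType) (a b c e : R) : a * e - b * c = 1 ->
  [/\ a * (e * 1 - b * 0) + b * (a * 0 - c * 1) = 1,
      a * (e * 0 - b * 1) + b * (a * 1 - c * 0) = 0,
      c * (e * 1 - b * 0) + e * (a * 0 - c * 1) = 0
    & c * (e * 0 - b * 1) + e * (a * 1 - c * 0) = 1].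
Proof. by move=> h; split; rewrite -?[RHS]h; ring. Qed.

Section TwoPoints.
Variable K : fieldExtType rat.
Local Notation OK := (@ring_of_integers K).
Hypothesis two_points : forall P Q : {mpoly K[2]},
  integral_coefs P -> integral_coefs Q -> jacobian_det P Q = 1 ->
  exists c d : K * K, c <> d /\ integral_point P c /\ integral_point P d.

(** R1, R2 are the components of F' = (P', Q') precomposed with the inverse of
    its linear part, and G1, G2 those of the rescaled map. *)
Lemma coordinates_integral (P Q : {mpoly K[2]}) l :
  jacobian_det P Q = 1 -> P@_0%MM = 0 -> Q@_0%MM = 0 ->
  integral_along_v P Q 'X_l.
Proof.
move=> jac1 P0 Q0; apply: NNPP => nint.
have [r [s prod1]] := embeddings K.
have [Pi [Pi0 [th [h0 [L hL]]]]] := runge_bounded prod1 jac1 nint.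
have [mM m1] := mcoeff0_is_multiplicative 2 K.
pose Q' := Q + th%:R *: P.
pose hq := ev1 (@mpolyC 2 K) Q' ('X^2 * h0).
pose P' := P - hq.
have jac1' : jacobian_det P' Q' = 1 by rewrite jacobian_shear.
have Q'0 : Q'@_0%MM = 0 by rewrite mcoeffD mcoeffZ P0 Q0 mulr0 addr0.
have P'0 : P'@_0%MM = 0.
  have hqE : hq = Q' * ev1 (@mpolyC 2 K) Q' ('X * h0).
    by rewrite /hq expr2 -mulrA [LHS]rmorphM ev1X.
  by rewrite mcoeffB P0 hqE mM Q'0 mul0r subr0.
pose a := P'@_(U_(0)); pose b := P'@_(U_(1)).
pose c := Q'@_(U_(0)); pose e := Q'@_(U_(1)).
have det1 : a * e - b * c = 1 by rewrite -jacobian_at0 jac1' m1.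
pose L1 : {mpoly K[2]} := e *: 'X_0 - b *: 'X_1.
pose L2 : {mpoly K[2]} := a *: 'X_1 - c *: 'X_0.
have X0 i : ('X_i : {mpoly K[2]})@_0%MM = 0 by rewrite mcoeffX -mdeg_eq0 mdeg1.
have Xc (i j : 'I_2) : ('X_i : {mpoly K[2]})@_(U_(j)) = (i == j)%:R.
  by rewrite linear_coef mderiv_var -mpolyC_nat mcoeffC eqxx mulr1.
have L10 : L1@_0%MM = 0 by rewrite mcoeffB !mcoeffZ !X0 !mulr0 subr0.
have L20 : L2@_0%MM = 0 by rewrite mcoeffB !mcoeffZ !X0 !mulr0 subr0.
pose R1 := P' \mPo [tuple L1; L2]; pose R2 := Q' \mPo [tuple L1; L2].
have R10 : R1@_0%MM = 0 by rewrite comp_at0.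
have R20 : R2@_0%MM = 0 by rewrite comp_at0.
have jacL : jacobian_det L1 L2 = 1.
  by rewrite jacobian_linear [e * a]mulrC det1.
have jacR : jacobian_det R1 R2 = 1 by rewrite jacobian_comp jac1' rmorph1 jacL mulr1.
have l1 j : L1@_(U_(j)) = e * (0 == j)%:R - b * (1 == j)%:R.
  by rewrite [LHS]mcoeffB [X in X - _]mcoeffZ [X in _ - X]mcoeffZ !Xc.
have l2 j : L2@_(U_(j)) = a * (1 == j)%:R - c * (0 == j)%:R.
  by rewrite [LHS]mcoeffB [X in X - _]mcoeffZ [X in _ - X]mcoeffZ !Xc.
have lin := inverse_matrix2 det1.
have R1l (j : 'I_2) : R1@_(U_(j)) = (0 == j)%:R.
  rewrite (linear_coef_comp _ _ L10 L20) l1 l2 -/a -/b.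
  by case: (ord2P j) => ->; case: lin.
have R2l (j : 'I_2) : R2@_(U_(j)) = (1 == j)%:R.
  rewrite (linear_coef_comp _ _ L10 L20) l1 l2 -/c -/e.
  by case: (ord2P j) => ->; case: lin.
have [D D0 hD] := common_denominator
  ([:: e; b; a; c] ++ [seq R1@_m | m <- msupp R1] ++ [seq R2@_m | m <- msupp R2]).
have OK0 : OK 0 by exact: integral0.
have hR1 m : OK (D%:R * R1@_m).
  have [mR|mR] := boolP (m \in msupp R1); last by rewrite (memN_msupp_eq0 mR) mulr0.
  by apply: hD; rewrite !mem_cat (map_f (fun m => R1@_m) mR) !orbT.
have hR2 m : OK (D%:R * R2@_m).
  have [mR|mR] := boolP (m \in msupp R2); last by rewrite (memN_msupp_eq0 mR) mulr0.
  by apply: hD; rewrite !mem_cat (map_f (fun m => R2@_m) mR) !orbT.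
(* With t = lam t' and t' a nonzero integer of K, the product of the
   absolute values of t is at least lam, which exceeds the Runge bound. *)
pose k := (Num.bound `|L|).+1.
pose lam : K := (2 * D * k)%:R.
have lamL : L < (2 * D * k)%:R.
  apply: le_lt_trans (ler_norm L) _.
  apply: lt_le_trans (archi_boundP (normr_ge0 L)) _.
  rewrite ler_nat; apply: leq_trans (leqnSn _) _.
  by rewrite -/k leq_pmull // muln_gt0.
have lam_gt0 : (0 < 2 * D * k)%N by rewrite !muln_gt0 D0.
have lam0 : lam != 0.
  by rewrite /lam ((pcharf0P K).1 (number_field_char0 K)) -lt0n.
have even1 := rescale_twice_integral (i := 0) k R10 R1l hR1.
have even2 := rescale_twice_integral (i := 1) k R20 R2l hR2.
rewrite -/lam in even1 even2.
pose G1 := rescale lam R1; pose G2 := rescale lam R2.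
have even_int (G : {mpoly K[2]}) i : (forall m, twice_integral (G - 'X_i)@_m) -> integral_coefs G.
  move=> ev m; have [d id hd] := ev m; rewrite -[G](subrK 'X_i) mcoeffD hd mcoeffX.
  apply: integral_add; last exact: integers_nat.
  by apply: integersM => //; apply: integers_nat.
have iG1 : integral_coefs G1 := even_int _ _ even1.
have iG2 : integral_coefs G2 := even_int _ _ even2.
have zero_only p : integral_point G1 p -> p = (0, 0).
  case: p => al be [/= ial ibe z1]; set v := tnth _ in z1.
  have iv i : OK (v i) by case: (ord2P i) => ->.
  pose t' := G2.@[v].
  have it' : OK t' by apply: (meval_in (@integers1 K) (@integersB K) (@integersM K)).
  pose lv i := lam * v i.
  pose w i := (tnth [tuple L1; L2] i).@[lv].
  have wP : P'.@[w] = 0.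
    by rewrite -comp_mpoly_meval -meval_rescale // z1 mulr0.
  have wQ : Q'.@[w] = lam * t'.
    by rewrite -comp_mpoly_meval -meval_rescale.
  have ilam x : x \in [:: e; b; a; c] -> OK (lam * x).
    move=> xl; rewrite /lam -mulnA mulnCA; apply: denominator_mul.
    by apply: hD; rewrite mem_cat xl.
  have iw i : OK (w i).
    have ilv x j : x \in [:: e; b; a; c] -> OK (x * lv j).
      by move=> xl; rewrite mulrA [x * lam]mulrC; apply: integersM => //; apply: ilam.
    by case: (ord2P i) => ->; rewrite /w /= mevalB !mevalZ !mevalXU;
      apply: integersB; apply: ilv; rewrite !inE eqxx ?orbT.
  have tz : t' = 0.
    apply/eqP; apply: contraT => tn.
    have ilt : OK (lam * t') by apply: integersM => //; apply: integers_nat.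
    have evP : ('X^2 * h0).[lam * t'] = P.@[w].
      rewrite -wQ; apply/eqP; rewrite eq_sym -subr_eq0 -wP mevalB /hq; apply/eqP.
      congr (_ - _); rewrite (rmorph_ev1 _ (meval w)).
      by rewrite (@eq_ev1 _ _ _ idfun) ?ev1_idfun // => x; rewrite /= mevalC.
    have evQ : lam * t' - th%:R * P.@[w] = Q.@[w].
      by rewrite -wQ mevalD mevalZ addrK.
    have eqn : ev3 idfun P.@[w] Q.@[w] (w l) Pi = 0.
      transitivity (meval w (ev3 (@mpolyC 2 K) P Q 'X_l Pi)); last by rewrite Pi0 rmorph0.
      rewrite (rmorph_ev3 _ (meval w)) -[w l](mevalXU w l).
      by apply: eq_ev3 => x; rewrite /= mevalC.
    have := hL _ _ ilt (iw l); cbv zeta; rewrite evP evQ => /(_ eqn).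
    rewrite leNgt => /negP; case; apply: lt_le_trans lamL _.
    rewrite (eq_bigr (fun i => (2 * D * k)%:R * nm (s i t'))) => [|i _]; last first.
      by rewrite /lam rmorphM rmorph_nat nmM nm_nat.
    have lam1 : 1 <= (2 * D * k)%:R :> algR by rewrite ler1n.
    rewrite big_split prodr_const card_ord /=.
    apply: le_trans (_ : (2 * D * k)%:R ^+ r.+1 <= _); first by rewrite exprS ler_peMr ?ler0n ?exprn_ege1.
    by rewrite ler_peMr ?prod1 // exprn_ge0 // ler0n.
  have G10 : G1@_0%MM = 0 by rewrite mcoeff_rescale R10 mulr0.
  have G20 : G2@_0%MM = 0 by rewrite mcoeff_rescale R20 mulr0.
  have [va vb] := tangent_id_zero prod1 G10 G20 even1 even2 iv z1 tz.
  by congr (_, _).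
have [p [q [pq [ip iq]]]] := two_points iG1 iG2 (jacobian_rescale lam0 R10 R20 jacR).
by apply: pq; rewrite (zero_only p ip) (zero_only q iq).
Qed.

(** Translations in the target change neither the derivation nor the Jacobian
    determinant; they make [coordinates_integral] applicable. *)
Lemma jacobian_derivation_nilpotent (P Q : {mpoly K[2]}) : jacobian_det P Q = 1 ->
  exists n, forall i, iter n (jacobian_det P) 'X_i = 0.
Proof.
move=> jac1; pose P0 := P - (P@_0%MM)%:MP; pose Q0 := Q - (Q@_0%MM)%:MP.
have jP0 f : jacobian_det P0 f = jacobian_det P f.
  by rewrite /jacobian_det !mderivB !mderivC !subr0.
have jac0 : jacobian_det P0 Q0 = 1.
  by rewrite jP0 jacobianD jacobianN jacobianC oppr0 addr0.
have c0 f : (f - (f@_0%MM)%:MP : {mpoly K[2]})@_0%MM = 0.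
  by rewrite mcoeffB mcoeffC eqxx mulr1 subrr.
have [r [s _]] := embeddings K.
have P00 : P0@_0%MM = 0 by apply: c0.
have Q00 : Q0@_0%MM = 0 by apply: c0.
have rel i : integral_along_v P0 Q0 'X_i := coordinates_integral i jac0 P00 Q00.
have [n hn] := integral_nilpotent (s 0) (number_field_char0 K) jac0 rel.
exists n => i; rewrite -[RHS](hn i); apply: eq_iter => f.
exact: esym (jP0 f).
Qed.

End TwoPoints.

Theorem theorem1 (K : fieldExtType rat) :
  (forall P Q : {mpoly K[2]},
     jacobian_det P Q = 1 -> invertible_map P Q)
  <->
  (forall P Q : {mpoly K[2]},
     integral_coefs P -> integral_coefs Q -> jacobian_det P Q = 1 ->
     exists c d : K * K,
       c <> d /\ integral_point P c /\ integral_point P d).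
Proof.
split=> [inv P Q iP iQ jac1|two_points P Q jac1].
  exact: invertible_two_integral_points (inv P Q jac1).
have jac1' : jacobian_det (- Q) P = 1 by rewrite jacobian_swap.
have [n1 h1] := jacobian_derivation_nilpotent two_points jac1'.
have [n2 h2] := jacobian_derivation_nilpotent two_points jac1.
apply: (@nilpotent_invertible K P Q (maxn n1 n2) (number_field_char0 K) jac1) => i.
  exact: iter_jacobian_ge0 (leq_maxl _ _) (h1 i).
exact: iter_jacobian_ge0 (leq_maxr _ _) (h2 i).
Qed.
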